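(* Let $A$ be an $N\times N$ irreducible matrix with entries in $\{0,1\}$, $N>1$, not a permutation matrix. The isomorphism of groups $f\in C(X_A,\mathbb{Z})\mapsto\rho^{A,f}\in\mathrm{Act}_{\mathcal{D}_A}(\mathbb{R}/\mathbb{Z},\mathcal{O}_A)$ induces an isomorphism $[f]\in H^A\mapsto[\rho^{A,f}]\in\mathrm{Act}_{\mathcal{D}_A}(\mathbb{R}/\mathbb{Z},\mathcal{O}_A)/\!\sim$ of ordered abelian groups.
   Context: $X_A=\{(x_n)_{n\in\mathbb{N}}\in\{1,\dots,N\}^{\mathbb{N}}\mid A(x_n,x_{n+1})=1 \text{ for all } n\}$ with the relative product topology, and $\sigma_A((x_n)_n)=(x_{n+1})_n$. $\mathcal{O}_A$ (Cuntz--Krieger algebra) is the universal unital $C^*$-algebra generated by partial isometries $S_1,\dots,S_N$ with $\sum_{j}S_jS_j^*=1$ and $S_i^*S_i=\sum_{j}A(i,j)S_jS_j^*$. $\mathcal{D}_A\subset\mathcal{O}_A$ is the $C^*$-subalgebra generated by the projections $S_{i_1}\cdots S_{i_n}S_{i_n}^*\cdots S_{i_1}^*$; it is identified with $C(X_A)$ by letting this projection correspond to the characteristic function of the cylinder set $\{x\in X_A\mid x_1=i_1,\dots,x_n=i_n\}$. For $f\in C(X_A,\mathbb{Z})$ and $t\in\mathbb{R}/\mathbb{Z}$, $U_t(f)=\exp(2\pi\sqrt{-1}\,tf)\in\mathcal{D}_A$, and $\rho^{A,f}_t$ is the automorphism of $\mathcal{O}_A$ with $\rho^{A,f}_t(S_i)=U_t(f)S_i$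 for all $i$. $\mathrm{Act}_{\mathcal{D}_A}(\mathbb{R}/\mathbb{Z},\mathcal{O}_A)$ is the set of continuous actions $\alpha$ of $\mathbb{R}/\mathbb{Z}$ on $\mathcal{O}_A$ by automorphisms with $\alpha_t(a)=a$ for all $t\in\mathbb{R}/\mathbb{Z}$, $a\in\mathcal{D}_A$. It is an abelian group under $(\alpha\cdot\beta)_t=\alpha_t\circ\beta_t$, and $f\mapsto\rho^{A,f}$ is a group isomorphism from $C(X_A,\mathbb{Z})$ (pointwise addition) onto it. For $\alpha^1,\alpha^2$ in this set, $\alpha^1\sim\alpha^2$ if there is a unitary one-cocycle relative to $\alpha^2$, i.e. a continuous map $t\in\mathbb{R}/\mathbb{Z}\mapsto u_t\in\mathcal{O}_A$ with $u_t$ unitary and $u_{t+s}=u_t\alpha^2_t(u_s)$, such that $\alpha^1_t=\mathrm{Ad}(u_t)\circ\alpha^2_t$ for all $t$. This is an equivalence relation; $[\alpha]$ is the class of $\alpha$. Order: put $\delta(\alpha)_t=\frac{d}{dt}\bigl(\sum_{i=1}^N\alpha_t(S_i)S_i^*\bigr)$; $\alpha\ge0$ means that $\frac{1}{2\pi\sqrt{-1}}\delta(\alpha)_0$ is a positive operator in $\mathcal{O}_A$ (positive in the $C^*$-algebra sense), and $[\alpha]\ge0$ means that there is $\alpha'\sim\alpha$ in $\mathrm{Act}_{\mathcal{D}_A}(\mathbb{R}/\mathbb{Z},\mathcal{O}_A)$ with $\alpha'\ge0$. $H^A$ is the quotient of $C(X_A,\mathbb{Z})$ by $\{\xi-\xi\circ\sigma_A\mid\xi\in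 C(X_A,\mathbb{Z})\}$, ordered by the positive cone consisting of the classes of nonnegative functions; $[f]$ is the class of $f$. *)

(* Defs.v *)
From HB Require Import structures.
From mathcomp Require Import all_boot all_order all_algebra.
From mathcomp Require Import complex.
From mathcomp Require Import all_classical all_reals all_analysis.
Import Order.TTheory GRing.Theory Num.Theory numFieldNormedType.Exports.

Set Implicit Arguments.
Unset Strict Implicit.
Unset Printing Implicit Defensive.

Local Open Scope classical_set_scope.
Local Open Scope ring_scope.
Local Open Scope quotient_scope.

(* A plain record, since the library has no join of normed modules and rings
   that could be extended; the algebra structure is put on [cstar_car] below.
   Norms take their values in [R[i]], as for any normed module over it. *)
Record cstarType (R : realType) := CStar {
  cstar_mod : completeNormedModType R[i];
  cstar_mul : cstar_mod -> cstar_mod -> cstar_mod;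
  cstar_one : cstar_mod;
  cstar_adj : cstar_mod -> cstar_mod;
  cstar_mulA : associative cstar_mul;
  cstar_mul1x : left_id cstar_one cstar_mul;
  cstar_mulx1 : right_id cstar_one cstar_mul;
  cstar_mulDl : left_distributive cstar_mul +%R;
  cstar_mulDr : right_distributive cstar_mul +%R;
  cstar_one_neq0 : cstar_one != 0;
  cstar_scaleAl : forall (c : R[i]) x y,
    c *: cstar_mul x y = cstar_mul (c *: x) y;
  cstar_scaleAr : forall (c : R[i]) x y,
    c *: cstar_mul x y = cstar_mul x (c *: y);
  cstar_adjD : {morph cstar_adj : x y / x + y};
  cstar_adjZ : forall (c : R[i]) x, cstar_adj (c *: x) = c^* *: cstar_adj x;
  cstar_adjM : forall x y,
    cstar_adj (cstar_mul x y) = cstar_mul (cstar_adj y) (cstar_adj x);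
  cstar_adjK : involutive cstar_adj;
  cstar_normM : forall x y, `|cstar_mul x y| <= `|x| * `|y|;
  cstar_normE : forall x, `|cstar_mul (cstar_adj x) x| = `|x| ^+ 2
}.

Definition cstar_car (R : realType) (A : cstarType R) : Type := cstar_mod A.
Coercion cstar_car : cstarType >-> Sortclass.

Section CStarInstances.
Context {R : realType} (A : cstarType R).

HB.instance Definition _ := CompleteNormedModule.on (cstar_car A).
HB.instance Definition _ := GRing.Zmodule_isNzRing.Build (cstar_car A)
  (@cstar_mulA R A) (@cstar_mul1x R A) (@cstar_mulx1 R A)
  (@cstar_mulDl R A) (@cstar_mulDr R A) (@cstar_one_neq0 R A).
HB.instance Definition _ := GRing.Lmodule_isLalgebra.Build R[i] (cstar_car A)
  (@cstar_scaleAl R A).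
HB.instance Definition _ := GRing.Lalgebra_isAlgebra.Build R[i] (cstar_car A)
  (@cstar_scaleAr R A).

Definition adj (a : A) : A := @cstar_adj R A a.
End CStarInstances.

Section CStarAlgebraTheory.
Context {R : realType}.

Definition star_morphism (A B : cstarType R) (phi : A -> B) : Prop :=
  [/\ linear phi, monoid_morphism phi & {morph phi : x / adj x}].

Definition star_automorphism (A : cstarType R) (phi : A -> A) : Prop :=
  star_morphism phi /\ bijective phi.

Definition cstar_subalgebra (A : cstarType R) (M : set A) : Prop :=
  [/\ M 0,
      forall (c : R[i]) x y, M x -> M y -> M (c *: x + y),
      forall x y, M x -> M y -> M (x * y),
      forall x, M x -> M (adj x)
    & closed M].

Definition cstar_generated (A : cstarType R) (G : set A) : set A :=
  smallest (@cstar_subalgebra A) G.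

Definition partial_isometry (A : cstarType R) (v : A) : Prop :=
  v * adj v * v = v.

Definition unitary (A : cstarType R) (u : A) : Prop :=
  adj u * u = 1 /\ u * adj u = 1.

Definition spectrum (A : cstarType R) (a : A) : set R[i] :=
  [set z | ~ exists b, b * (a - z%:A) = 1 /\ (a - z%:A) * b = 1].

(* In [R[i]], [0 <= z] means that z is real and nonnegative. *)
Definition positive (A : cstarType R) (a : A) : Prop :=
  adj a = a /\ forall z, spectrum a z -> 0 <= z.

End CStarAlgebraTheory.

Section Circle.
Variable R : realType.

Definition int_pred : {pred R} := fun x => x \is a Num.int.

Lemma int_pred_zmod_closed : zmod_closed int_pred.
Proof. by split=> [|x y]; [exact: int_num0|exact: rpredB]. Qed.

HB.instance Definition _ := GRing.isZmodClosed.Build R int_pred int_pred_zmod_closed.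

Definition RZ : Type := Quotient.quot int_pred.
HB.instance Definition _ := GRing.Zmodule.copy RZ (Quotient.quot int_pred).

Definition to_RZ (r : R) : RZ := \pi_(Quotient.quot int_pred) r.
Definition of_RZ (t : RZ) : R := repr (t : Quotient.quot int_pred).

(* The quotient topology; it is declared directly because [quotient_topology]
   does not carry the group structure of the quotient. *)
Definition RZ_open : set_system RZ := [set U | open (to_RZ @^-1` U)].

Lemma RZ_openT : RZ_open setT.
Proof. by rewrite /RZ_open /= preimage_setT; exact: openT. Qed.

Lemma RZ_openI : setI_closed RZ_open.
Proof. by move=> U V ? ?; exact: openI. Qed.

Lemma RZ_open_bigcup (I : Type) (f : I -> set RZ) :
  (forall i, RZ_open (f i)) -> RZ_open (\bigcup_i f i).
Proof. by move=> of_; apply: bigcup_open => i _; exact: of_. Qed.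

HB.instance Definition _ :=
  isOpenTopological.Build RZ RZ_openT RZ_openI RZ_open_bigcup.
End Circle.

Section CZ.
Variable X : topologicalType.

Definition CZ : Type := continuousType X (discrete_topology int).
HB.instance Definition _ := Choice.on CZ.

Definition CZ_fun (f : CZ) : X -> int := f.
Coercion CZ_fun : CZ >-> Funclass.

Lemma CZP (f g : CZ) : (forall x, f x = g x) -> f = g.
Proof. by move=> fg; apply/continuousEP. Qed.

Lemma CZ_op_continuous (op : int -> int -> int) (f g : CZ) :
  continuous ((fun x => op (f x) (g x)) : X -> discrete_topology int).
Proof.
move=> x U; rewrite /= nbhs_principalE => /principal_filterP Ux.
have nb (h : CZ) : \forall y \near x, h y = h x.
  have /(_ x) := @cts_fun _ _ (h : continuousType X (discrete_topology int)).
  move=> /(_ [set z | z = h x]); apply => /=.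
  by rewrite nbhs_principalE; apply/principal_filterP.
by apply: filterS2 (nb f) (nb g) => y fy gy; rewrite /= fy gy.
Qed.

Definition CZ_op op (f g : CZ) : CZ :=
  mkcts (@CZ_op_continuous op f g) : continuousType X (discrete_topology int).

Definition CZ_zero : CZ :=
  cst (0 : int) : continuousType X (discrete_topology int).
Definition CZ_opp (f : CZ) : CZ := CZ_op (fun a _ => - a) f f.
Definition CZ_add : CZ -> CZ -> CZ := CZ_op +%R.

Lemma CZ_addA : associative CZ_add.
Proof. by move=> f g h; apply: CZP => x; exact: addrA. Qed.
Lemma CZ_addC : commutative CZ_add.
Proof. by move=> f g; apply: CZP => x; exact: addrC. Qed.
Lemma CZ_add0 : left_id CZ_zero CZ_add.
Proof. by move=> f; apply: CZP => x; exact: add0r. Qed.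
Lemma CZ_addN : left_inverse CZ_zero CZ_opp CZ_add.
Proof. by move=> f; apply: CZP => x; exact: addNr. Qed.

HB.instance Definition _ :=
  GRing.isZmodule.Build CZ CZ_addA CZ_addC CZ_add0 CZ_addN.

End CZ.

Section Shift.
Context {N : nat}.
Implicit Types (A : 'M[nat]_N) (w : seq 'I_N).

Definition irreducible_mx A : Prop :=
  forall i j, exists2 k : nat, (0 < k)%N & (0 < (A ^+ k)%R i j)%N.

(* Sequences are indexed from 0. *)
Definition shift_space A :
    set (prod_topology (fun _ : nat => discrete_topology 'I_N)) :=
  [set x | forall n, A (x n) (x n.+1) = 1%N].

Definition XA A : topologicalType := set_type (shift_space A).

Definition XA_coord A (x : XA A) : nat -> 'I_N := set_val x.

Lemma shift_proof A (x : XA A) :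
  (fun n => XA_coord x n.+1) \in shift_space A.
Proof. by apply/mem_set => n; have /set_mem := valP x; apply. Qed.

Definition shift A (x : XA A) : XA A :=
  exist (fun y => y \in shift_space A) _ (shift_proof x).

Definition cylinder A w : set (XA A) :=
  [set x | forall k i, (k < size w)%N -> nth i w k = XA_coord x k].

Definition coboundary A : {pred CZ (XA A)} :=
  fun f => `[< exists xi : CZ (XA A), forall x, f x = xi x - xi (shift x) >].

Lemma coboundary_zmod_closed A : zmod_closed (coboundary (A := A)).
Proof.
split=> [|f g /asboolP[xi fE] /asboolP[eta gE]]; apply/asboolP.
  by exists 0 => x; rewrite subrr.
exists (xi - eta) => x.
transitivity (CZ_fun f x - CZ_fun g x); first by [].
rewrite fE gE; transitivity (CZ_fun xi x - CZ_fun eta x - (CZ_fun xi (shift x) - CZ_fun eta (shift x))).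
  by rewrite !opprB addrACA [RHS]addrACA; congr (_ + _); exact: addrC.
by [].
Qed.

HB.instance Definition _ A := GRing.isZmodClosed.Build (CZ (XA A))
  (coboundary (A := A)) (@coboundary_zmod_closed A).

Definition HA A : zmodType := Quotient.quot (coboundary (A := A)).

Definition HA_class A (f : CZ (XA A)) : HA A :=
  \pi_(Quotient.quot (coboundary (A := A))) f.

Definition HA_nonneg A (h : HA A) : Prop :=
  exists2 f : CZ (XA A), (forall x, 0 <= f x) & h = HA_class f.

End Shift.

Section CuntzKrieger.
Context {R : realType} {N : nat} (A : 'M[nat]_N).

Definition ck_family (B : cstarType R) (T : 'I_N -> B) : Prop :=
  [/\ forall i, partial_isometry (T i),
      \sum_j T j * adj (T j) = 1
    & forall i, adj (T i) * T i = \sum_j (T j * adj (T j)) *+ A i j].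

Definition cuntz_krieger (OA : cstarType R) (S : 'I_N -> OA) : Prop :=
  [/\ ck_family S,
      cstar_generated (range S) = setT
    & forall (B : cstarType R) (T : 'I_N -> B), ck_family T ->
      exists! phi : OA -> B, star_morphism phi /\ forall i, phi (S i) = T i].

Section Actions.
Context {OA : cstarType R} (S : 'I_N -> OA).

Definition word_elt (w : seq 'I_N) : OA := \prod_(i <- w) S i.

Definition diag_alg : set OA :=
  cstar_generated [set word_elt w * adj (word_elt w) | w in setT].

(* [Phi] is the identification of C(X_A) with [diag_alg]; its values at
   discontinuous functions are irrelevant. *)
Definition diag_identification (Phi : (XA A -> R[i]) -> OA) : Prop :=
  let C := [set f : XA A -> R[i] | continuous (f : XA A -> R[i]^o)] in
  [/\ forall (c : R[i]) f g, C f -> C g ->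
        Phi (fun x => c * f x + g x) = c *: Phi f + Phi g,
      forall f g, C f -> C g -> Phi (fun x => f x * g x) = Phi f * Phi g,
      forall f, C f -> Phi (fun x => (f x)^* ) = adj (Phi f),
      set_bij C diag_alg Phi
    & forall w, Phi \1_(cylinder w) = word_elt w * adj (word_elt w)].

Definition expi (theta : R) : R[i] := (cos theta +i* sin theta)%C.

Definition U (Phi : (XA A -> R[i]) -> OA) (t : RZ R) (f : CZ (XA A)) : OA :=
  Phi (fun x => expi (2 * pi * of_RZ t * (f x)%:~R)).

Definition diag_action (alpha : RZ R -> OA -> OA) : Prop :=
  [/\ forall t, star_automorphism (alpha t),
      alpha 0 = id,
      forall s t, alpha (s + t) = alpha s \o alpha t,
      forall a, continuous (fun t => alpha t a)
    & forall t a, diag_alg a -> alpha t a = a].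

Definition action_mul (alpha beta : RZ R -> OA -> OA) : RZ R -> OA -> OA :=
  fun t => alpha t \o beta t.

Definition unitary_cocycle (alpha : RZ R -> OA -> OA) (u : RZ R -> OA) : Prop :=
  [/\ continuous u,
      forall t, unitary (u t)
    & forall t s, u (t + s) = u t * alpha t (u s)].

Definition cocycle_equiv (alpha1 alpha2 : RZ R -> OA -> OA) : Prop :=
  exists2 u, unitary_cocycle alpha2 u &
    forall t a, alpha1 t a = u t * alpha2 t a * adj (u t).

(* [d] is delta(alpha)_t, the derivative being the norm limit of the difference
   quotient in a real increment. *)
Definition is_delta (alpha : RZ R -> OA -> OA) (t : RZ R) (d : OA) : Prop :=
  let F s := \sum_i alpha s (S i) * adj (S i) in
  (h^-1)%:C%C *: (F (t + to_RZ h) - F t) @[h --> (0 : R)^'] --> d.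

Definition action_nonneg (alpha : RZ R -> OA -> OA) : Prop :=
  exists2 d, is_delta alpha 0 d & positive ((0 +i* (2 * pi))%C^-1 *: d).

(* Classes are sets of actions. Neither [action_mul] nor [class_mul] is bundled
   as a group law: that they are group laws relies on D_A being maximal abelian
   in O_A, and follows from their transport along the isomorphisms. *)

Definition action_class (alpha : RZ R -> OA -> OA) : set (RZ R -> OA -> OA) :=
  [set beta | diag_action beta /\ cocycle_equiv beta alpha].

Definition action_classes : set (set (RZ R -> OA -> OA)) :=
  [set action_class alpha | alpha in diag_action].

Definition class_mul (c1 c2 : set (RZ R -> OA -> OA)) :
    set (RZ R -> OA -> OA) :=
  [set gamma | diag_action gamma /\ exists alpha beta : RZ R -> OA -> OA,
    [/\ c1 alpha, c2 beta & cocycle_equiv gamma (action_mul alpha beta)]].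

Definition class_nonneg (c : set (RZ R -> OA -> OA)) : Prop :=
  exists2 alpha, c alpha & action_nonneg alpha.

End Actions.
End CuntzKrieger.

(* Main.v *)
Require Import Defs.
From HB Require Import structures.
From mathcomp Require Import all_boot all_order all_algebra.
From mathcomp Require Import complex.
From mathcomp Require Import all_classical all_reals all_analysis.
From mathcomp Require Import perm ring lra zify.
Import Order.TTheory GRing.Theory Num.Theory numFieldNormedType.Exports.

Set Implicit Arguments.
Unset Strict Implicit.
Unset Printing Implicit Defensive.

Local Open Scope classical_set_scope.
Local Open Scope ring_scope.

(** The proof rests on one fact about the Cuntz-Krieger algebra: an element commuting
    with the diagonal D lies in D ([diag_maximal_abelian]). Granted this, everything
    reduces to functions on the shift space X.

    The automorphisms. For a unitary v of D, the elements v S_i satisfy the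
    Cuntz-Krieger relations again, so universality yields an endomorphism S_i |-> v S_i.
    The covariance relation S_i d = (d o shift) S_i shows that a word is multiplied by a
    diagonal unitary, which cancels in the range projections of words: D is fixed
    ([twist_morphism]). With v = U_t(f) these are the rho^f_t; with v a constant they are
    the gauge automorphisms.

    Surjectivity. If alpha fixes D, then u_t = sum_i alpha_t(S_i) S_i^* commutes with D
    and is therefore a function on X; it is a continuous character of R/Z because alpha
    fixes it. Evaluated at a point of X it is t |-> exp(2 pi i t n) for an integer n, and n
    is locally constant since near t = 0 it can be read off from an argument
    ([unitary_character]). So u_t = U_t(f) and alpha = rho^f.

    Cocycles. A cocycle u relating rho^f and rho^g commutes with D, which both actions
    fix; as before u_t = U_t(xi). Conjugating S_i by U_t(xi) multiplies it by
    U_t(xi - xi o shift), so cohomologous actions are exactly those whose functions differ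
    by a coboundary ([twist_equiv]).

    Order. The derivative of U_t(f) at 0 is 2 pi i f, and the spectrum of a function with
    integer values is its set of values; so rho^f >= 0 if and only if f >= 0
    ([twist_nonneg]), and the positive cones correspond.

    Maximality of D. The gauge action splits an element t of the commutant of D into
    homogeneous parts, limits of averages over roots of unity. The part of degree 0 is
    approximated by combinations of S_mu S_nu^* with words of equal length, and pinching by
    projections of D, which does not move elements of the commutant, kills the terms with
    mu <> nu; so this part is in D. For a part c of nonzero degree, c^* c has degree 0,
    hence is a function; c is approximated by combinations of S_mu S_nu^* with words of
    different lengths, each of which vanishes on small cylinders around every point but
    one. Irreducibility of A, which is not a permutation matrix, means that X has no
    isolated point ([XA_perfect]), so the continuous function c^* c takes arbitrarily
    small values on every cylinder, and c = 0. Finally, t is the limit of its Fejer means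
    and hence equals its part of degree 0.

    Two tools replace spectral theory. A selfadjoint element of norm less than 1 is the
    average of two unitaries, the square root of 1 - h^2 being a fixed point of a
    contraction, so morphisms are contractive ([smorph_nrm]); the same trick with functions
    shows that the identification Phi of C(X) with D is bounded in both directions
    ([Phi_bound], [Phi_lower]). *)

(** * Real-valued norms in complex algebras *)

Section ComplexModulus.
Context {R : realType}.
Implicit Types z w : R[i].

Definition cmod z : R := complex.Re `|z|.

Lemma cmodC z : (cmod z)%:C%C = `|z|.
Proof. by rewrite /cmod RRe_real // ger0_real. Qed.

Lemma cmod_ge0 z : 0 <= cmod z.
Proof. by rewrite -ler0c cmodC. Qed.

Lemma cmod_lt z (e : R) : (`|z| < e%:C%C) = (cmod z < e).
Proof. by rewrite -cmodC ltcR. Qed.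

Lemma cmod0 : cmod 0 = 0. Proof. by rewrite /cmod normr0. Qed.

Lemma cmod1 : cmod 1 = 1. Proof. by rewrite /cmod normr1. Qed.

Lemma cmod_eq0 z : cmod z = 0 -> z = 0.
Proof. by move=> z0; apply/eqP; rewrite -normr_eq0 -cmodC z0. Qed.

Lemma cmod_gt0 z : z != 0 -> 0 < cmod z.
Proof.
by move=> z0; rewrite lt_def cmod_ge0 andbT; apply: contraNN z0 => /eqP/cmod_eq0/eqP.
Qed.

Lemma cmodD z w : cmod (z + w) <= cmod z + cmod w.
Proof. by rewrite -lecR rmorphD/= !cmodC ler_normD. Qed.

Lemma cmod_dist u z w : cmod (z - w) <= cmod (z - u) + cmod (u - w).
Proof. by rewrite -(subrK u z) -addrA (le_trans (cmodD _ _)) // subrK. Qed.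

Lemma cmodM z w : cmod (z * w) = cmod z * cmod w.
Proof. by apply: complexI; rewrite rmorphM/= !cmodC normrM. Qed.

Lemma cmodX z n : cmod (z ^+ n) = cmod z ^+ n.
Proof. by apply: complexI; rewrite rmorphXn/= !cmodC normrX. Qed.

Lemma cmodV z : cmod z^-1 = (cmod z)^-1.
Proof. by apply: complexI; rewrite fmorphV/= !cmodC normfV. Qed.

Lemma cmod_real (r : R) : cmod r%:C%C = `|r|.
Proof. by rewrite /cmod normc_def /= expr0n/= addr0 sqrtr_sqr. Qed.

Lemma cmod_nat n : cmod (n%:R : R[i]) = n%:R.
Proof. by apply: complexI; rewrite cmodC rmorph_nat normr_nat. Qed.

Lemma cmod_conj z : cmod (z^*) = cmod z.
Proof. by apply: complexI; rewrite !cmodC norm_conjC. Qed.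

Lemma cmod_Re z : `|complex.Re z| <= cmod z.
Proof.
rewrite /cmod normc_def /= -[leLHS]sqrtr_sqr.
by rewrite ler_wsqrtr // lerDl sqr_ge0.
Qed.

Lemma cmod_Im z : `|complex.Im z| <= cmod z.
Proof.
rewrite /cmod normc_def /= -[leLHS]sqrtr_sqr.
by rewrite ler_wsqrtr // lerDr sqr_ge0.
Qed.

Lemma posc_real z : 0 < z -> 0 < complex.Re z /\ z = (complex.Re z)%:C%C.
Proof.
by case: z => a b; rewrite ltcE /= => /andP[/eqP -> a0].
Qed.

End ComplexModulus.

Section CStarNorm.
Context {R : realType}.
Implicit Types B : cstarType R.

Definition nrm B (x : B) : R := complex.Re `|x|.

Lemma nrmC B (x : B) : (nrm x)%:C%C = `|x|.
Proof. by rewrite /nrm RRe_real // ger0_real. Qed.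

Lemma nrm_lt B (x : B) (e : R) : (`|x| < e%:C%C) = (nrm x < e).
Proof. by rewrite -nrmC ltcR. Qed.

Lemma nrm_ge0 B (x : B) : 0 <= nrm x.
Proof. by rewrite -ler0c nrmC. Qed.

Lemma nrm_eq0 B (x : B) : nrm x = 0 -> x = 0.
Proof. by move=> x0; apply/eqP; rewrite -normr_eq0 -nrmC x0. Qed.

Lemma nrm0 B : nrm (0 : B) = 0.
Proof. by rewrite /nrm normr0. Qed.

Lemma nrmN B (x : B) : nrm (- x) = nrm x.
Proof. by rewrite /nrm normrN. Qed.

Lemma nrm_sub B (x y : B) : nrm (x - y) = nrm (y - x).
Proof. by rewrite /nrm distrC. Qed.

Lemma nrmD B (x y : B) : nrm (x + y) <= nrm x + nrm y.
Proof. by rewrite -lecR rmorphD/= !nrmC ler_normD. Qed.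

Lemma nrm_dist B (z x y : B) : nrm (x - y) <= nrm (x - z) + nrm (z - y).
Proof. by rewrite -(subrK z x) -addrA (le_trans (nrmD _ _)) // subrK. Qed.

Lemma nrmM B (x y : B) : nrm (x * y) <= nrm x * nrm y.
Proof. by rewrite -lecR rmorphM/= !nrmC; exact: cstar_normM. Qed.

Lemma nrmZ B (c : R[i]) (x : B) : nrm (c *: x) = cmod c * nrm x.
Proof. by apply: complexI; rewrite rmorphM/= !nrmC cmodC normrZ. Qed.

Lemma nrm_sum B I (r : seq I) (P : pred I) (F : I -> B) :
  nrm (\sum_(i <- r | P i) F i) <= \sum_(i <- r | P i) nrm (F i).
Proof.
elim/big_rec2: _ => [|i x y _ le_yx]; first by rewrite nrm0.
by rewrite (le_trans (nrmD _ _)) // lerD2l.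
Qed.

Lemma nrm_small_eq0 B (x : B) : (forall e, 0 < e -> nrm x <= e) -> x = 0.
Proof.
move=> x_le; apply: nrm_eq0; apply/eqP; rewrite eq_le nrm_ge0 andbT.
by apply/ler_addgt0Pr => e e0; rewrite add0r x_le.
Qed.

Lemma starK B (x : B) : adj (adj x) = x. Proof. exact: cstar_adjK. Qed.
Lemma starM B (x y : B) : adj (x * y) = adj y * adj x.
Proof. exact: cstar_adjM. Qed.
Lemma starD B (x y : B) : adj (x + y) = adj x + adj y.
Proof. exact: cstar_adjD. Qed.
Lemma starZ B c (x : B) : adj (c *: x) = c^* *: adj x.
Proof. exact: cstar_adjZ. Qed.
Lemma star0 B : adj (0 : B) = 0.
Proof. by apply: (@addrI _ (adj (0 : B))); rewrite -starD !addr0. Qed.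
Lemma star1 B : adj (1 : B) = 1.
Proof. by rewrite -[LHS]mulr1 -[X in _ * X]starK -starM mulr1 starK. Qed.
Lemma starN B (x : B) : adj (- x) = - adj x.
Proof. by apply/eqP; rewrite -addr_eq0 -starD addNr star0. Qed.
Lemma starB B (x y : B) : adj (x - y) = adj x - adj y.
Proof. by rewrite starD starN. Qed.

Lemma nrm_cstar B (x : B) : nrm (adj x * x) = nrm x ^+ 2.
Proof. by apply: complexI; rewrite rmorphXn/= !nrmC; exact: cstar_normE. Qed.

(** By the C*-identity [|x|^2 = |x^* x| <= |x^*| |x|], and symmetrically. *)
Lemma nrm_adj B (x : B) : nrm (adj x) = nrm x.
Proof.
suff H (y : B) : nrm y <= nrm (adj y).
  by apply/eqP; rewrite eq_le H -{2}(starK x) H.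
have [y0|y_gt0] := leP (nrm y) 0; first exact: le_trans (nrm_ge0 _).
by rewrite -(ler_pM2r y_gt0) -expr2 -nrm_cstar nrmM.
Qed.

Lemma nrm1 B : nrm (1 : B) = 1.
Proof.
have n0 : nrm (1 : B) != 0 by apply/eqP => /nrm_eq0/eqP; rewrite oner_eq0.
by apply: (mulfI n0); rewrite -expr2 -nrm_cstar star1 !mulr1.
Qed.

Lemma unitary_nrm B (u : B) : unitary u -> nrm u = 1.
Proof.
move=> [uu _]; apply/eqP; rewrite -(@eqrXn2 _ 2) ?nrm_ge0 //.
by rewrite -nrm_cstar uu nrm1 expr1n.
Qed.

Lemma nrmMu B (u x : B) : unitary u -> nrm (u * x) <= nrm x.
Proof. by move=> /unitary_nrm u1; rewrite (le_trans (nrmM _ _)) // u1 mul1r. Qed.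

Lemma nrm_conj_le B (u x : B) : unitary u -> nrm (u * x * adj u) <= nrm x.
Proof.
move=> u1; rewrite (le_trans (nrmM _ _)) // nrm_adj (unitary_nrm u1) mulr1.
exact: nrmMu.
Qed.

Lemma nrm_subM B (x y x' y' : B) :
  nrm (x * y - x' * y') <= nrm x * nrm (y - y') + nrm (x - x') * nrm y'.
Proof.
have -> : x * y - x' * y' = x * (y - y') + (x - x') * y'.
  by rewrite mulrBr mulrBl addrA subrK.
by rewrite (le_trans (nrmD _ _)) // lerD // nrmM.
Qed.

Definition cvg_nrm B (y : nat -> B) (l : B) :=
  forall e, 0 < e -> exists n0, forall n, (n0 <= n)%N -> nrm (y n - l) < e.

(** The only use of completeness: every limit below is obtained from here. *)
Lemma cauchy_nrm_cvg B (y : nat -> B) :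
  (forall e, 0 < e -> exists n0, forall m n, (n0 <= m)%N -> (n0 <= n)%N ->
     nrm (y m - y n) < e) ->
  exists l, cvg_nrm y l.
Proof.
move=> y_cauchy.
have /cauchy_cvgP : cauchy (y @ \oo).
  apply/cauchy_ballP => _/posnumP[e]; near_simpl.
  have [e0 eE] : 0 < complex.Re e%:num /\ _ := posc_real (gt0 e).
  have [n0 n0P] := y_cauchy _ e0.
  exists ([set n | (n0 <= n)%N], [set n | (n0 <= n)%N]); first by split; exists n0.
  move=> [m n] [/= n0m n0n]; rewrite /= -ball_normE /ball_ /=.
  by rewrite eE nrm_lt n0P.
move=> /cvgP; case/cvg_ex => l /cvgrPdist_lt yl; exists l => e e0.
have e0' : 0 < e%:C%C by rewrite ltcR.
have [n0 _ n0P] := yl _ e0'.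
by exists n0 => n /n0P; rewrite /= nrm_lt nrm_sub.
Qed.

Lemma cvg_nrm_unique B (y : nat -> B) l l' : cvg_nrm y l -> cvg_nrm y l' -> l = l'.
Proof.
move=> yl yl'; apply/eqP; rewrite -subr_eq0; apply/eqP; apply: nrm_small_eq0.
move=> e e0; have e20 : 0 < e / 2 by rewrite divr_gt0.
have [n0 n0P] := yl _ e20; have [n1 n1P] := yl' _ e20.
have := n0P _ (leq_maxl n0 n1); have := n1P _ (leq_maxr n0 n1).
by have := nrm_dist (y (maxn n0 n1)) l l'; rewrite (nrm_sub l (y _)); lra.
Qed.

Lemma closed_nrmP B (M : set B) : closed M <->
  forall x, (forall e, 0 < e -> exists2 y, M y & nrm (x - y) < e) -> M x.
Proof.
split=> [cM x xM|H x clx].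
  apply: cM => V /nbhs_normP[e /= e0 eV].
  have [e0' eE] := posc_real e0.
  have [y My xy] := xM _ e0'; exists y; split=> //; apply: eV; rewrite /ball_ /=.
  by rewrite eE nrm_lt.
apply: H => e e0; have e0' : 0 < e%:C%C by rewrite ltcR.
have [|y [My]] := clx [set y | `|x - y| < e%:C%C].
  by apply/nbhs_normP; exists e%:C%C.
by rewrite /= nrm_lt => xy; exists y.
Qed.

End CStarNorm.

(** * Limits in norm *)

Section Limits.
Context {R : realType} (B : cstarType R).
Implicit Types (x y l : B) (u v : nat -> B).

Lemma cvg_nrm_cst x : cvg_nrm (fun=> x) x.
Proof. by move=> e e0; exists 0%N => n _; rewrite subrr nrm0. Qed.

Lemma cvg_nrm_eventually u v l n0 :
  (forall n, (n0 <= n)%N -> u n = v n) -> cvg_nrm u l -> cvg_nrm v l.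
Proof.
move=> uv ul e e0; have [n1 n1P] := ul e e0.
by exists (maxn n0 n1) => n; rewrite geq_max => /andP[n0n n1n]; rewrite -uv // n1P.
Qed.

Lemma cvg_nrmD u v l m :
  cvg_nrm u l -> cvg_nrm v m -> cvg_nrm (fun n => u n + v n) (l + m).
Proof.
move=> ul vm e e0; have e20 : 0 < e / 2 by rewrite divr_gt0.
have [n0 n0P] := ul _ e20; have [n1 n1P] := vm _ e20.
exists (maxn n0 n1) => n; rewrite geq_max => /andP[/n0P n0n /n1P n1n].
rewrite opprD addrACA; have := nrmD (u n - l) (v n - m); lra.
Qed.

Lemma cvg_nrmZ u l (c : R[i]) : cvg_nrm u l -> cvg_nrm (fun n => c *: u n) (c *: l).
Proof.
move=> ul e e0; have c1 : 0 < cmod c + 1 by rewrite ltr_wpDl // cmod_ge0.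
have [n0 n0P] := ul _ (divr_gt0 e0 c1).
exists n0 => n /n0P; rewrite -scalerBr nrmZ ltr_pdivlMr // mulrC.
by apply: le_lt_trans; rewrite ler_wpM2r ?nrm_ge0 // lerDl.
Qed.

Lemma cvg_nrmM u v l m :
  cvg_nrm u l -> cvg_nrm v m -> cvg_nrm (fun n => u n * v n) (l * m).
Proof.
move=> ul vm e e0.
pose K := nrm l + 1 + nrm m + 1.
have K0 : 0 < K.
  by have := nrm_ge0 l; have := nrm_ge0 m; rewrite /K; lra.
have [n0 n0P] := ul _ ltr01.
have [n1 n1P] := ul _ (divr_gt0 (divr_gt0 e0 K0) (@ltr0Sn _ 1)).
have [n2 n2P] := vm _ (divr_gt0 (divr_gt0 e0 K0) (@ltr0Sn _ 1)).
exists (maxn n0 (maxn n1 n2)) => n; rewrite !geq_max.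
move=> /and3P[/n0P un /n1P un1 /n2P vn].
have unK : nrm (u n) <= K.
  have := nrmD (u n - l) l; rewrite subrK.
  by have := nrm_ge0 m; rewrite /K; lra.
have mK : nrm m <= K by have := nrm_ge0 l; rewrite /K; lra.
apply: (le_lt_trans (nrm_subM _ _ _ _)).
apply: (@le_lt_trans _ _ (K * nrm (v n - m) + nrm (u n - l) * K)).
  by rewrite lerD // ?ler_wpM2l ?ler_wpM2r ?nrm_ge0.
rewrite mulrC -mulrDl -ltr_pdivlMr //; lra.
Qed.

Lemma cvg_nrm_adj u l : cvg_nrm u l -> cvg_nrm (fun n => adj (u n)) (adj l).
Proof.
by move=> ul e /ul[n0 n0P]; exists n0 => n /n0P; rewrite -starB nrm_adj.
Qed.

Lemma cvg_nrm_le u l c n0 : cvg_nrm u l ->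
  (forall n, (n0 <= n)%N -> nrm (u n) <= c) -> nrm l <= c.
Proof.
move=> ul uc; apply/ler_addgt0Pr => e e0; have [n1 n1P] := ul e e0.
have := n1P _ (leq_maxr n0 n1); have := uc _ (leq_maxl n0 n1).
by have := nrmD (l - u (maxn n0 n1)) (u (maxn n0 n1)); rewrite subrK nrm_sub; lra.
Qed.

Lemma cvg_nrm_sum I (r : seq I) (F : I -> nat -> B) (L : I -> B) :
  (forall i, cvg_nrm (F i) (L i)) ->
  cvg_nrm (fun n => \sum_(i <- r) F i n) (\sum_(i <- r) L i).
Proof.
move=> FL; elim: r => [|i r IHr].
  rewrite big_nil; apply: (@cvg_nrm_eventually (fun=> 0) _ _ 0%N) => [n _|].
    by rewrite big_nil.
  exact: cvg_nrm_cst.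
rewrite big_cons.
apply: (@cvg_nrm_eventually (fun n => F i n + \sum_(j <- r) F j n) _ _ 0%N) => [n _|].
  by rewrite big_cons.
exact: cvg_nrmD.
Qed.

Lemma geometric_cvg_nrm u (c r : R) : 0 <= r < 1 ->
  (forall n, nrm (u n.+1 - u n) <= c * r ^+ n) -> exists l, cvg_nrm u l.
Proof.
move=> /andP[r0 r1] ur; apply: cauchy_nrm_cvg => e e0.
have r1' : 0 < 1 - r by rewrite subr_gt0.
have c0 : 0 <= c by have := ur 0%N; rewrite expr0 mulr1; apply: le_trans; exact: nrm_ge0.
have dist n k : nrm (u (n + k)%N - u n) <= c / (1 - r) * r ^+ n * (1 - r ^+ k).
  elim: k => [|k IHk]; first by rewrite addn0 subrr nrm0 expr0 subrr mulr0.
  apply: (le_trans (nrm_dist (u (n + k)%N) _ _)); rewrite addnS.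
  apply: (le_trans (lerD (ur _) IHk)).
  rewrite le_eqVlt; apply/orP; left; apply/eqP; rewrite exprD exprS.
  by field; rewrite gt_eqF.
have dist' n m : (n <= m)%N -> nrm (u m - u n) <= c / (1 - r) * r ^+ n.
  move=> nm; rewrite -(subnKC nm); apply: le_trans (dist _ _) _.
  apply: ler_piMr; first by rewrite !mulr_ge0 ?invr_ge0 ?exprn_ge0 // ltW.
  by rewrite gerBl exprn_ge0.
have C0 : 0 < c / (1 - r) + 1 by rewrite ltr_wpDl // mulr_ge0 // invr_ge0 ltW.
have [n0 n0P] : exists n0, r ^+ n0 < e / 2 / (c / (1 - r) + 1).
  have := @cvg_expr _ r; rewrite ger0_norm // => /(_ r1)/cvgrPdist_lt.
  have := divr_gt0 (divr_gt0 e0 (@ltr0Sn _ 1)) C0.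
  move=> E0 /(_ _ E0)[n0 _ /(_ _ (leqnn n0))] /=.
  by rewrite sub0r normrN ger0_norm ?exprn_ge0 // => ?; exists n0.
have small m : (n0 <= m)%N -> nrm (u m - u n0) < e / 2.
  move=> /dist' /le_lt_trans; apply; move: n0P.
  rewrite ltr_pdivlMr // mulrC; apply: le_lt_trans.
  by rewrite ler_wpM2r ?exprn_ge0 // lerDl.
exists n0 => m n /small m0 /small n0'.
have := nrm_dist (u n0) (u m) (u n); rewrite (nrm_sub (u n0)); lra.
Qed.

End Limits.

(** * Morphisms of C*-algebras are contractive *)

Section GeneratedSubalgebra.
Context {R : realType} {B : cstarType R}.

Lemma cstar_generated_subalgebra (G : set B) : cstar_subalgebra (cstar_generated G).
Proof.
split=> [M [[] ? _ _ _ _ _] //|c x y xG yG M MG|x y xG yG M MG|x xG M MG|].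
- by have [[_ lin _ _ _] _] := MG; apply: lin; [exact: xG|exact: yG].
- by have [[_ _ mul _ _] _] := MG; apply: mul; [exact: xG|exact: yG].
- by have [[_ _ _ star _] _] := MG; apply: star; exact: xG.
- apply/closed_nrmP => x xG M MG; have [[_ _ _ _ /closed_nrmP cl] _] := MG.
  by apply: cl => e /xG[y yG xy]; exists y => //; exact: yG.
Qed.

Lemma sub_cstar_generated (G : set B) : G `<=` cstar_generated G.
Proof. by move=> x Gx M [_]; exact. Qed.

Lemma cstar_generated_ind (G M : set B) :
  cstar_subalgebra M -> G `<=` M -> cstar_generated G `<=` M.
Proof. by move=> MA GM x; apply. Qed.

End GeneratedSubalgebra.

Section Contractive.
Context {R : realType}.
Implicit Types B : cstarType R.

(** With [y = 1 - s] the equation reads [y = (x + y ^ 2) / 2], whose right-hand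
    side is a contraction of the ball of radius [|x| < 1]; its iterates from [0]
    are selfadjoint polynomials in [x], so that the limit is selfadjoint and
    commutes with whatever commutes with [x]. *)
Lemma sqrt_one_minus B (x : B) : adj x = x -> nrm x < 1 ->
  exists s, [/\ adj s = s, s * s = 1 - x & forall h, h * x = x * h -> h * s = s * h].
Proof.
move=> xx x1; pose F (y : B) := 2^-1 *: (x + y * y).
pose u n := iter n F 0; set r := nrm x.
have half : cmod (2^-1 : R[i]) = 2^-1 by rewrite cmodV cmod_nat.
have uS n : u n.+1 = F (u n) by [].
have r0 : 0 <= r := nrm_ge0 x.
have ur n : nrm (u n) <= r.
  elim: n => [|n IHn]; first by rewrite nrm0.
  rewrite uS nrmZ half; have := nrmD x (u n * u n); have := nrmM (u n) (u n).
  have : nrm (u n) * nrm (u n) <= r * r by rewrite ler_pM ?nrm_ge0.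
  have : r * r <= r by rewrite ler_piMr // ltW.
  rewrite -/r; lra.
have ud n : nrm (u n.+1 - u n) <= r * r ^+ n.
  elim: n => [|n IHn]; first by rewrite expr0 mulr1 subr0 ur.
  rewrite !(uS n.+1) {2}uS -scalerBr nrmZ half opprD addrACA subrr add0r.
  have := nrm_subM (u n.+1) (u n.+1) (u n) (u n).
  have h1 : nrm (u n.+1) * nrm (u n.+1 - u n) <= r * (r * r ^+ n).
    by rewrite ler_pM ?nrm_ge0.
  have h2 : nrm (u n.+1 - u n) * nrm (u n) <= r * (r * r ^+ n).
    by rewrite mulrC ler_pM ?nrm_ge0.
  rewrite exprS; lra.
have [|l ul] := @geometric_cvg_nrm _ _ u r r _ ud; first by rewrite r0.
have lF : l = F l.
  apply: (@cvg_nrm_unique _ _ (fun n => u n.+1)).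
    move=> e /ul[n0 n0P]; exists n0 => n n0n; apply: n0P; exact: leqW.
  apply: cvg_nrmZ; apply: cvg_nrmD; first exact: cvg_nrm_cst.
  exact: cvg_nrmM.
have ladj : adj l = l.
  apply: (@cvg_nrm_unique _ _ u) => //.
  apply: (@cvg_nrm_eventually _ _ (fun n => adj (u n)) _ _ 0%N); last exact: cvg_nrm_adj.
  move=> n _; elim: n => [|n IHn]; first by rewrite star0.
  rewrite uS /F starZ starD starM xx IHn; congr (_ *: _).
  by rewrite fmorphV rmorph_nat.
exists (1 - l); split; first by rewrite starB star1 ladj.
  have l2 : l + l = x + l * l.
    rewrite {1 2}lF -scalerDl -[RHS]scale1r; congr (_ *: _).
    by field.
  rewrite mulrBr mulr1 mulrBl mul1r -addrA -opprD; congr (1 - _).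
  by rewrite addrA l2 addrK.
move=> h hx; rewrite mulrBr mulr1 mulrBl mul1r; congr (_ - _).
apply: (@cvg_nrm_unique _ _ (fun n => h * u n)).
  by apply: cvg_nrmM => //; exact: cvg_nrm_cst.
apply: (@cvg_nrm_eventually _ _ (fun n => u n * h) _ _ 0%N).
  move=> n _; elim: n => [|n IHn]; first by rewrite mulr0 mul0r.
  rewrite uS /F -scalerAl -scalerAr mulrDl mulrDr hx.
  by rewrite -mulrA IHn mulrA IHn mulrA.
by apply: cvg_nrmM => //; exact: cvg_nrm_cst.
Qed.

Lemma half_double B (x : B) : 2^-1 *: (x + x) = x.
Proof.
rewrite -[x in x + _]scale1r -[x in _ + x]scale1r -scalerDl scalerA.
by rewrite mulVf ?scale1r // (pnatr_eq0 R[i] 2).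
Qed.

(** A selfadjoint element of norm [< 1] is the average of the unitaries
    [h +i sqrt (1 - h ^ 2)] and [h -i sqrt (1 - h ^ 2)]. *)
Lemma selfadjoint_half_unitary B (h : B) : adj h = h -> nrm h < 1 ->
  exists2 u, unitary u & h = 2^-1 *: (u + adj u).
Proof.
move=> hh h1.
have hh1 : nrm (h * h) < 1.
  by rewrite -{1}hh nrm_cstar exprn_ilt1 ?nrm_ge0.
have [|s [sadj s2 sC]] := sqrt_one_minus _ hh1; first by rewrite starM hh.
have {}sC : h * s = s * h by apply: sC; rewrite mulrA.
pose i : R[i] := 'i%C.
have ii : i * i = -1 by rewrite -expr2 sqr_i.
have uadj : adj (h + i *: s) = h - i *: s.
  by rewrite starD starZ hh sadj -scaleNr; congr (_ + _ *: _); rewrite /i /=; simpc.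
have comm : h * (i *: s) = (i *: s) * h by rewrite -scalerAl -scalerAr sC.
have sq : (i *: s) * (i *: s) = h * h - 1.
  by rewrite -scalerAl -scalerAr scalerA ii scaleN1r s2 opprB.
exists (h + i *: s); last by rewrite uadj addrACA subrr addr0 half_double.
split; rewrite uadj.
  by rewrite mulrBl !mulrDr comm opprD sq addrA addrK opprB addrC subrK.
by rewrite mulrDl !mulrBr comm sq addrA subrK opprB addrC subrK.
Qed.

Section Morphism.
Variables (B B' : cstarType R) (phi : B -> B').
Hypothesis phiM : star_morphism phi.

Lemma smorphD x y : phi (x + y) = phi x + phi y.
Proof. by case: phiM => lin _ _; have := lin 1 x y; rewrite !scale1r. Qed.

Lemma smorph0 : phi 0 = 0.
Proof. by apply: (@addrI _ (phi 0)); rewrite -smorphD !addr0. Qed.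

Lemma smorphZ c x : phi (c *: x) = c *: phi x.
Proof.
by case: phiM => lin _ _; have := lin c x 0; rewrite smorph0 !addr0.
Qed.

Lemma smorphN x : phi (- x) = - phi x.
Proof. by rewrite -scaleN1r smorphZ scaleN1r. Qed.

Lemma smorphB x y : phi (x - y) = phi x - phi y.
Proof. by rewrite smorphD smorphN. Qed.

Lemma smorphM x y : phi (x * y) = phi x * phi y.
Proof. by case: phiM => _ [_ mul] _; exact (mul x y). Qed.

Lemma smorph1 : phi 1 = 1.
Proof. by case: phiM => _ [one _] _. Qed.

Lemma smorph_adj x : phi (adj x) = adj (phi x).
Proof. by case: phiM => _ _ star; exact (star x). Qed.

Lemma smorph_unitary u : unitary u -> unitary (phi u).
Proof. by move=> [uu uu']; split; rewrite -smorph_adj -smorphM ?uu ?uu' smorph1. Qed.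

(** Morphisms preserve unitaries, which have norm 1, and a selfadjoint element of
    norm [< 1] is an average of two unitaries; the C*-identity reduces the
    general case to the selfadjoint one. *)
Lemma smorph_nrm x : nrm (phi x) <= nrm x.
Proof.
have lt1 h : adj h = h -> nrm h < 1 -> nrm (phi h) <= 1.
  move=> hh /(selfadjoint_half_unitary hh)[u uu ->].
  rewrite smorphZ smorphD smorph_adj nrmZ cmodV cmod_nat.
  have pu := unitary_nrm (smorph_unitary uu).
  by have := nrmD (phi u) (adj (phi u)); rewrite nrm_adj pu; lra.
have sa h : adj h = h -> nrm (phi h) <= nrm h.
  move=> hh; apply/ler_addgt0Pr => e e0; have h0 := nrm_ge0 h.
  have t0 : 0 < nrm h + e by rewrite ltr_wpDl.
  have c : cmod (nrm h + e)^-1%:C%C = (nrm h + e)^-1.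
    by rewrite cmod_real ger0_norm // invr_ge0 ltW.
  have := @lt1 ((nrm h + e)^-1%:C%C *: h).
  rewrite starZ hh smorphZ !nrmZ c mulrC ltr_pdivrMr // mul1r ltrDl => /(_ _ e0).
  rewrite ler_pdivrMl // mulr1; apply; congr (_ *: _).
  exact: (conjc_real (nrm h + e)^-1).
rewrite -(@ler_pXn2r _ 2) ?nnegrE ?nrm_ge0 // -!nrm_cstar -smorph_adj -smorphM.
by apply: sa; rewrite starM starK.
Qed.

End Morphism.

Lemma smorph_id B : star_morphism (@id B).
Proof. by split=> //; split. Qed.

Lemma smorph_comp B B' B'' (psi : B' -> B'') (phi : B -> B') :
  star_morphism psi -> star_morphism phi -> star_morphism (psi \o phi).
Proof.
move=> psiM phiM; split=> [c x y||x] /=.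
- by rewrite (smorphD phiM) (smorphZ phiM) (smorphD psiM) (smorphZ psiM).
- by split=> [|x y] /=; rewrite ?(smorph1 phiM) ?(smorph1 psiM) ?(smorphM phiM) ?(smorphM psiM).
- by rewrite (smorph_adj phiM) (smorph_adj psiM).
Qed.

Lemma equalizer_subalgebra (B B' : cstarType R) (phi psi : B -> B') :
  star_morphism phi -> star_morphism psi ->
  cstar_subalgebra [set x | phi x = psi x].
Proof.
move=> phiM psiM; split=> [|c y z yE zE|y z yE zE|y yE|] /=.
- by rewrite (smorph0 phiM) (smorph0 psiM).
- by rewrite (smorphD phiM) (smorphD psiM) (smorphZ phiM) (smorphZ psiM) yE zE.
- by rewrite (smorphM phiM) (smorphM psiM) yE zE.
- by rewrite (smorph_adj phiM) (smorph_adj psiM) yE.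
apply/closed_nrmP => y yG; apply/eqP; rewrite -subr_eq0; apply/eqP.
apply: nrm_small_eq0 => e e0; have [z zE yz] := yG _ (divr_gt0 e0 (@ltr0Sn _ 1)).
have := nrm_dist (phi z) (phi y) (psi y).
rewrite {2}zE -(smorphB phiM) -(smorphB psiM).
have := smorph_nrm phiM (y - z); have := smorph_nrm psiM (z - y).
rewrite (nrm_sub z); lra.
Qed.

(** Morphisms are continuous, so their equalizer is closed and it is enough to test
    generators. *)
Lemma smorph_ext (B B' : cstarType R) (G : set B) (phi psi : B -> B') :
  star_morphism phi -> star_morphism psi -> cstar_generated G = setT ->
  (forall x, G x -> phi x = psi x) -> phi = psi.
Proof.
move=> phiM psiM Gen eqG; apply/funext => x.
apply: (cstar_generated_ind (equalizer_subalgebra phiM psiM) eqG).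
by rewrite Gen.
Qed.

End Contractive.

(** * The topology of the shift space *)

Section ShiftSpace.
Context {N : nat}.
Implicit Types (A : 'M[nat]_N).

Definition agree A (n : nat) (x y : XA A) :=
  forall k, (k < n)%N -> XA_coord x k = XA_coord y k.

Lemma agreeW A m n (x y : XA A) : (m <= n)%N -> agree n x y -> agree m x y.
Proof. by move=> mn xy k km; rewrite xy // (leq_trans km). Qed.

Lemma agree_trans A n (x y z : XA A) : agree n x y -> agree n y z -> agree n x z.
Proof. by move=> xy yz k kn; rewrite xy // yz. Qed.

Lemma XA_ext A (x y : XA A) : (forall k, XA_coord x k = XA_coord y k) -> x = y.
Proof. by move=> xy; apply: val_inj; apply/funext. Qed.

Lemma XA_coord_shift A (x : XA A) k : XA_coord (Defs.shift x) k = XA_coord x k.+1.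
Proof. by []. Qed.

Lemma XA_coord_iter_shift A (x : XA A) m k :
  XA_coord (iter m (@Defs.shift _ A) x) k = XA_coord x (k + m).
Proof. by elim: m k => [|m IHm] k; rewrite ?addn0 //= XA_coord_shift IHm addSnnS. Qed.

Lemma XA_edge A (x : XA A) k : A (XA_coord x k) (XA_coord x k.+1) = 1%N.
Proof. by have /set_mem := valP x; apply. Qed.

Lemma coord_nbhs A (x : XA A) k : \forall y \near x, XA_coord y k = XA_coord x k.
Proof.
have cval : continuous (set_val : XA A -> _) by exact: initial_continuous.
have cproj : continuous (fun y : prod_topology (fun=> discrete_topology 'I_N) =>
    (y k : discrete_topology 'I_N)).
  by exact: (@proj_continuous _ (fun=> discrete_topology 'I_N) k).
have := continuous_comp (cval x) (cproj _).
move=> /(_ [set z | z = XA_coord x k]); apply => /=.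
by rewrite nbhs_principalE; apply/principal_filterP.
Qed.

Lemma agree_nbhs A (x : XA A) n : \forall y \near x, agree n x y.
Proof.
have FN : Filter (nbhs x) by exact: nbhs_filter.
elim: n => [|n IHn]; first by apply: (@filterE _ _ FN) => y k.
apply: (@filterS2 _ _ FN _ _ _ _ IHn (coord_nbhs x n)) => y xy yn k.
by rewrite ltnS leq_eqVlt => /predU1P[->|/xy].
Qed.

(** The product topology is generated by the coordinates, and finitely many of them
    are determined by a long enough prefix. *)
Lemma nbhs_agree A (x : XA A) (V : set (XA A)) :
  nbhs x V <-> exists n, forall y, agree n x y -> V y.
Proof.
split=> [|[n nV]]; last by apply: filterS (agree_nbhs x n).
pose F : set_system (forall _ : nat, 'I_N) :=
  [set W | exists n, forall y, (forall k, (k < n)%N -> y k = XA_coord x k) -> W y].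
have FF : Filter F.
  split; first by exists 0%N.
    move=> P Q [m mP] [n nQ]; exists (maxn m n) => y xy; split.
      by apply: mP => k km; apply: xy; rewrite leq_max km.
    by apply: nQ => k kn; apply: xy; rewrite leq_max kn orbT.
  by move=> P Q PQ [m mP]; exists m => y /mP /PQ.
have : F --> (XA_coord x : prod_topology (fun=> discrete_topology 'I_N)).
  apply/cvg_sup => k W; rewrite nbhsE => -[_ [[D Dop <-] Dx] DW].
  exists k.+1 => y /(_ k (leqnn _)) yx; apply: DW.
  by move: Dx; rewrite /= yx.
move=> FX; rewrite nbhsE => -[_ [[W Wop <-] Wx] WV].
have /FX[n nP] : nbhs (XA_coord x : prod_topology (fun=> discrete_topology 'I_N)) W.
  exact: open_nbhs_nbhs.
by exists n => y xy; apply: WV; apply: nP => k kn; exact/esym/xy.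
Qed.

Lemma continuous_agree {R : realType} A (g : XA A -> R[i]) :
  continuous (g : XA A -> R[i]^o) <->
  forall x e, 0 < e -> exists n, forall y, agree n x y -> cmod (g x - g y) < e.
Proof.
split=> [gC x e e0|gP x].
  have e0' : 0 < e%:C%C by rewrite ltcR.
  have /(@cvgrPdist_lt _ _ _ _ (nbhs_filter x))/(_ _ e0')/nbhs_agree[n nP] := gC x.
  by exists n => y /nP; rewrite cmod_lt.
apply/(@cvgrPdist_lt _ _ _ _ (nbhs_filter x)) => e /posc_real[e0 eE].
apply/nbhs_agree; have [n nP] := gP x _ e0.
by exists n => y /nP; rewrite eE cmod_lt.
Qed.

Lemma CZ_agree A (f : CZ (XA A)) x :
  exists n, forall y, agree n x y -> f y = f x.
Proof.
apply/(nbhs_agree x [set y | f y = f x]).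
have /(_ x) := @cts_fun _ _ (f : continuousType (XA A) (discrete_topology int)).
move=> /(_ [set z | z = f x]); apply => /=.
by rewrite nbhs_principalE; apply/principal_filterP.
Qed.

Lemma CZ_of_agree A (f : XA A -> int) :
  (forall x, exists n, forall y, agree n x y -> f y = f x) ->
  exists g : CZ (XA A), forall x, g x = f x.
Proof.
move=> fP; have fC : continuous (f : XA A -> discrete_topology int).
  move=> x V; rewrite nbhs_principalE => /principal_filterP Vx.
  by apply/nbhs_agree; have [n nP] := fP x; exists n => y /nP /= ->.
by exists (mkcts fC : continuousType (XA A) (discrete_topology int)).
Qed.

Definition prefix_word A (x : XA A) n := mkseq (XA_coord x) n.

Lemma cylinder_prefix A (x y : XA A) n :
  cylinder (prefix_word x n) y <-> agree n x y.
Proof.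
rewrite /cylinder/= size_mkseq; split=> xy k.
  by move=> kn; rewrite -(xy _ (XA_coord x k) kn) nth_mkseq.
by move=> i kn; rewrite nth_mkseq // xy.
Qed.

Section Perfect.
Variable A : 'M[nat]_N.
Hypotheses (A01 : forall i j, A i j = 0%N \/ A i j = 1%N)
  (A_irr : irreducible_mx A) (A_nperm : ~~ is_perm_mx A).

Lemma row_has_edge i : exists j, A i j = 1%N.
Proof.
have [k k0 Ak] := A_irr i i; apply: contrapT => noj.
move: Ak; rewrite -(prednK k0) exprS mxE big1 // => j _.
have [->|Aij] := A01 i j; first by rewrite mul0r.
by case: noj; exists j.
Qed.

Lemma col_has_edge j : exists i, A i j = 1%N.
Proof.
have [k k0 Ak] := A_irr j j; apply: contrapT => noi.
move: Ak; rewrite -(prednK k0) exprSr mxE big1 // => i _.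
have [->|Aij] := A01 i j; first by rewrite mulr0.
by case: noi; exists i.
Qed.

(** A transition matrix without branching is the graph of a map, onto since
    every column has a nonzero entry, hence of a permutation. *)
Lemma branching_vertex : exists i j j', [/\ A i j = 1%N, A i j' = 1%N & j != j'].
Proof.
apply: contrapT => nobranch; move/negP: A_nperm; apply.
have /choice[s sP] := row_has_edge.
have A_s i j : A i j = 1%N -> j = s i.
  by move=> Aij; apply: contrapT => /eqP ns; apply: nobranch; exists i, j, (s i).
have s_inj : injective s.
  have /choice[t tP] := col_has_edge.
  have st : cancel t s by move=> j; rewrite -(A_s _ _ (tP j)).
  exact: bij_inj (bij_can_bij (injF_bij (can_inj st)) st).
apply/is_perm_mxP; exists (perm s_inj); apply/matrixP => i j.
rewrite !mxE permE; have [<-|sij] := eqVneq; first by rewrite sP.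
by have [|/A_s jE] := A01 i j; rewrite ?jE ?eqxx // in sij *.
Qed.

Definition edge : rel 'I_N := fun i j => A i j == 1%N.

Lemma path_extend (i : 'I_N) (p : seq 'I_N) : path edge i p ->
  exists y : XA A, forall k, (k <= size p)%N -> XA_coord y k = nth i (i :: p) k.
Proof.
move=> ip; have /choice[s sP] := row_has_edge.
pose y k := if (k <= size p)%N then nth i (i :: p) k
            else iter (k - size p) s (last i p).
have yP : shift_space A y.
  move=> k; rewrite /y; have [kp|pk|kp] := ltngtP k (size p).
  - by apply/eqP; exact: (pathP i ip).
  - by rewrite subSn ?(ltnW pk) //=.
  - by rewrite kp subSnn /= -(last_nth i).
exists (exist (fun y => y \in shift_space A) y (mem_set yP)) => k kp.
by rewrite -[LHS]/(y k) /y kp.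
Qed.

Lemma irreducible_path i j : exists p, path edge i p /\ last i p = j.
Proof.
have [k _] := A_irr i j; elim: k i => [|k IHk] i.
  rewrite expr0 mxE; case: eqP => [-> _|]; last by [].
  by exists [::].
rewrite exprS mxE lt0n sum_nat_eq0 => /forallPn[l]; rewrite /= muln_eq0 negb_or.
case/andP=> Ail; rewrite -lt0n => /IHk[p [lp pj]]; exists (l :: p); split=> //=.
by rewrite lp andbT /edge; have [Ail0|->//] := A01 i l; rewrite Ail0 in Ail.
Qed.

(** From the [n]-th letter of [x] there is a path to a vertex with two successors; the
    two ways to go on give two points agreeing with [x] up to [n], and [x] is at most
    one of them. *)
Lemma XA_perfect (x : XA A) n : exists2 y, agree n x y & y <> x.
Proof.
have [b [j [j' [bj bj' jj']]]] := branching_vertex.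
have [q [xq qb]] := irreducible_path (XA_coord x n) b.
pose w := [seq XA_coord x k.+1 | k <- iota 0 n].
have sw : size w = n by rewrite size_map size_iota.
have wx k : (k <= n)%N -> nth (XA_coord x 0) (XA_coord x 0 :: w) k = XA_coord x k.
  by case: k => // k kn /=; rewrite (nth_map 0) ?size_iota // nth_iota.
have lw : last (XA_coord x 0) w = XA_coord x n.
  by rewrite (last_nth (XA_coord x 0)) sw wx.
have pw : path edge (XA_coord x 0) w.
  apply/(pathP (XA_coord x 0)) => k; rewrite sw => kn.
  have -> : nth (XA_coord x 0) w k = XA_coord x k.+1 := wx k.+1 kn.
  by rewrite (wx _ (ltnW kn)) /edge XA_edge.
have ext l : A b l = 1%N ->
    exists2 y, agree n x y & XA_coord y (n + size q).+1 = l.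
  move=> bl; have [|y yP] := @path_extend (XA_coord x 0) (w ++ rcons q l).
    by rewrite cat_path pw lw rcons_path xq qb /edge bl.
  exists y => [k kn|].
    have le_size : (k <= size (w ++ rcons q l))%N.
      by rewrite size_cat sw (leq_trans (ltnW kn)) // leq_addr.
    by rewrite (yP _ le_size) -cat_cons nth_cat /= sw ltnS (ltnW kn) wx // ltnW.
  have le_size : ((n + size q).+1 <= size (w ++ rcons q l))%N.
    by rewrite size_cat sw size_rcons addnS.
  by rewrite (yP _ le_size) /= nth_cat sw ltnNge leq_addr /= addKn nth_rcons ltnn eqxx.
have [y xy yj] := ext _ bj; have [y' xy' yj'] := ext _ bj'.
have [yx|] := pselect (y = x); last by exists y.
by exists y' => // y'x; move: jj'; rewrite -yj -yj' yx y'x eqxx.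
Qed.

Lemma XA_avoid (x e : XA A) n : exists2 y, agree n x y & y <> e.
Proof.
have [->|xe] := pselect (x = e); first exact: XA_perfect.
by exists x.
Qed.

End Perfect.

End ShiftSpace.

(** * Continuous functions on the shift space and the diagonal *)

Section ContinuousFunctions.
Context {R : realType} {N : nat} {A : 'M[nat]_N}.
Implicit Types (f g : XA A -> R[i]) (x y : XA A) (r : XA A -> R).

(** A record rather than a definition, so that the topological structures behind
    [continuous] are not unfolded when two functions are compared. *)
Record Cfun f : Prop := CfunI { Cfun_continuous : continuous (f : XA A -> R[i]^o) }.

Lemma Cfun_agree f : Cfun f <->
  forall x e, 0 < e -> exists n, forall y, agree n x y -> cmod (f x - f y) < e.
Proof. by split=> [[/continuous_agree]|/continuous_agree]. Qed.

Lemma Cfun_locally_cst f :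
  (forall x, exists n, forall y, agree n x y -> f y = f x) -> Cfun f.
Proof.
move=> fP; apply/Cfun_agree => x e e0; have [n nP] := fP x.
by exists n => y /nP ->; rewrite subrr cmod0.
Qed.

Lemma Cfun_cst (c : R[i]) : Cfun (fun=> c).
Proof. by apply: Cfun_locally_cst => x; exists 0%N. Qed.

Lemma Cfun_CZ (F : int -> R[i]) (f : CZ (XA A)) : Cfun (fun x => F (f x)).
Proof.
apply: Cfun_locally_cst => x; have [n nP] := CZ_agree f x.
by exists n => y /nP ->.
Qed.

Lemma CfunD f g : Cfun f -> Cfun g -> Cfun (fun x => f x + g x).
Proof. by move=> [fC] [gC]; split=> x; exact: (cvgD (fC x) (gC x)). Qed.

Lemma CfunM f g : Cfun f -> Cfun g -> Cfun (fun x => f x * g x).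
Proof. by move=> [fC] [gC]; split=> x; exact: (cvgM (fC x) (gC x)). Qed.

Lemma CfunN f : Cfun f -> Cfun (fun x => - f x).
Proof. by move=> [fC]; split=> x; exact: (cvgN (fC x)). Qed.

Lemma Cfun_conj f : Cfun f -> Cfun (fun x => (f x)^*).
Proof.
move=> /Cfun_agree fC; apply/Cfun_agree => x e e0.
have [n nP] := fC x e e0; exists n => y /nP.
by rewrite -rmorphB/= cmod_conj.
Qed.

Lemma agree_shift n x y : agree n.+1 x y -> agree n (Defs.shift x) (Defs.shift y).
Proof. by move=> xy k kn; rewrite !XA_coord_shift xy. Qed.

Lemma Cfun_shift f : Cfun f -> Cfun (fun x => f (Defs.shift x)).
Proof.
move=> /Cfun_agree fC; apply/Cfun_agree => x e e0.
have [n nP] := fC (Defs.shift x) e e0; exists n.+1 => y xy.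
exact/nP/agree_shift.
Qed.

Lemma Cfun_iter_shift f m : Cfun f -> Cfun (fun x => f (iter m (@Defs.shift _ A) x)).
Proof.
move=> fC; elim: m => [|m IHm]; first exact: fC.
by have := Cfun_shift IHm; congr Cfun; apply/funext => x; rewrite -iterSr.
Qed.

Lemma Cfun_cylinder (w : seq 'I_N) : Cfun \1_(cylinder w : set (XA A)).
Proof.
apply: Cfun_locally_cst => x; exists (size w) => y xy; rewrite !indicE.
congr (nat_of_bool _)%:R; apply/idP/idP; rewrite !inE => wx k i kw.
  by rewrite wx // xy.
by rewrite wx // xy.
Qed.

Definition Cfun_real r := Cfun (fun x => (r x)%:C%C).

Lemma Cfun_realP r : Cfun_real r <->
  forall x e, 0 < e -> exists n, forall y, agree n x y -> `|r x - r y| < e.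
Proof.
rewrite /Cfun_real Cfun_agree.
split=> H x e e0; have [n nP] := H x e e0; exists n => y /nP;
  by rewrite -rmorphB/= cmod_real.
Qed.

Lemma Cfun_Re f : Cfun f -> Cfun_real (fun x => complex.Re (f x)).
Proof.
move=> /Cfun_agree fC; apply/Cfun_realP => x e e0.
have [n nP] := fC x e e0; exists n => y /nP; apply: le_lt_trans.
by rewrite -raddfB; exact: cmod_Re.
Qed.

Lemma Cfun_Im f : Cfun f -> Cfun_real (fun x => complex.Im (f x)).
Proof.
move=> /Cfun_agree fC; apply/Cfun_realP => x e e0.
have [n nP] := fC x e e0; exists n => y /nP; apply: le_lt_trans.
by rewrite -raddfB; exact: cmod_Im.
Qed.

Lemma Cfun_real_comp (phi : R -> R) r :
  continuous phi -> Cfun_real r -> Cfun_real (fun x => phi (r x)).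
Proof.
move=> phiC /Cfun_realP rC; apply/Cfun_realP => x e e0.
have /cvgrPdist_lt/(_ _ e0)/nbhs_normP[d /= d0 dP] := phiC (r x).
have [n nP] := rC x _ d0; exists n => y /nP; exact: dP.
Qed.

Lemma continuous_half_circle : continuous (fun t : R => Num.sqrt (1 - t ^+ 2)).
Proof.
move=> t; apply: (@continuous_comp _ _ _ (fun t : R => 1 - t ^+ 2) (@Num.sqrt R)).
  by apply: (@cvgB _ _ _ (nbhs t)); [exact: cvg_cst|exact: exprn_continuous].
exact: sqrt_continuous.
Qed.

End ContinuousFunctions.

Section DiagonalIdentification.
Context {R : realType} {N : nat} {A : 'M[nat]_N} {OA : cstarType R}.
Context {S : 'I_N -> OA} {Phi : (XA A -> R[i]) -> OA}.
Hypothesis PhiI : diag_identification S Phi.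
Implicit Types (f g h : XA A -> R[i]) (x y : XA A) (w : seq 'I_N).

Lemma Phi_cylinder w : Phi \1_(cylinder w) = word_elt S w * adj (word_elt S w).
Proof. by case: PhiI. Qed.

Lemma PhiM f g : Cfun f -> Cfun g -> Phi (fun x => f x * g x) = Phi f * Phi g.
Proof. by move=> [fC] [gC]; case: PhiI => _ M _ _ _; exact (M f g fC gC). Qed.

Lemma Phi_conj f : Cfun f -> Phi (fun x => (f x)^*) = adj (Phi f).
Proof. by move=> [fC]; case: PhiI => _ _ M _ _; exact (M f fC). Qed.

Lemma Phi_diag f : Cfun f -> diag_alg S (Phi f).
Proof. by move=> [fC]; case: PhiI => _ _ _ [M _ _] _; exact (M f fC). Qed.

Lemma Phi_inj f g : Cfun f -> Cfun g -> Phi f = Phi g -> f = g.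
Proof.
move=> [fC] [gC]; case: PhiI => _ _ _ [_ inj _] _.
exact: (inj f g (mem_set fC) (mem_set gC)).
Qed.

Lemma Phi_surj d : diag_alg S d -> exists2 f, Cfun f & Phi f = d.
Proof.
move=> dD; case: PhiI => _ _ _ [_ _ surj] _; have [f fC fd] := surj d dD.
by exists f.
Qed.

Lemma Phi_lin c f g : Cfun f -> Cfun g ->
  Phi (fun x => c * f x + g x) = c *: Phi f + Phi g.
Proof. by move=> [fC] [gC]; case: PhiI => M _ _ _ _; exact (M c f g fC gC). Qed.

Lemma PhiD f g : Cfun f -> Cfun g -> Phi (fun x => f x + g x) = Phi f + Phi g.
Proof.
move=> fC gC; rewrite -[Phi f]scale1r -Phi_lin //.
by congr Phi; apply/funext => x; rewrite mul1r.
Qed.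

Lemma Phi0 : Phi (fun=> 0) = 0.
Proof.
apply: (@addrI _ (Phi (fun=> 0))); rewrite -PhiD ?addr0; try exact: Cfun_cst.
by congr Phi; apply/funext => x; rewrite addr0.
Qed.

Lemma PhiZ c f : Cfun f -> Phi (fun x => c * f x) = c *: Phi f.
Proof.
move=> fC; rewrite -[RHS]addr0 -Phi0 -Phi_lin //; last exact: Cfun_cst.
by congr Phi; apply/funext => x; rewrite addr0.
Qed.

Lemma PhiN f : Cfun f -> Phi (fun x => - f x) = - Phi f.
Proof.
move=> fC; rewrite -scaleN1r -PhiZ //.
by congr Phi; apply/funext => x; rewrite mulN1r.
Qed.

Lemma PhiB f g : Cfun f -> Cfun g -> Phi (fun x => f x - g x) = Phi f - Phi g.
Proof. by move=> fC gC; rewrite PhiD ?PhiN //; exact: CfunN. Qed.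

Lemma word_elt_nil : word_elt S [::] = 1.
Proof. by rewrite /word_elt big_nil. Qed.

Lemma word_elt_cons i w : word_elt S (i :: w) = S i * word_elt S w.
Proof. by rewrite /word_elt big_cons. Qed.

Lemma word_elt_cat w w' : word_elt S (w ++ w') = word_elt S w * word_elt S w'.
Proof. by rewrite /word_elt big_cat. Qed.

Lemma Phi1 : Phi (fun=> 1) = 1.
Proof.
have := Phi_cylinder [::]; rewrite word_elt_nil star1 mulr1 => <-.
by congr Phi; apply/funext => x; rewrite indicE mem_set.
Qed.

Lemma Phi_cst c : Phi (fun=> c) = c%:A.
Proof.
rewrite -Phi1 -PhiZ; last exact: Cfun_cst.
by congr Phi; apply/funext => x; rewrite mulr1.
Qed.

Lemma PhiC f g : Cfun f -> Cfun g -> Phi f * Phi g = Phi g * Phi f.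
Proof.
by move=> fC gC; rewrite -!PhiM //; congr Phi; apply/funext => x; rewrite mulrC.
Qed.

(** The diagonal is commutative because it is a copy of a function algebra. *)
Lemma diag_comm d e : diag_alg S d -> diag_alg S e -> d * e = e * d.
Proof. by move=> /Phi_surj[f fC <-] /Phi_surj[g gC <-]; exact: PhiC. Qed.

Lemma Phi_unitary h : Cfun h -> (forall x, h x * (h x)^* = 1) -> unitary (Phi h).
Proof.
move=> hC h1; have hC' := Cfun_conj hC.
by split; rewrite -Phi_conj // -PhiM // -Phi1; congr Phi; apply/funext => x;
  rewrite 1?[_^* * _]mulrC h1.
Qed.

(** A real function with values in [-1, 1] is the average of the unimodular
    functions [r +i sqrt (1 - r ^ 2)] and [r -i sqrt (1 - r ^ 2)], and unitaries
    have norm 1; so no compactness is needed to see that [Phi] is bounded. *)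
Lemma Phi_real_le1 (r : XA A -> R) : Cfun_real r -> (forall x, `|r x| <= 1) ->
  nrm (Phi (fun x => (r x)%:C%C)) <= 1.
Proof.
move=> rC r1; pose s x := Num.sqrt (1 - r x ^+ 2).
have sC : Cfun_real s.
  exact: (Cfun_real_comp continuous_half_circle rC).
pose h x := (r x +i* s x)%C.
have hE : h = fun x => (r x)%:C%C + 'i%C * (s x)%:C%C.
  by apply/funext => x; rewrite /h [LHS]complexE.
have hC : Cfun h.
  by rewrite hE; apply: CfunD => //; apply: CfunM => //; exact: Cfun_cst.
have h1 x : h x * (h x)^* = 1.
  have s2 : s x ^+ 2 = 1 - r x ^+ 2.
    by rewrite sqr_sqrtr // subr_ge0 -real_normK ?num_real // exprn_ile1.
  rewrite -[_^*]/(r x -i* s x)%C; simpc.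
  by rewrite -!expr2 s2 addrC subrK mulrC addNr.
have := unitary_nrm (Phi_unitary hC h1) => nh.
have -> : Phi (fun x => (r x)%:C%C) = 2^-1 *: (Phi h + adj (Phi h)).
  have hC' := Cfun_conj hC.
  rewrite -Phi_conj // -PhiD // -PhiZ; last exact: CfunD.
  congr Phi; apply/funext => x.
  by rewrite -[(h x)^*]/(h x)^*%C addcJ mulrA mulVf ?mul1r // (pnatr_eq0 R[i] 2).
rewrite nrmZ cmodV cmod_nat; have := nrmD (Phi h) (adj (Phi h)).
by rewrite nrm_adj nh; lra.
Qed.

Lemma Phi_bound f (M : R) : 0 < M -> Cfun f -> (forall x, cmod (f x) <= M) ->
  nrm (Phi f) <= 2 * M.
Proof.
move=> M0 fC fM.
have part (r : XA A -> R) : Cfun_real r -> (forall x, `|r x| <= M) ->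
    nrm (Phi (fun x => (r x)%:C%C)) <= M.
  move=> rC rM.
  have sE : (fun x => (r x)%:C%C) = fun x => M%:C%C * (M^-1 * r x)%:C%C.
    by apply/funext => x; rewrite -rmorphM/= mulrA mulfV ?mul1r // gt_eqF.
  have sC : Cfun_real (fun x => M^-1 * r x).
    rewrite /Cfun_real.
    have -> : (fun x => (M^-1 * r x)%:C%C) = fun x => M^-1%:C%C * (r x)%:C%C.
      by apply/funext => x; rewrite -rmorphM.
    by apply: CfunM => //; exact: Cfun_cst.
  rewrite sE PhiZ // nrmZ cmod_real gtr0_norm // -[leRHS]mulr1.
  rewrite ler_pM2l // Phi_real_le1 // => x.
  by rewrite normrM gtr0_norm ?invr_gt0 // ler_pdivrMl // mulr1.
have fE : f = fun x => 'i%C * (complex.Im (f x))%:C%C + (complex.Re (f x))%:C%C.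
  by apply/funext => x; rewrite addrC -complexE.
rewrite fE Phi_lin; [|exact: Cfun_Im|exact: Cfun_Re].
apply: (le_trans (nrmD _ _)); rewrite nrmZ.
have -> : cmod ('i%C : R[i]) = 1.
  by rewrite /cmod normc_def /= expr0n/= add0r expr1n sqrtr1.
rewrite mul1r mulr_natl mulr2n; apply: lerD.
  by apply: part => [|x]; [exact: Cfun_Im|exact: le_trans (cmod_Im _) (fM x)].
by apply: part => [|x]; [exact: Cfun_Re|exact: le_trans (cmod_Re _) (fM x)].
Qed.

Lemma cylinder_agree_ind x y n :
  (\1_(cylinder (prefix_word x n)) y : R[i]) = `[< agree n x y >]%:R.
Proof.
rewrite indicE; congr (nat_of_bool _)%:R.
by apply/idP/asboolP; rewrite inE cylinder_prefix.
Qed.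

(** Multiplying by these projections localizes an element of the algebra near [x]. *)
Definition proj_cyl x n : OA := Phi \1_(cylinder (prefix_word x n)).

Lemma proj_cyl_idem x n : proj_cyl x n * proj_cyl x n = proj_cyl x n.
Proof.
rewrite /proj_cyl -PhiM; try exact: Cfun_cylinder.
congr Phi; apply/funext => y; rewrite !indicE.
by case: (y \in _); rewrite ?mulr1 ?mulr0.
Qed.

Lemma proj_cyl_adj x n : adj (proj_cyl x n) = proj_cyl x n.
Proof.
rewrite /proj_cyl -Phi_conj; last exact: Cfun_cylinder.
by congr Phi; apply/funext => y; rewrite !indicE rmorph_nat.
Qed.

(** A projection has norm 0 or 1, and [Phi] is injective. *)
Lemma proj_cyl_nrm x n : nrm (proj_cyl x n) = 1.
Proof.
have n0 : nrm (proj_cyl x n) != 0.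
  apply/eqP => /nrm_eq0; rewrite -Phi0.
  move=> /(Phi_inj (@Cfun_cylinder _ _ _ _) (@Cfun_cst _ _ _ _)).
  move=> /(congr1 (fun f => f x)); rewrite cylinder_agree_ind.
  by case: asboolP => [_ /eqP|[]//]; rewrite oner_eq0.
by apply: (mulfI n0); rewrite -expr2 -nrm_cstar proj_cyl_adj proj_cyl_idem mulr1.
Qed.

Lemma proj_cylM x y m n : agree n x y -> (n <= m)%N ->
  proj_cyl x n * proj_cyl y m = proj_cyl y m.
Proof.
move=> xy nm; rewrite /proj_cyl -PhiM; try exact: Cfun_cylinder.
congr Phi; apply/funext => z; rewrite !cylinder_agree_ind.
case: (asboolP (agree m y z)) => yz; last by rewrite mulr0.
rewrite mulr1; case: asboolP => // -[].
exact: agree_trans xy (agreeW nm yz).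
Qed.

(** On a small cylinder around [x], [Phi f] differs little from [f x] times a
    projection, which has norm 1. *)
Lemma Phi_cut_lower f x n (M : R) : Cfun f -> nrm (proj_cyl x n * Phi f) <= M ->
  cmod (f x) <= M.
Proof.
move=> fC fM; apply/ler_addgt0Pr => e e0.
have e40 : 0 < e / 4 by rewrite divr_gt0.
have [m mP] := (Cfun_agree f).1 fC x _ e40.
pose k := maxn m n; pose p := proj_cyl x k.
have pf : nrm (p * Phi f) <= M.
  apply: le_trans fM; rewrite /p -(@proj_cylM x x k n) ?leq_maxr //.
  rewrite [proj_cyl x n * _]PhiC; try exact: Cfun_cylinder.
  rewrite -mulrA; apply: le_trans (nrmM _ _) _.
  by rewrite proj_cyl_nrm mul1r.
have : nrm (Phi (fun y => \1_(cylinder (prefix_word x k)) y * (f x - f y))) <= 2 * (e / 4).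
  apply: Phi_bound => //.
    apply: CfunM; first exact: Cfun_cylinder.
    by apply: CfunD; [exact: Cfun_cst|exact: CfunN].
  move=> y; rewrite cylinder_agree_ind; case: asboolP => xy.
    by rewrite mul1r; apply/ltW/mP/(agreeW _ xy)/leq_maxl.
  by rewrite mul0r cmod0 ltW.
rewrite PhiM ?PhiB ?Phi_cst; try exact: Cfun_cylinder; try exact: Cfun_cst; last first.
- by apply: CfunD; [exact: Cfun_cst|exact: CfunN].
- by [].
rewrite -[Phi \1_(_)]/p mulrBr -scalerAr mulr1.
have := nrmD (f x *: p - p * Phi f) (p * Phi f).
rewrite subrK nrmZ proj_cyl_nrm mulr1; lra.
Qed.

(** Together with [Phi_bound]: [Phi] is a homeomorphism onto the diagonal for the
    uniform norm. This also shows that continuous functions are bounded, without an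
    appeal to the compactness of the shift space. *)
Lemma Phi_lower f x : Cfun f -> cmod (f x) <= nrm (Phi f).
Proof.
move=> fC; apply: (@Phi_cut_lower f x 0) => //.
by rewrite (le_trans (nrmM _ _)) // proj_cyl_nrm mul1r.
Qed.

End DiagonalIdentification.

(** * Covariance and automorphisms fixing the diagonal *)

Section Covariance.
Context {R : realType} {N : nat} {A : 'M[nat]_N} {OA : cstarType R}.
Context {S : 'I_N -> OA} {Phi : (XA A -> R[i]) -> OA}.
Hypotheses (OA_ck : ck_family A S) (PhiI : diag_identification S Phi).
Implicit Types (f g h : XA A -> R[i]) (x y : XA A) (w : seq 'I_N).

Lemma gen_partial_isometry i : S i * adj (S i) * S i = S i.
Proof. by case: OA_ck => /(_ i). Qed.

Lemma gen_sum_range : \sum_j S j * adj (S j) = 1.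
Proof. by case: OA_ck. Qed.

Lemma gen_source i : adj (S i) * S i = \sum_j (S j * adj (S j)) *+ A i j.
Proof. by case: OA_ck. Qed.

Lemma diag_subalgebra : cstar_subalgebra (diag_alg S).
Proof. exact: cstar_generated_subalgebra. Qed.

Lemma diag_word w : diag_alg S (word_elt S w * adj (word_elt S w)).
Proof. by apply: sub_cstar_generated; exists w. Qed.

Lemma word_elt1 i : word_elt S [:: i] = S i.
Proof. by rewrite word_elt_cons word_elt_nil mulr1. Qed.

Lemma diag_range i : diag_alg S (S i * adj (S i)).
Proof. by have := diag_word [:: i]; rewrite word_elt1. Qed.

Lemma diagD d e : diag_alg S d -> diag_alg S e -> diag_alg S (d + e).
Proof.
case: diag_subalgebra => _ lin _ _ _ dD eD.
by have := lin 1 _ _ dD eD; rewrite scale1r.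
Qed.

Lemma diagM d e : diag_alg S d -> diag_alg S e -> diag_alg S (d * e).
Proof. by case: diag_subalgebra => _ _ mul _ _; exact: mul. Qed.

Lemma diag_adj d : diag_alg S d -> diag_alg S (adj d).
Proof. by case: diag_subalgebra => _ _ _ star _; exact: star. Qed.

Lemma diag0 : diag_alg S 0.
Proof. by case: diag_subalgebra. Qed.

Lemma diagZ c d : diag_alg S d -> diag_alg S (c *: d).
Proof.
case: diag_subalgebra => d0 lin _ _ _ dD.
by have := lin c _ _ dD d0; rewrite addr0.
Qed.

Lemma diag1 : diag_alg S 1.
Proof. by have := diag_word [::]; rewrite word_elt_nil star1 mulr1. Qed.

Lemma diag_closed d : (forall e, 0 < e -> exists2 d', diag_alg S d' & nrm (d - d') < e) ->
  diag_alg S d.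
Proof. by case: diag_subalgebra => _ _ _ _ /closed_nrmP cl; exact: cl. Qed.

Lemma diag_source i : diag_alg S (adj (S i) * S i).
Proof.
rewrite gen_source; apply: (big_ind (diag_alg S)); [exact: diag0|exact: diagD|].
move=> j _; elim: (A i j) => [|n IHn]; first by rewrite mulr0n; exact: diag0.
by rewrite mulrS; apply: diagD => //; exact: diag_range.
Qed.

Lemma gen_range_indicator i : Phi \1_(cylinder [:: i]) = S i * adj (S i).
Proof. by rewrite (Phi_cylinder PhiI) word_elt1. Qed.

Lemma cylinder_cons i w x :
  \1_(cylinder (i :: w)) x =
  \1_(cylinder w) (Defs.shift x) * \1_(cylinder [:: i]) x :> R[i].
Proof.
rewrite !indicE -natrM mulnb; congr (nat_of_bool _)%:R.
apply/idP/andP; rewrite !inE.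
  move=> iwx; split; first by move=> k j kw; exact: (iwx k.+1 j kw).
  by move=> [|//] j _; exact: (iwx 0%N j).
by move=> [wx ix] [|k] j kw; [exact: (ix 0%N j)|exact: wx].
Qed.

Lemma Cfun_cylinder_shift w : Cfun (fun x : XA A => \1_(cylinder w) (Defs.shift x) : R[i]).
Proof. by apply: (Cfun_shift (f := \1_(cylinder w))); exact: Cfun_cylinder. Qed.

Lemma covariance_cylinder i w :
  S i * Phi \1_(cylinder w) = Phi (fun x => \1_(cylinder w) (Defs.shift x)) * S i.
Proof.
have wC := Cfun_cylinder_shift w; have iC := @Cfun_cylinder R _ A [:: i].
rewrite -[in RHS]gen_partial_isometry mulrA -gen_range_indicator -(PhiM PhiI) //.
have -> : (fun x : XA A => \1_(cylinder w) (Defs.shift x) * \1_(cylinder [:: i]) x : R[i])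
    = \1_(cylinder (i :: w)) by apply/funext => x; exact/esym/cylinder_cons.
rewrite !(Phi_cylinder PhiI) word_elt_cons starM !mulrA.
rewrite -[in RHS](mulrA _ (adj (S i))) -(mulrA (S i) _ (adj (word_elt _ _))).
rewrite -(mulrA (S i) _ (adj (S i) * S i)).
rewrite (diag_comm PhiI (diag_word w) (diag_source i)) !mulrA.
by rewrite gen_partial_isometry.
Qed.

(** On indicators of cylinders this is the multiplication of words. It passes to the
    whole diagonal because the functions for which it holds, together with their
    conjugates, correspond to a closed subalgebra; the bounds of [Phi] in both
    directions give closedness. *)
Lemma covariance i f : Cfun f ->
  S i * Phi f = Phi (fun x => f (Defs.shift x)) * S i.
Proof.
pose cov f := S i * Phi f = Phi (fun x => f (Defs.shift x)) * S i.
pose M : set OA :=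
  [set d | exists f, [/\ Cfun f, Phi f = d, cov f & cov (fun x => (f x)^*)]].
have covD c g h : Cfun g -> Cfun h -> cov g -> cov h -> cov (fun x => c * g x + h x).
  move=> gC hC cg ch; rewrite /cov (Phi_lin PhiI) // mulrDr -scalerAr cg ch.
  by rewrite scalerAl -mulrDl -(Phi_lin PhiI) //; exact: Cfun_shift.
have covM g h : Cfun g -> Cfun h -> cov g -> cov h -> cov (fun x => g x * h x).
  move=> gC hC cg ch; rewrite /cov (PhiM PhiI) // mulrA cg -mulrA ch mulrA.
  by rewrite -(PhiM PhiI) //; exact: Cfun_shift.
have DM : diag_alg S `<=` M.
  apply: cstar_generated_ind => [|_ [w _ <-]]; last first.
    exists \1_(cylinder w); split; [exact: Cfun_cylinder|exact: (Phi_cylinder PhiI)| |].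
      exact: covariance_cylinder.
    have -> : (fun x : XA A => (\1_(cylinder w) x : R[i])^*) = \1_(cylinder w).
      by apply/funext => x; rewrite indicE rmorph_nat.
    exact: covariance_cylinder.
  split.
  - exists (fun=> 0); split; [exact: Cfun_cst|exact: (Phi0 PhiI)| |].
      by rewrite /cov (Phi0 PhiI) mulr0 mul0r.
    by rewrite /cov rmorph0 (Phi0 PhiI) mulr0 mul0r.
  - move=> c _ _ [g [gC <- cg cg']] [h [hC <- ch ch']].
    exists (fun x => c * g x + h x); split; [|exact: (Phi_lin PhiI)|exact: covD|].
      by apply: CfunD => //; apply: CfunM => //; exact: Cfun_cst.
    have -> : (fun x => (c * g x + h x)^*) = (fun x => c^* * (g x)^* + (h x)^*).
      by apply/funext => x; rewrite rmorphD rmorphM.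
    by apply: covD => //; exact: Cfun_conj.
  - move=> _ _ [g [gC <- cg cg']] [h [hC <- ch ch']].
    exists (fun x => g x * h x); split; [exact: CfunM|exact: (PhiM PhiI)|exact: covM|].
    have -> : (fun x => (g x * h x)^*) = (fun x => (g x)^* * (h x)^*).
      by apply/funext => x; rewrite rmorphM.
    by apply: covM => //; exact: Cfun_conj.
  - move=> _ [g [gC <- cg cg']]; exists (fun x => (g x)^*).
    split; [exact: Cfun_conj|exact: (Phi_conj PhiI)|by []|].
    by have -> : (fun x => (g x)^*^*) = g by apply/funext => x; rewrite conjCK.
  - apply/closed_nrmP => d dM.
    have [|g gC gd] := Phi_surj PhiI (d := d).
      apply: diag_closed => e /dM[_ [g [gC <- _ _]] dg].
      by exists (Phi g) => //; exact: Phi_diag.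
    have covg (u : XA A -> R[i]) : Cfun u ->
      (forall e, 0 < e -> exists2 v, Cfun v /\ cov v & nrm (Phi u - Phi v) < e) -> cov u.
      move=> uC uP; apply/eqP; rewrite -subr_eq0; apply/eqP.
      apply: nrm_small_eq0 => e e0.
      have K0 : 0 < 3 * (nrm (S i) + 1) by rewrite mulr_gt0 // ltr_wpDl ?nrm_ge0.
      have [v [vC cv] uv] := uP _ (divr_gt0 e0 K0); set t := e / _ in uv.
      have uvC : Cfun (fun x => u x - v x) by apply: CfunD => //; exact: CfunN.
      have sh : nrm (Phi (fun x => u (Defs.shift x)) - Phi (fun x => v (Defs.shift x)))
          <= 2 * t.
        rewrite -(PhiB PhiI); try exact: Cfun_shift.
        apply: (Phi_bound PhiI); first by rewrite divr_gt0.
          exact: (Cfun_shift uvC).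
        move=> x; apply: le_trans (ltW uv); rewrite -(PhiB PhiI) //.
        exact: (Phi_lower PhiI _ uvC).
      have -> : S i * Phi u - Phi (fun x => u (Defs.shift x)) * S i =
          S i * (Phi u - Phi v) -
          (Phi (fun x => u (Defs.shift x)) - Phi (fun x => v (Defs.shift x))) * S i.
        by rewrite mulrBr mulrBl -cv opprB addrA subrK.
      apply: (le_trans (nrmD _ _)); rewrite nrmN.
      apply: (@le_trans _ _ (nrm (S i) * t + 2 * t * nrm (S i))).
        apply: lerD; first by rewrite (le_trans (nrmM _ _)) // ler_wpM2l ?nrm_ge0 ?ltW.
        by rewrite (le_trans (nrmM _ _)) // ler_wpM2r ?nrm_ge0.
      have -> : e = t * (3 * (nrm (S i) + 1)) by rewrite mulfVK // gt_eqF.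
      have t0 : 0 < t by rewrite divr_gt0.
      by have := nrm_ge0 (S i); nra.
    exists g; split=> //.
      by apply: covg => // e /dM[_ [v [vC <- cv _]] dv]; exists v; rewrite ?gd.
    apply: covg => [|e /dM[_ [v [vC <- _ cv]] dv]]; first exact: Cfun_conj.
    exists (fun x => (v x)^*); first by split=> //; exact: Cfun_conj.
    by rewrite !(Phi_conj PhiI) // -starB nrm_adj gd.
move=> fC; have [g [gC gf cg _]] := DM _ (Phi_diag PhiI fC).
by rewrite -[f](Phi_inj PhiI gC fC gf).
Qed.

Lemma covariance_word w f : Cfun f ->
  word_elt S w * Phi f = Phi (fun x => f (iter (size w) (@Defs.shift _ A) x)) * word_elt S w.
Proof.
move=> fC; elim: w => [|i w IHw]; first by rewrite word_elt_nil mul1r mulr1.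
rewrite word_elt_cons -mulrA IHw mulrA covariance ?mulrA; last exact: Cfun_iter_shift.
by congr (Phi _ * _ * _); apply/funext => x; rewrite -iterSr.
Qed.

End Covariance.

Section Twist.
Context {R : realType} {N : nat} {A : 'M[nat]_N} {OA : cstarType R}.
Context {S : 'I_N -> OA} {Phi : (XA A -> R[i]) -> OA}.
Hypotheses (OA_univ : cuntz_krieger A S) (PhiI : diag_identification S Phi).
Implicit Types (h : XA A -> R[i]).

Let OA_ck : ck_family A S. Proof. by case: OA_univ. Qed.

Lemma gen_ext (B : cstarType R) (phi psi : OA -> B) :
  star_morphism phi -> star_morphism psi -> (forall i, phi (S i) = psi (S i)) ->
  phi = psi.
Proof.
move=> phiM psiM eqS; case: OA_univ => _ gen _.
by apply: (smorph_ext phiM psiM gen) => _ [i _ <-].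
Qed.

(** A diagonal unitary commutes with the range projections and disappears from the
    source projections, so twisting by it preserves the Cuntz-Krieger relations. *)
Lemma twist_family h : Cfun h -> (forall x, h x * (h x)^* = 1) ->
  ck_family A (fun i => Phi h * S i).
Proof.
move=> hC h1; have [hh1 hh2] := Phi_unitary PhiI hC h1.
have hD := Phi_diag PhiI hC.
have range j : Phi h * S j * adj (Phi h * S j) = S j * adj (S j).
  rewrite starM mulrA -(mulrA (Phi h)) (diag_comm PhiI hD (diag_range j)).
  by rewrite -mulrA hh2 mulr1.
split=> [i||i].
- rewrite /partial_isometry range mulrA -(diag_comm PhiI hD (diag_range i)) -mulrA.
  by rewrite (gen_partial_isometry OA_ck).
- by rewrite -(gen_sum_range OA_ck); apply: eq_bigr => j _.
- rewrite starM mulrA -(mulrA (adj (S i))) hh1 mulr1 (gen_source OA_ck).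
  by apply: eq_bigr => j _; rewrite range.
Qed.

(** The image of a word is the word multiplied by a diagonal unitary, by covariance;
    this unitary cancels in the range projections of words, which generate the
    diagonal. *)
Lemma twist_morphism h : Cfun h -> (forall x, h x * (h x)^* = 1) ->
  exists phi : OA -> OA, [/\ star_morphism phi, forall i, phi (S i) = Phi h * S i
    & forall d, diag_alg S d -> phi d = d].
Proof.
move=> hC h1; case: OA_univ => _ _ /(_ _ _ (twist_family hC h1)).
move=> [phi [[phiM phiS] _]]; exists phi; split=> //.
suff : diag_alg S `<=` [set d | phi d = d] by [].
apply: cstar_generated_ind; first exact: equalizer_subalgebra (smorph_id OA).
move=> _ [w _ <-] /=.
have [k [kC k1 ->]] : exists k, [/\ Cfun k, forall x, k x * (k x)^* = 1 &
    phi (word_elt S w * adj (word_elt S w)) =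
    Phi k * word_elt S w * adj (Phi k * word_elt S w)].
  suff [k [kC k1 kE]] : exists k, [/\ Cfun k, forall x, k x * (k x)^* = 1 &
      phi (word_elt S w) = Phi k * word_elt S w].
    by exists k; split=> //; rewrite (smorphM phiM) (smorph_adj phiM) kE.
  elim: w => [|i w [k [kC k1 kE]]].
    exists (fun=> 1); rewrite word_elt_nil (smorph1 phiM) (Phi1 PhiI) mulr1.
    by split=> // [|x]; [exact: Cfun_cst|rewrite rmorph1 mulr1].
  have kC' := Cfun_shift kC.
  exists (fun x => h x * k (Defs.shift x)); split; first exact: CfunM.
    by move=> x; rewrite rmorphM mulrACA h1 k1 mulr1.
  rewrite word_elt_cons (smorphM phiM) phiS kE (PhiM PhiI) // -!mulrA.
  by rewrite [S i * _]mulrA (covariance OA_ck PhiI) // -mulrA.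
have [_ kk] := Phi_unitary PhiI kC k1.
rewrite starM mulrA -(mulrA (Phi k)).
rewrite (diag_comm PhiI (Phi_diag PhiI kC) (diag_word w)).
by rewrite -mulrA kk mulr1.
Qed.

End Twist.

(** * The circle and its roots of unity *)

Section Characters.
Context {R : realType}.
Implicit Types (s t theta : R).

Lemma expiD s t : expi (s + t) = expi s * expi t.
Proof. by rewrite /expi cosD sinD; simpc; congr (_ +i* _)%C; rewrite addrC. Qed.

Lemma expi0 : expi (0 : R) = 1.
Proof. by rewrite /expi cos0 sin0. Qed.

Lemma expi_conj t : (expi t)^* = expi (- t).
Proof. by rewrite /expi cosN sinN. Qed.

Lemma expi_unimodular t : expi t * (expi t)^* = 1.
Proof. by rewrite expi_conj -expiD subrr expi0. Qed.

Lemma expiMn t n : expi (t *+ n) = expi t ^+ n.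
Proof. by elim: n => [|n IHn]; rewrite ?expi0 // mulrS expiD IHn exprS. Qed.

Lemma unimodular_cmod (z : R[i]) : z * z^* = 1 -> cmod z = 1.
Proof.
move=> z1; apply/eqP; rewrite -(@eqrXn2 _ 2) ?cmod_ge0 //.
by rewrite expr1n expr2 -[X in _ * X]cmod_conj -cmodM z1 cmod1.
Qed.

Lemma cmod_expi t : cmod (expi t) = 1.
Proof. exact/unimodular_cmod/expi_unimodular. Qed.

Lemma expi_2pi : expi (2 * pi : R) = 1.
Proof. by rewrite /expi mulr_natl cos2pi sin2pi. Qed.

Lemma expi_2pi_int (k : int) : expi (2 * pi * k%:~R : R) = 1.
Proof.
have pos n : expi (2 * pi * n%:R : R) = 1 by rewrite mulr_natr expiMn expi_2pi expr1n.
case: k => n; first exact: pos.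
by rewrite NegzE mulrNz mulrN -expi_conj pos rmorph1.
Qed.

(** Subtract the multiple of [2 pi] just below [t]: the half-angle of the remainder
    lies in [0, pi), where the sine only vanishes at 0. *)
Lemma expi_eq1 t : expi t = 1 -> exists k : int, t = 2 * pi * k%:~R.
Proof.
move=> t1; have pi0 := @pi_gt0 R; have p2 : 0 < 2 * pi :> R by rewrite mulr_gt0.
exists (Num.floor (t / (2 * pi))); set k := Num.floor _.
pose r := t - 2 * pi * k%:~R.
have r1 : expi r = 1 by rewrite expiD t1 -expi_conj expi_2pi_int rmorph1 mulr1.
have r0 : 0 <= r.
  by rewrite subr_ge0 mulrC -ler_pdivlMr // ge_floor.
have r2 : r < 2 * pi.
  rewrite ltrBlDr -[X in X + _]mulr1 -mulrDr mulrC -ltr_pdivrMr //.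
  by rewrite addrC -[1]/(1%:~R) -intrD floorD1_gt.
suff : r = 0 by move/eqP; rewrite subr_eq0 => /eqP.
apply/eqP; rewrite eq_le r0 andbT leNgt; apply/negP => r_gt0.
have s0 : 0 < sin (r / 2).
  by apply: sin_gt0_pi; rewrite divr_gt0 // ltr_pdivrMr // mulrC.
have : cos (r / 2 *+ 2) = 1.
  have -> : r / 2 *+ 2 = r by rewrite -mulr_natr mulfVK // pnatr_eq0.
  by have := congr1 (@complex.Re R) r1.
rewrite cos_mulr2n cos2sin2 => h; have : sin (r / 2) ^+ 2 = 0 by lra.
by move/eqP; rewrite sqrf_eq0 gt_eqF.
Qed.

Definition root_of_unity m (j : nat) : R[i] := expi (2 * pi / m.+1%:R *+ j).

Lemma root_unimodular m j : root_of_unity m j * (root_of_unity m j)^* = 1.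
Proof. exact: expi_unimodular. Qed.

(** Orthogonality of the characters of a finite cyclic group: a geometric sum. *)
Lemma root_of_unity_sum m p q : (p <= m)%N -> (q <= m)%N ->
  m.+1%:R^-1 * \sum_(j < m.+1) root_of_unity m j ^+ p * (root_of_unity m j)^* ^+ q
  = (p == q)%:R.
Proof.
move=> pm qm; pose theta : R := 2 * pi * (p%:R - q%:R) / m.+1%:R.
have m0 : m.+1%:R != 0 :> R by rewrite pnatr_eq0.
have term j : root_of_unity m j ^+ p * (root_of_unity m j)^* ^+ q = expi theta ^+ j.
  rewrite /root_of_unity expi_conj -!expiMn -expiD; congr expi.
  rewrite -[_ *+ j]mulr_natr -[_ *+ p]mulr_natr -[_ *+ q]mulr_natr mulNr -mulrBr.
  by rewrite mulrAC [2 * pi / _ * _]mulrAC -[theta *+ j]mulr_natr.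
under eq_bigr => j _ do rewrite term.
have [pq|pq] := eqVneq p q.
  have -> : theta = 0 by rewrite /theta pq subrr mulr0 mul0r.
  rewrite expi0; under eq_bigr => j _ do rewrite expr1n.
  by rewrite sumr_const card_ord -[1 *+ _]/(m.+1%:R) mulVf // (pnatr_eq0 R[i]).
have theta1 : expi theta - 1 != 0.
  rewrite subr_eq0; apply/eqP => /expi_eq1[k kE].
  have {}kE : (p%:R - q%:R : R) = k%:~R * m.+1%:R.
    have p2 : 2 * pi != 0 :> R by rewrite mulf_neq0 ?pnatr_eq0 // gt_eqF ?pi_gt0.
    apply: (mulfI p2); rewrite mulrA -kE /theta mulfVK //.
  have {}kE : (p%:Z - q%:Z = k * m.+1%:Z)%R.
    by apply: (@intr_inj R); rewrite rmorphB rmorphM.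
  have k0 : k = 0 by nia.
  by move: kE pq; rewrite k0 mul0r => /eqP; rewrite subr_eq0 => /eqP[->]; rewrite eqxx.
apply: (mulIf theta1); rewrite mul0r -mulrA [X in _ * X]mulrC.
rewrite -subrX1 -expiMn.
have -> : theta *+ m.+1 = 2 * pi * (p%:Z - q%:Z)%:~R.
  by rewrite -[theta *+ _]mulr_natr /theta mulfVK // rmorphB.
by rewrite expi_2pi_int subrr mulr0.
Qed.

End Characters.

(** * Density of the monomials *)

Section LinearSpan.
Context {R : realType} {B : cstarType R}.

(** Linear combinations, as an inductive predicate so that properties of the monomials
    extend to their combinations by induction. *)
Inductive span (G : set B) : set B :=
| span0 : span G 0
| span_cons c g x : G g -> span G x -> span G (c *: g + x).

Lemma span_gen (G : set B) g : G g -> span G g.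
Proof.
move=> Gg; rewrite -[g]scale1r -[X in span G X]addr0.
by apply: span_cons => //; exact: span0.
Qed.

Lemma spanD (G : set B) x y : span G x -> span G y -> span G (x + y).
Proof.
move=> xG yG; elim: xG => [|c g z Gg _ IH]; first by rewrite add0r.
by rewrite -addrA; exact: span_cons.
Qed.

Lemma spanZ (G : set B) c x : span G x -> span G (c *: x).
Proof.
elim=> [|d g z Gg _ IH]; first by rewrite scaler0; exact: span0.
by rewrite scalerDr scalerA; exact: span_cons.
Qed.

Lemma span_sum (G : set B) I (r : seq I) (F : I -> B) :
  (forall i, span G (F i)) -> span G (\sum_(i <- r) F i).
Proof. by move=> FG; apply: (big_ind (span G)) => //; [exact: span0|exact: spanD]. Qed.

Lemma span_linear (B' : cstarType R) (G : set B) (M : set B') (T : B -> B') :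
  M 0 -> (forall c y z, M y -> M z -> M (c *: y + z)) ->
  T 0 = 0 -> (forall c y z, T (c *: y + z) = c *: T y + T z) ->
  (forall g, G g -> M (T g)) -> forall x, span G x -> M (T x).
Proof.
move=> M0 Mlin T0 Tlin TG x; elim=> [|c g z Gg _ IH]; first by rewrite T0.
by rewrite Tlin; apply: Mlin => //; exact: TG.
Qed.

Definition dense_in_norm (M : set B) :=
  forall x e, 0 < e -> exists2 y, M y & nrm (x - y) < e.

End LinearSpan.

Section Monomials.
Context {R : realType} {N : nat} {A : 'M[nat]_N} {OA : cstarType R}.
Context {S : 'I_N -> OA} {Phi : (XA A -> R[i]) -> OA}.
Hypotheses (OA_univ : cuntz_krieger A S) (PhiI : diag_identification S Phi).
Implicit Types (mu nu : seq 'I_N).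

Let OA_ck : ck_family A S. Proof. by case: OA_univ. Qed.

Definition monomial (S : 'I_N -> OA) mu nu := word_elt S mu * adj (word_elt S nu).

(** The predicate on the two lengths selects gauge degrees. *)
Definition monomials (S : 'I_N -> OA) (p : nat -> nat -> bool) : set OA :=
  [set x | exists mu nu, p (size mu) (size nu) /\ x = monomial S mu nu].

(** The range projections of distinct generators are indicators of disjoint cylinders. *)
Lemma gen_orthogonal i j : i != j -> adj (S i) * S j = 0.
Proof.
move=> ij; have pp : S i * adj (S i) * (S j * adj (S j)) = 0.
  rewrite -!(gen_range_indicator PhiI) -(PhiM PhiI); try exact: Cfun_cylinder.
  rewrite -(Phi0 PhiI); congr Phi; apply/funext => x; rewrite !indicE -natrM mulnb.
  case: andP => //; rewrite !inE => -[ix jx].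
  by case/eqP: ij; exact: (etrans (ix 0%N i isT) (esym (jx 0%N j isT))).
have Si : adj (S i) = adj (S i) * (S i * adj (S i)).
  by rewrite -{1}(gen_partial_isometry OA_ck i) !starM starK.
rewrite Si -(gen_partial_isometry OA_ck j) -mulrA [X in _ * X]mulrA pp.
by rewrite mul0r mulr0.
Qed.

Lemma range_gen i j : S j * adj (S j) * S i = if j == i then S i else 0.
Proof.
case: eqVneq => [->|ji]; first exact: gen_partial_isometry OA_ck _.
by rewrite -mulrA gen_orthogonal // mulr0.
Qed.

Lemma monomial_cons i mu nu : monomial S (i :: mu) nu = S i * monomial S mu nu.
Proof. by rewrite /monomial word_elt_cons mulrA. Qed.

Notation all_monomials := (monomials S (fun _ _ => true)).

Lemma span_monomial mu nu : span all_monomials (monomial S mu nu).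
Proof. by apply: span_gen; exists mu, nu. Qed.

(** For empty [mu] the letter [j] is appended to both words; otherwise the projection
    keeps or kills the first letter of [mu]. *)
Lemma range_monomial j mu nu : span all_monomials (S j * adj (S j) * monomial S mu nu).
Proof.
case: mu => [|i mu].
  rewrite {1}/monomial word_elt_nil mul1r -mulrA -starM.
  have -> : word_elt S nu * S j = word_elt S (rcons nu j).
    by rewrite -cats1 word_elt_cat word_elt1.
  rewrite -[S j]word_elt1; exact: span_monomial.
rewrite monomial_cons mulrA range_gen.
case: eqP => _; last by rewrite mul0r; exact: span0.
by rewrite -monomial_cons; exact: span_monomial.
Qed.

Lemma span_mul_gen i x : span all_monomials x -> span all_monomials (S i * x).
Proof.
apply: (@span_linear _ OA OA all_monomials (span all_monomials) (fun x => S i * x)) => //.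
- exact: span0.
- by move=> c y z ? ?; apply: spanD => //; exact: spanZ.
- exact: mulr0.
- by move=> c y z; rewrite mulrDr -scalerAr.
- by move=> _ [mu [nu [_ ->]]]; rewrite -monomial_cons; exact: span_monomial.
Qed.

Lemma span_mul_adj_gen i x : span all_monomials x -> span all_monomials (adj (S i) * x).
Proof.
apply: (@span_linear _ OA OA all_monomials (span all_monomials) (fun x => adj (S i) * x)) => //.
- exact: span0.
- by move=> c y z ? ?; apply: spanD => //; exact: spanZ.
- exact: mulr0.
- by move=> c y z; rewrite mulrDr -scalerAr.
move=> _ [[|j mu] [nu [_ ->]]].
  rewrite {1}/monomial word_elt_nil mul1r -starM.
  have -> : word_elt S nu * S i = word_elt S (rcons nu i).
    by rewrite -cats1 word_elt_cat word_elt1.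
  by have := span_monomial [::] (rcons nu i); rewrite /monomial word_elt_nil mul1r.
rewrite monomial_cons mulrA; have [->|ij] := eqVneq i j; last first.
  by rewrite gen_orthogonal // mul0r; exact: span0.
rewrite (gen_source OA_ck) mulr_suml; apply: span_sum => k.
elim: (A j k) => [|n IHn]; first by rewrite mulr0n mul0r; exact: span0.
by rewrite mulrS mulrDl; apply: spanD => //; exact: range_monomial.
Qed.

(** The elements whose left multiplications, and those of their adjoints, preserve
    the closed span of the monomials form a closed subalgebra containing every
    [S i], hence everything; applied to the monomial [1] this gives density. *)
Lemma monomials_dense : dense_in_norm (span all_monomials).
Proof.
pose P := span all_monomials.
pose M : set OA := [set x | forall e, 0 < e -> exists2 y, P y & nrm (x - y) < e].
have M_closed x : (forall e, 0 < e -> exists2 y, M y & nrm (x - y) < e) -> M x.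
  move=> xM e e0; have e20 : 0 < e / 2 by rewrite divr_gt0.
  have [y yM xy] := xM _ e20; have [z zP yz] := yM _ e20; exists z => //.
  by have := nrm_dist y x z; lra.
have M_lin c x y : M x -> M y -> M (c *: x + y).
  move=> xM yM e e0; have e20 : 0 < e / 2 by rewrite divr_gt0.
  have c1 : 0 < cmod c + 1 by rewrite ltr_wpDl // cmod_ge0.
  have [x' xP xx] := xM _ (divr_gt0 e20 c1); have [y' yP yy] := yM _ e20.
  exists (c *: x' + y'); first by apply: spanD => //; exact: spanZ.
  rewrite opprD addrACA -scalerBr; have := nrmD (c *: (x - x')) (y - y').
  rewrite nrmZ; move: xx; rewrite ltr_pdivlMr // => xx.
  by have := nrm_ge0 (x - x'); nra.
have M0 : M 0 by move=> e e0; exists 0; rewrite ?subrr ?nrm0 //; exact: span0.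
have M_mul s : (forall x, P x -> P (s * x)) -> forall x, M x -> M (s * x).
  move=> sP x xM e e0; have s1 : 0 < nrm s + 1 by rewrite ltr_wpDl // nrm_ge0.
  have [y yP xy] := xM _ (divr_gt0 e0 s1); exists (s * y); first exact: sP.
  rewrite -mulrBr; apply: (le_lt_trans (nrmM _ _)).
  by move: xy; rewrite ltr_pdivlMr // => xy; have := nrm_ge0 (x - y); nra.
(* The condition on the adjoint makes [L] closed under [adj]. *)
pose L : set OA := [set x | forall m, M m -> M (x * m) /\ M (adj x * m)].
have LA : cstar_subalgebra L.
  split.
  - by move=> m mM; rewrite star0 mul0r.
  - move=> c x y xL yL m mM; have [h1 h2] := xL m mM; have [h3 h4] := yL m mM.
    rewrite starD starZ !mulrDl -!scalerAl.
    by split; exact: M_lin.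
  - move=> x y xL yL m mM; rewrite starM -!mulrA.
    have [h1 _] := yL m mM; have [_ h4] := xL m mM.
    by split; [exact: (xL _ h1).1|exact: (yL _ h4).2].
  - by move=> x xL m mM; rewrite starK; have [] := xL m mM.
  - apply/closed_nrmP => x xL m mM.
    have m1 : 0 < nrm m + 1 by rewrite ltr_wpDl // nrm_ge0.
    have small y e : nrm (x - y) < e / (nrm m + 1) -> nrm ((x - y) * m) < e.
      rewrite ltr_pdivlMr // => xy; apply: (le_lt_trans (nrmM _ _)).
      by have := nrm_ge0 (x - y); nra.
    split; apply: M_closed => e e0; have [y yL xy] := xL _ (divr_gt0 e0 m1);
      have [h1 h2] := yL m mM.
      by exists (y * m) => //; rewrite -mulrBl; exact: small.
    exists (adj y * m) => //; rewrite -mulrBl -starB.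
    move: xy; rewrite -nrm_adj ltr_pdivlMr // => xy.
    apply: (le_lt_trans (nrmM _ _)).
    by have := nrm_ge0 (adj (x - y)); nra.
have SL : range S `<=` L.
  by move=> _ [i _ <-] m mM; split; apply: M_mul => //;
    [exact: span_mul_gen|exact: span_mul_adj_gen].
have M1 : M 1.
  move=> e e0; exists 1; last by rewrite subrr nrm0.
  by have := span_monomial [::] [::]; rewrite /monomial word_elt_nil star1 mulr1.
move=> x; have xL : L x.
  by apply: (cstar_generated_ind LA SL); case: OA_univ => _ -> _.
by have [+ _] := xL 1 M1; rewrite mulr1.
Qed.

End Monomials.

(** * Fourier analysis of the gauge action *)

Section ContractiveLinear.
Context {R : realType} {B : cstarType R}.
Implicit Types (T : B -> B).

Definition contractive_linear T :=
  (forall c x y, T (c *: x + y) = c *: T x + T y) /\ (forall x, nrm (T x) <= nrm x).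

Variable T : B -> B.
Hypothesis TC : contractive_linear T.

Lemma contrD x y : T (x + y) = T x + T y.
Proof. by rewrite -[x]scale1r TC.1 !scale1r. Qed.

Lemma contr0 : T 0 = 0.
Proof. by apply: (@addrI _ (T 0)); rewrite -contrD !addr0. Qed.

Lemma contrZ c x : T (c *: x) = c *: T x.
Proof. by rewrite -[c *: x]addr0 TC.1 contr0 addr0. Qed.

Lemma contrB x y : T (x - y) = T x - T y.
Proof. by rewrite contrD -scaleN1r contrZ scaleN1r. Qed.

Lemma contr_dist x y : nrm (T x - T y) <= nrm (x - y).
Proof. by rewrite -contrB TC.2. Qed.

End ContractiveLinear.

Lemma contractive_ext {R : realType} {B : cstarType R} (G : set B) (T T' : B -> B) :
  contractive_linear T -> contractive_linear T' -> dense_in_norm (span G) ->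
  (forall g, G g -> T g = T' g) -> forall x, T x = T' x.
Proof.
move=> TC TC' Gd TG x; apply/eqP; rewrite -subr_eq0; apply/eqP.
apply: nrm_small_eq0 => e e0; have [y yG xy] := Gd x _ (divr_gt0 e0 (@ltr0Sn _ 1)).
have Ty : T y = T' y.
  elim: yG => [|c g z Gg _ IH]; first by rewrite (contr0 TC) (contr0 TC').
  by rewrite TC.1 TC'.1 TG // IH.
have := nrm_dist (T y) (T x) (T' x); rewrite {2}Ty.
by have := contr_dist TC x y; have := contr_dist TC' y x; rewrite (nrm_sub y); lra.
Qed.

Lemma smorph_contractive {R : realType} {B : cstarType R} (phi : B -> B) :
  star_morphism phi -> contractive_linear phi.
Proof.
move=> phiM; split; last exact: smorph_nrm.
by move=> c x y; rewrite (smorphD phiM) (smorphZ phiM).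
Qed.

Lemma contractive_scale {R : realType} {B : cstarType R} (c : R[i]) (T : B -> B) :
  cmod c = 1 -> contractive_linear T -> contractive_linear (fun x => c *: T x).
Proof.
move=> c1 TC; split=> [d x y|x]; last by rewrite nrmZ c1 mul1r TC.2.
by rewrite TC.1 scalerDr !scalerA mulrC.
Qed.

Lemma contractive_comp {R : realType} {B : cstarType R} (T T' : B -> B) :
  contractive_linear T -> contractive_linear T' -> contractive_linear (T \o T').
Proof.
move=> TC TC'; split=> [d x y|x] /=; first by rewrite TC'.1 TC.1.
exact: le_trans (TC.2 _) (TC'.2 _).
Qed.

Section Gauge.
Context {R : realType} {N : nat} {A : 'M[nat]_N} {OA : cstarType R}.
Context {S : 'I_N -> OA} {Phi : (XA A -> R[i]) -> OA}.
Hypotheses (OA_univ : cuntz_krieger A S) (PhiI : diag_identification S Phi).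
Implicit Types (mu nu : seq 'I_N) (z : R[i]).

(** The circle is parametrized by the unit complex numbers; the values at other numbers
    are arbitrary. *)
Definition gauge_action (S : 'I_N -> OA) (gamma : R[i] -> OA -> OA) := forall z, z * z^* = 1 ->
  [/\ star_morphism (gamma z), forall i, gamma z (S i) = z *: S i
    & forall d, diag_alg S d -> gamma z d = d].

Lemma gauge_action_exists : exists gamma, gauge_action S gamma.
Proof.
suff /choice[gamma gammaP] : forall z : R[i], exists phi : OA -> OA, z * z^* = 1 ->
  [/\ star_morphism phi, forall i, phi (S i) = z *: S i
    & forall d, diag_alg S d -> phi d = d] by exists gamma => z /gammaP.
move=> z; have [z1|] := pselect (z * z^* = 1); last by move=> nz; exists id.
have [phi [phiM phiS phiD]] :=
  twist_morphism OA_univ PhiI (@Cfun_cst _ _ A z) (fun=> z1).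
exists phi => _; split=> // i.
by rewrite phiS (Phi_cst PhiI) -scalerAl mul1r.
Qed.

Variables (gamma : R[i] -> OA -> OA) (gammaP : gauge_action S gamma).

Lemma gauge_word z mu : z * z^* = 1 ->
  gamma z (word_elt S mu) = z ^+ size mu *: word_elt S mu.
Proof.
move=> /gammaP[gM gS _]; elim: mu => [|i mu IH].
  by rewrite word_elt_nil (smorph1 gM) scale1r.
by rewrite word_elt_cons (smorphM gM) gS IH -scalerAl -scalerAr scalerA exprS.
Qed.

Lemma gauge_monomial z mu nu : z * z^* = 1 ->
  gamma z (monomial S mu nu) = (z ^+ size mu * z^* ^+ size nu) *: monomial S mu nu.
Proof.
move=> z1; have [gM _ _] := gammaP z1.
rewrite /monomial (smorphM gM) (smorph_adj gM) !gauge_word // starZ.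
by rewrite -scalerAl -scalerAr scalerA rmorphXn.
Qed.

(** Averaging [z ^+ a * z^* ^+ b *: gamma z x] over the roots of unity of order
    [m + 1] keeps the part of [x] of gauge degree [b - a] modulo [m + 1]. *)
Definition gauge_average m a b (x : OA) : OA :=
  (m.+1%:R : R[i])^-1 *: \sum_(j < m.+1)
    (root_of_unity m j ^+ a * (root_of_unity m j)^* ^+ b) *: gamma (root_of_unity m j) x.

Lemma gauge_average_contractive m a b : contractive_linear (gauge_average m a b).
Proof.
have gC (j : 'I_m.+1) : contractive_linear (gamma (root_of_unity m j)).
  by have [gM _ _] := gammaP (root_unimodular m j); exact: smorph_contractive.
split=> [c x y|x].
  rewrite /gauge_average [in RHS]scalerA [in RHS]mulrC -[in RHS]scalerA -scalerDr.
  congr (_ *: _); rewrite scaler_sumr -big_split /=; apply: eq_bigr => j _.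
  by rewrite (gC j).1 scalerDr !scalerA mulrC.
rewrite /gauge_average nrmZ cmodV cmod_nat ler_pdivrMl ?ltr0n //.
apply: (le_trans (nrm_sum _ _ _)).
apply: (@le_trans _ _ (\sum_(j < m.+1) nrm x)).
  apply: ler_sum => j _; rewrite nrmZ cmodM !cmodX cmod_conj.
  by rewrite (unimodular_cmod (root_unimodular m j)) !expr1n !mul1r (gC j).2.
by rewrite sumr_const card_ord mulr_natl.
Qed.

Lemma gauge_average_monomial m a b mu nu :
  (a + size mu <= m)%N -> (b + size nu <= m)%N ->
  gauge_average m a b (monomial S mu nu)
  = (a + size mu == b + size nu)%N%:R *: monomial S mu nu.
Proof.
move=> am bm; rewrite -(root_of_unity_sum am bm) /gauge_average.
rewrite -scalerA scaler_suml; congr (_ *: _); apply: eq_bigr => j _.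
rewrite gauge_monomial; last exact: root_unimodular.
by rewrite scalerA mulrACA -!exprD.
Qed.

Let mono_dense := monomials_dense OA_univ PhiI.
Notation all_monomials := (monomials S (fun _ _ => true)).

Lemma gauge_average_stable a b y : span all_monomials y ->
  exists n0, forall m n, (n0 <= m)%N -> (n0 <= n)%N ->
    gauge_average m a b y = gauge_average n a b y.
Proof.
elim=> [|c _ z [mu [nu [_ ->]]] _ [n0 n0P]].
  by exists 0%N => m n _ _; rewrite !(contr0 (gauge_average_contractive _ _ _)).
exists (maxn n0 (maxn (a + size mu) (b + size nu))) => m n; rewrite !geq_max.
move=> /and3P[m0 m1 m2] /and3P[n1 n2 n3].
rewrite !(gauge_average_contractive _ _ _).1 (n0P m n) //.
by rewrite !gauge_average_monomial.
Qed.

(** On a combination of monomials the averages are stationary as soon as [m] exceeds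
    the lengths involved; contractivity extends convergence to the closure. *)
Lemma gauge_average_cvg a b x : exists l, cvg_nrm (fun m => gauge_average m a b x) l.
Proof.
apply: cauchy_nrm_cvg => e e0.
have [y yS xy] := mono_dense x (divr_gt0 e0 (@ltr0Sn _ 1)).
have [n0 n0P] := gauge_average_stable a b yS; exists n0 => m n m0 n1.
have c1 := contr_dist (gauge_average_contractive m a b) x y.
have c2 := contr_dist (gauge_average_contractive n a b) y x.
have := nrm_dist (gauge_average m a b y) (gauge_average m a b x) (gauge_average n a b x).
by rewrite {2}(n0P m n) //; rewrite (nrm_sub y) in c2; lra.
Qed.

Variables (coef : nat -> nat -> OA -> OA).
Hypothesis coefP : forall a b x, cvg_nrm (fun m => gauge_average m a b x) (coef a b x).

Lemma coef_contractive a b : contractive_linear (coef a b).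
Proof.
split=> [c x y|x].
  apply: (cvg_nrm_unique (coefP a b _)).
  apply: (@cvg_nrm_eventually _ _
    (fun m => c *: gauge_average m a b x + gauge_average m a b y) _ _ 0%N).
    by move=> m _; rewrite (gauge_average_contractive m a b).1.
  by apply: cvg_nrmD => //; exact: cvg_nrmZ.
apply: (@cvg_nrm_le _ _ _ _ _ 0%N (coefP a b x)) => n _.
by rewrite (gauge_average_contractive n a b).2.
Qed.

Lemma coef_monomial a b mu nu : coef a b (monomial S mu nu)
  = (a + size mu == b + size nu)%N%:R *: monomial S mu nu.
Proof.
apply: (cvg_nrm_unique (coefP a b _)).
apply: (@cvg_nrm_eventually _ _
  (fun=> (a + size mu == b + size nu)%N%:R *: monomial S mu nu) _ _
  (maxn (a + size mu)%N (b + size nu)%N)); last exact: cvg_nrm_cst.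
by move=> m; rewrite geq_max => /andP[? ?]; rewrite gauge_average_monomial.
Qed.

Lemma coef_span a b x : span all_monomials x ->
  span (monomials S (fun p q => (a + p == b + q)%N)) (coef a b x).
Proof.
have cC := coef_contractive a b.
apply: (@span_linear _ _ _ _ (span (monomials S (fun p q => (a + p == b + q)%N)))) => //.
- exact: span0.
- by move=> c y z yS zS; apply: spanD => //; exact: spanZ.
- exact: contr0.
- exact: cC.1.
move=> _ [mu [nu [_ ->]]]; rewrite coef_monomial.
have [eq|] := eqVneq; last by rewrite scale0r; constructor.
by rewrite scale1r; apply: span_gen; exists mu, nu; rewrite eq.
Qed.

(** For monomials this counts letters; both sides are contractive in [x], and the
    monomials span a dense subspace. *)
Lemma gauge_coef z a b x : z * z^* = 1 ->
  gamma z (coef a b x) = (z ^+ b * z^* ^+ a) *: coef a b x.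
Proof.
move=> z1; have [gM _ _] := gammaP z1; have cC := coef_contractive a b.
have zab : cmod (z ^+ b * z^* ^+ a) = 1.
  by rewrite cmodM !cmodX cmod_conj unimodular_cmod // !expr1n mulr1.
apply: (@contractive_ext _ _ all_monomials (gamma z \o coef a b)
  (fun x => (z ^+ b * z^* ^+ a) *: coef a b x)) => //.
- by apply: contractive_comp => //; exact: smorph_contractive.
- exact: contractive_scale.
move=> _ [mu [nu [_ ->]]] /=; rewrite coef_monomial (smorphZ gM) gauge_monomial //.
rewrite !scalerA; congr (_ *: _); case: eqVneq => [eq|]; last by rewrite mul0r mulr0.
rewrite mul1r mulr1.
transitivity (z ^+ (a + size mu)%N * z^* ^+ (b + size nu)%N * (z ^+ b * z^* ^+ a)).
  have za : z ^+ a * z^* ^+ a = 1 by rewrite -exprMn z1 expr1n.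
  have zb : z ^+ b * z^* ^+ b = 1 by rewrite -exprMn z1 expr1n.
  rewrite !exprD -[LHS]mulr1 -[in LHS]za -[LHS]mulr1 -[in LHS]zb.
  move: (z ^+ a) (z^* ^+ a) (z ^+ b) (z^* ^+ b) (z ^+ size mu) (z^* ^+ size nu).
  by move=> u u' v v' s t; ring.
by rewrite eq -exprMn z1 expr1n mul1r.
Qed.

(** Every term of the averages is then equal to [x]. *)
Lemma coef_fixed x : (forall z, z * z^* = 1 -> gamma z x = x) -> coef 0 0 x = x.
Proof.
move=> xfix; apply: (cvg_nrm_unique (coefP 0 0 x)).
apply: (@cvg_nrm_eventually _ _ (fun=> x) _ _ 0%N); last exact: cvg_nrm_cst.
move=> m _; rewrite /gauge_average.
under eq_bigr => j _ do rewrite (xfix _ (root_unimodular m j)) !expr0 mulr1 scale1r.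
rewrite sumr_const card_ord -[x *+ _]scaler_nat scalerA.
by rewrite mulVf ?scale1r // (pnatr_eq0 R[i]).
Qed.

Lemma coef_diag l x : coef l l x = coef 0 0 x.
Proof.
apply: (cvg_nrm_unique (coefP l l x)).
apply: (@cvg_nrm_eventually _ _ (fun m => gauge_average m 0 0 x) _ _ 0%N) => // m _.
congr (_ *: _); apply: eq_bigr => j _.
by rewrite -!exprMn root_unimodular !expr1n.
Qed.

(** The gauge action fixes the diagonal. *)
Lemma coef_commute d a b x : diag_alg S d -> d * x = x * d ->
  d * coef a b x = coef a b x * d.
Proof.
move=> dD dx; apply: (@cvg_nrm_unique _ _ (fun m => d * gauge_average m a b x)).
  by apply: cvg_nrmM => //; exact: cvg_nrm_cst.
apply: (@cvg_nrm_eventually _ _ (fun m => gauge_average m a b x * d) _ _ 0%N).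
  move=> m _; rewrite /gauge_average -scalerAl -scalerAr; congr (_ *: _).
  rewrite mulr_suml mulr_sumr; apply: eq_bigr => j _.
  have [gM _ gD] := gammaP (root_unimodular m j).
  by rewrite -scalerAl -scalerAr -{1}(gD d dD) -(smorphM gM) -dx (smorphM gM) gD.
by apply: cvg_nrmM => //; exact: cvg_nrm_cst.
Qed.

(** The Fejer mean, written without its kernel. *)
Definition fejer K (x : OA) : OA :=
  (K.+1%:R : R[i])^-1 *: \sum_(l < K.+1) \sum_(l' < K.+1) coef l l' x.

(** Its finite-order version averages [gamma z x] against the weights
    [|sum_(l <= K) z ^ l| ^ 2 >= 0], whose total mass is that of the pairs [l = l']. *)
Lemma fejer_contractive K : contractive_linear (fejer K).
Proof.
split=> [c x y|x].
  rewrite /fejer [in RHS]scalerA [in RHS]mulrC -[in RHS]scalerA -scalerDr.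
  congr (_ *: _); rewrite scaler_sumr -big_split /=; apply: eq_bigr => l _.
  rewrite scaler_sumr -big_split /=; apply: eq_bigr => l' _.
  by rewrite (coef_contractive l l').1.
have lim : cvg_nrm (fun m => (K.+1%:R : R[i])^-1 *:
    \sum_(l < K.+1) \sum_(l' < K.+1) gauge_average m l l' x) (fejer K x).
  by apply: cvg_nrmZ; apply: cvg_nrm_sum => l; apply: cvg_nrm_sum => l'.
apply: (@cvg_nrm_le _ _ _ _ _ K lim) => m Km.
pose w j := root_of_unity m j : R[i]; pose D j := \sum_(l < K.+1) w j ^+ l.
pose c j := D j * (D j)^*.
have cE j : (cmod (c j))%:C%C = c j.
  by rewrite cmodC ger0_norm // /c mul_conjC_ge0.
have cS j : c j = \sum_(l < K.+1) \sum_(l' < K.+1) w j ^+ l * (w j)^* ^+ l'.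
  rewrite /c /D rmorph_sum mulr_suml; apply: eq_bigr => l _.
  by rewrite mulr_sumr; apply: eq_bigr => l' _; rewrite rmorphXn.
have sumE : \sum_(l < K.+1) \sum_(l' < K.+1) gauge_average m l l' x =
    (m.+1%:R : R[i])^-1 *: \sum_(j < m.+1) c j *: gamma (w j) x.
  under eq_bigr => l _ do rewrite -scaler_sumr exchange_big.
  rewrite -scaler_sumr exchange_big; congr (_ *: _); apply: eq_bigr => j _ /=.
  rewrite cS scaler_suml; apply: eq_bigr => l _.
  by rewrite scaler_suml; apply: eq_bigr.
have mass : (K.+1%:R : R)^-1 * (m.+1%:R^-1 * \sum_(j < m.+1) cmod (c j)) = 1.
  have cmodE : (\sum_(j < m.+1) cmod (c j))%:C%C = \sum_(j < m.+1) c j.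
    by rewrite rmorph_sum; apply: eq_bigr => j _; exact: cE.
  apply: complexI; rewrite !rmorphM/= cmodE !fmorphV !rmorph_nat.
  under eq_bigr => j _ do rewrite cS.
  rewrite exchange_big mulr_sumr /=.
  under eq_bigr => l _.
    rewrite exchange_big mulr_sumr /=.
    under eq_bigr => l' _.
      rewrite root_of_unity_sum; [over|..].
        by rewrite (leq_trans _ Km) // -ltnS.
      by rewrite (leq_trans _ Km) // -ltnS.
    rewrite (bigD1 l) //= eqxx big1 ?addr0; last first.
      by move=> l' l'l; rewrite eq_sym (negPf (l'l : l' != l :> nat)).
    over.
  by rewrite sumr_const card_ord mulVf // (pnatr_eq0 R[i]).
have nx : nrm x =
    K.+1%:R^-1 * (m.+1%:R^-1 * ((\sum_(j < m.+1) cmod (c j)) * nrm x)).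
  by rewrite [X in _ * X]mulrA mulrA mass mul1r.
rewrite sumE !nrmZ !cmodV !cmod_nat [leRHS]nx.
rewrite ler_wpM2l ?invr_ge0 // ler_wpM2l ?invr_ge0 //.
apply: (le_trans (nrm_sum _ _ _)); rewrite mulr_suml; apply: ler_sum => j _.
rewrite nrmZ ler_wpM2l ?cmod_ge0 //.
by have [gM _ _] := gammaP (root_unimodular m j); exact: smorph_nrm.
Qed.

End Gauge.

Section Counting.
Local Open Scope nat_scope.

Lemma count_shift_eq n q c : \sum_(l' < n) (c == l' + q) = (q <= c) && (c < n + q).
Proof.
elim: n => [|n IHn]; first by rewrite big_ord0; case: leqP => //= h; rewrite ltnNge h.
rewrite big_ord_recr /= IHn.
by case: (leqP q c); case: (ltnP c (n + q)); case: (ltnP c (n.+1 + q));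
  case: (eqVneq c (n + q)) => //=; lia.
Qed.

(** The pairs [(l, l')] with [l + p = l' + q] miss at most [q] values of [l] at the
    lower end and [p] at the upper end. *)
Lemma count_diagonal K p q :
  \sum_(l < K) \sum_(l' < K) (l + p == l' + q) <= K /\
  K <= \sum_(l < K) \sum_(l' < K) (l + p == l' + q) + (p + q).
Proof.
under eq_bigr => l _ do rewrite count_shift_eq.
split.
  rewrite -[leqRHS]card_ord -sum1_card; apply: leq_sum => l _.
  by case: (_ && _).
have H n : n <= K -> n <= \sum_(l < n) ((q <= l + p) && (l + p < K + q)) + (minn n q + (n + p - K)).
  elim: n => [//|n IHn] nK; rewrite big_ord_recr /=; have := IHn (ltnW nK).
  by case: (leqP q (n + p)); case: (ltnP (n + p) (K + q)) => //=; lia.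
by apply: leq_trans (H K (leqnn K)) _; rewrite leq_add2l; lia.
Qed.

End Counting.

(** * The diagonal is a maximal abelian subalgebra *)

Section MaximalAbelian.
Context {R : realType} {N : nat} {A : 'M[nat]_N} {OA : cstarType R}.
Context {S : 'I_N -> OA} {Phi : (XA A -> R[i]) -> OA}.
Hypotheses (OA_univ : cuntz_krieger A S) (PhiI : diag_identification S Phi).
Implicit Types (mu nu : seq 'I_N) (z : R[i]).

Let OA_ck : ck_family A S. Proof. by case: OA_univ. Qed.
Let mono_dense := monomials_dense OA_univ PhiI.
Notation all_monomials := (monomials S (fun _ _ => true)).

Section WithCoefficients.
Variables (gamma : R[i] -> OA -> OA) (coef : nat -> nat -> OA -> OA).
Hypotheses (gammaP : gauge_action S gamma)
  (coefP : forall a b x, cvg_nrm (fun m => gauge_average gamma m a b x) (coef a b x)).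

Let cC := coef_contractive gammaP coefP.
Let fC := fejer_contractive gammaP coefP.

(** A monomial is multiplied by the proportion of pairs [(l, l')] whose difference is
    its degree. *)
Lemma fejer_monomial K mu nu :
  nrm (fejer coef K (monomial S mu nu) - monomial S mu nu)
  <= (size mu + size nu)%N%:R / K.+1%:R * nrm (monomial S mu nu).
Proof.
pose c := (\sum_(l < K.+1) \sum_(l' < K.+1) (l + size mu == l' + size nu))%N.
have -> : fejer coef K (monomial S mu nu) = (K.+1%:R^-1 * c%:R) *: monomial S mu nu.
  rewrite /fejer -scalerA /c natr_sum scaler_suml; congr (_ *: _).
  apply: eq_bigr => l _; rewrite natr_sum scaler_suml; apply: eq_bigr => l' _.
  exact: (coef_monomial gammaP coefP).
rewrite -[X in _ - X]scale1r -scalerBl nrmZ ler_wpM2r ?nrm_ge0 //.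
have [cK Kc] := count_diagonal K.+1 (size mu) (size nu).
have K0 : K.+1%:R != 0 :> R by rewrite pnatr_eq0.
have -> : (K.+1%:R^-1 * c%:R - 1 : R[i]) = (- ((K.+1 - c)%N%:R / K.+1%:R : R))%:C%C.
  rewrite rmorphN rmorphM/= fmorphV !rmorph_nat natrB // mulrBl opprB mulrC mulfV //.
rewrite cmod_real normrN ger0_norm ?divr_ge0 // ler_wpM2r ?invr_ge0 //.
by rewrite ler_nat leq_subLR.
Qed.

Lemma fejer_cvg x : cvg_nrm (fun K => fejer coef K x) x.
Proof.
have span_cvg y : span all_monomials y -> cvg_nrm (fun K => fejer coef K y) y.
  elim=> [|c _ u [mu [nu [_ ->]]] _ IH].
    apply: (@cvg_nrm_eventually _ _ (fun=> 0) _ _ 0%N); last exact: cvg_nrm_cst.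
    by move=> K _; rewrite (contr0 (fC K)).
  apply: (@cvg_nrm_eventually _ _ (fun K => c *: fejer coef K (monomial S mu nu)
    + fejer coef K u) _ _ 0%N) => [K _|]; first by rewrite (fC K).1.
  apply: cvg_nrmD => //; apply: cvg_nrmZ => e e0.
  set M := (size mu + size nu)%N%:R * nrm (monomial S mu nu).
  have M0 : 0 <= M by rewrite mulr_ge0 ?nrm_ge0.
  exists (Num.bound (M / e)) => K Kb; apply: (le_lt_trans (fejer_monomial _ _ _)).
  rewrite mulrAC -/M ltr_pdivrMr // mulrC -ltr_pdivrMr //.
  apply: (lt_trans (archi_boundP _)); first by rewrite divr_ge0 // ltW.
  by rewrite ltr_nat.
move=> e e0; have e30 : 0 < e / 3 by rewrite divr_gt0.
have [y yS xy] := mono_dense x e30; have [n0 n0P] := span_cvg y yS _ e30.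
exists n0 => K /n0P Ky; have := contr_dist (fC K) x y.
have := nrm_dist (fejer coef K y) (fejer coef K x) x.
have := nrm_dist y (fejer coef K y) x; rewrite (nrm_sub y x); lra.
Qed.

(** An element without gauge coefficients of nonzero degree equals all its Fejer
    means, which are its coefficient of degree zero. *)
Lemma coef_vanish x : (forall l l', l <> l' -> coef l l' x = 0) -> coef 0 0 x = x.
Proof.
move=> x0; apply: (cvg_nrm_unique _ (fejer_cvg x)).
apply: (@cvg_nrm_eventually _ _ (fun=> coef 0 0 x) _ _ 0%N); last exact: cvg_nrm_cst.
move=> K _; rewrite /fejer.
have -> : \sum_(l < K.+1) \sum_(l' < K.+1) coef l l' x = \sum_(l < K.+1) coef 0 0 x.
  apply: eq_bigr => l _; rewrite (bigD1 l) //= big1 ?addr0; last first.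
    by move=> l' l'l; apply: x0 => ll'; case/eqP: l'l; apply: val_inj.
  exact: coef_diag coefP _ _.
rewrite sumr_const card_ord -[coef 0 0 x *+ _]scaler_nat scalerA.
by rewrite mulVf ?scale1r // (pnatr_eq0 R[i]).
Qed.

End WithCoefficients.

Definition diag_commutant (S : 'I_N -> OA) : set OA :=
  [set x | forall d, diag_alg S d -> d * x = x * d].

(** For a selfadjoint unitary [u = p - (1 - p)] this is the compression
    [p * x * p + (1 - p) * x * (1 - p)]. *)
Definition pinch (u x : OA) : OA := 2^-1 *: (x + u * x * u).

Lemma pinch_contractive u : adj u = u -> u * u = 1 -> contractive_linear (pinch u).
Proof.
move=> uadj uu; have uU : unitary u by split; rewrite uadj.
split=> [c x y|x].
  rewrite /pinch scalerA mulrC -scalerA -scalerDr; congr (_ *: _).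
  by rewrite mulrDr mulrDl -scalerAr -scalerAl scalerDr addrACA.
rewrite /pinch nrmZ cmodV cmod_nat; have := nrmD x (u * x * u).
by have := nrm_conj_le x uU; rewrite uadj; lra.
Qed.

Definition diag_reflection (u : OA) := [/\ diag_alg S u, adj u = u & u * u = 1].

Lemma pinch_commutant u x : diag_reflection u -> diag_commutant S x -> pinch u x = x.
Proof.
move=> [uD _ uu] xD; rewrite /pinch xD // -mulrA uu mulr1; exact: half_double.
Qed.

Lemma diag_sub_commutant d : diag_alg S d -> diag_commutant S d.
Proof. by move=> dD e eD; exact: (diag_comm PhiI). Qed.

Definition pinches (us : seq OA) (x : OA) : OA := foldr pinch x us.

Definition reflections (us : seq OA) := forall u, u \in us -> diag_reflection u.

Lemma pinches_contractive us : reflections us -> contractive_linear (pinches us).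
Proof.
elim: us => [|u us IH] usR; first by split.
have [_ uadj uu] := usR u (mem_head _ _).
apply: (contractive_comp (pinch_contractive uadj uu) (IH _)).
by move=> v vus; apply: usR; rewrite inE vus orbT.
Qed.

Lemma pinches_commutant us x : reflections us -> diag_commutant S x -> pinches us x = x.
Proof.
elim: us => [//|u us IH] usR xD /=; rewrite IH //; last first.
  by move=> v vus; apply: usR; rewrite inE vus orbT.
by apply: pinch_commutant => //; exact: usR (mem_head _ _).
Qed.

Lemma pinchC u v x : u * v = v * u -> pinch u (pinch v x) = pinch v (pinch u x).
Proof.
move=> uv; rewrite /pinch; congr (_ *: _).
rewrite -!scalerAr -!scalerAl -!scalerDr; congr (_ *: _).
rewrite !mulrDr !mulrDl !addrA; congr (_ + _); first by rewrite addrAC.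
by rewrite !mulrA uv -!mulrA uv.
Qed.

Lemma pinches_pinchC us u x : reflections us -> diag_reflection u ->
  pinches us (pinch u x) = pinch u (pinches us x).
Proof.
move=> + uR; elim: us => [//|v us IH] usR /=; rewrite IH; last first.
  by move=> w wus; apply: usR; rewrite inE wus orbT.
apply: pinchC; apply: (diag_comm PhiI); last by case: uR.
by have [] := usR v (mem_head _ _).
Qed.

(** Reflections in the diagonal commute, hence so do the pinchings by them; this allows
    the reflections needed for the terms of a sum to be used together. *)
Lemma pinchesC us vs x : reflections us -> reflections vs ->
  pinches us (pinches vs x) = pinches vs (pinches us x).
Proof.
move=> usR; elim: vs => [//|v vs IH] vsR /=.
rewrite pinches_pinchC // ?IH //; last exact: vsR (mem_head _ _).
by move=> w wvs; apply: vsR; rewrite inE wvs orbT.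
Qed.

Lemma reflections_cat us vs :
  reflections us -> reflections vs -> reflections (us ++ vs).
Proof. by move=> usR vsR u; rewrite mem_cat => /orP[/usR|/vsR]. Qed.

Lemma word_partial_isometry mu :
  word_elt S mu * adj (word_elt S mu) * word_elt S mu = word_elt S mu.
Proof.
elim: mu => [|i mu IH]; first by rewrite word_elt_nil star1 !mulr1.
rewrite word_elt_cons starM !mulrA -(mulrA _ (adj (S i))) -(mulrA (S i)).
rewrite -(mulrA (S i)) (diag_comm PhiI (diag_word mu) (diag_source OA_ck i)).
by rewrite mulrA -mulrA IH mulrA (gen_partial_isometry OA_ck).
Qed.

(** The range projection of [word_elt mu] is the indicator of the cylinder of [mu]. *)
Lemma cut_word f mu : Cfun f -> (forall x, cylinder mu x -> f x = 0) ->
  Phi f * word_elt S mu = 0.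
Proof.
move=> fC f0; rewrite -word_partial_isometry mulrA -(Phi_cylinder PhiI) -(PhiM PhiI) //.
  have -> : (fun x => f x * \1_(cylinder mu) x) = fun=> 0.
    apply/funext => x; rewrite indicE.
    by case: (boolP (x \in _)) => xmu; rewrite ?mulr0 // f0 ?mul0r //; exact/set_mem.
  by rewrite (Phi0 PhiI) mul0r.
exact: Cfun_cylinder.
Qed.

Lemma cylinder_disjoint mu nu (x : XA A) : size mu = size nu ->
  cylinder mu x -> cylinder nu x -> mu = nu.
Proof.
case: mu => [|i mu]; first by case: nu.
move=> smn mux nux; apply: (@eq_from_nth _ i) => // k kmu.
by rewrite mux // nux // -smn.
Qed.

(** The pinching by the reflection [2 * p - 1] kills an off-diagonal monomial
    [word_elt mu * adj (word_elt nu)] of degree 0, when [p] is the projection onto the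
    cylinder of [mu]. *)
Lemma span_pinch x : span (monomials S (fun p q => p == q)) x ->
  exists2 us, reflections us & diag_alg S (pinches us x).
Proof.
elim=> [|c _ y [mu [nu [/eqP smn ->]]] _ [us usR usy]].
  by exists [::] => //; exact: diag0.
suff [vs vsR vsx] : exists2 vs, reflections vs & diag_alg S (pinches vs (monomial S mu nu)).
  exists (us ++ vs); first exact: reflections_cat.
  have -> : pinches (us ++ vs) (c *: monomial S mu nu + y) =
      pinches us (pinches vs (c *: monomial S mu nu + y)) by rewrite /pinches foldr_cat.
  rewrite (pinches_contractive vsR).1 (pinches_contractive usR).1.
  rewrite (pinchesC y usR vsR) (pinches_commutant vsR (diag_sub_commutant usy)).
  rewrite (pinches_commutant usR (diag_sub_commutant vsx)).
  by apply: diagD => //; exact: diagZ.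
have [->|munu] := eqVneq mu nu; first by exists [::] => //; exact: diag_word.
pose p := word_elt S mu * adj (word_elt S mu); pose u := p + p - 1.
have pD : diag_alg S p by exact: diag_word.
have padj : adj p = p by rewrite /p starM starK.
have pmu : p * word_elt S mu = word_elt S mu := word_partial_isometry mu.
have pp : p * p = p by rewrite {2}/p mulrA pmu.
have nup : adj (word_elt S nu) * p = 0.
  rewrite -[LHS]starK starM starK padj -[p](Phi_cylinder PhiI) cut_word ?star0 //.
    exact: Cfun_cylinder.
  move=> t nut; rewrite indicE; case: (boolP (t \in _)) => // /set_mem mut.
  by case/eqP: munu; exact: cylinder_disjoint mut nut.
have uR : diag_reflection u.
  split.
  - apply: diagD; first exact: diagD.
    by rewrite -scaleN1r; apply: diagZ; exact: diag1.
  - by rewrite /u starB starD padj star1.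
  - have up : u * p = p by rewrite /u mulrBl mulrDl mul1r pp addrK.
    by rewrite {2}/u mulrBr mulr1 mulrDr up /u opprB addrC subrK.
exists [:: u]; first by move=> v; rewrite inE => /eqP ->.
rewrite /= /pinch; suff -> : u * monomial S mu nu * u = - monomial S mu nu.
  by rewrite subrr scaler0; exact: diag0.
have umu : u * word_elt S mu = word_elt S mu.
  by rewrite /u mulrBl mulrDl pmu mul1r addrK.
have nuu : adj (word_elt S nu) * u = - adj (word_elt S nu).
  by rewrite /u mulrBr mulrDr nup mulr1 addr0 sub0r.
by rewrite /monomial mulrA umu -mulrA nuu mulrN.
Qed.

End MaximalAbelian.

Section MaximalAbelianProof.
Context {R : realType} {N : nat} {A : 'M[nat]_N} {OA : cstarType R}.
Context {S : 'I_N -> OA} {Phi : (XA A -> R[i]) -> OA}.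
Hypotheses (OA_univ : cuntz_krieger A S) (PhiI : diag_identification S Phi).
Hypotheses (A01 : forall i j, A i j = 0%N \/ A i j = 1%N)
  (A_irr : irreducible_mx A) (A_nperm : ~~ is_perm_mx A).
Implicit Types (mu nu : seq 'I_N) (x y : XA A).

Let OA_ck : ck_family A S. Proof. by case: OA_univ. Qed.
Let mono_dense := monomials_dense OA_univ PhiI.
Let sigma := @Defs.shift N A.

(** The first [size nu] letters are those of [nu], and each later letter repeats the one
    [size nu - size mu] places before it. *)
Lemma tail_equal_unique mu nu x y : (size mu < size nu)%N ->
  cylinder nu x -> cylinder nu y ->
  iter (size mu) sigma x = iter (size nu) sigma x ->
  iter (size mu) sigma y = iter (size nu) sigma y -> x = y.
Proof.
move=> munu nux nuy sx sy; apply: XA_ext => k.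
have [m] := ubnP k; elim: m k => // m IH k; rewrite ltnS => km.
have [knu|nuk] := ltnP k (size nu).
  by rewrite -(nux k (XA_coord x k) knu) (nuy k _ knu).
have per z : iter (size mu) sigma z = iter (size nu) sigma z ->
    XA_coord z k = XA_coord z (k - size nu + size mu).
  move=> sz; rewrite -{1}(subnK nuk) -!XA_coord_iter_shift.
  exact: (congr1 (fun t => XA_coord t (k - size nu)) (esym sz)).
by rewrite (per _ sx) (per _ sy) IH //; lia.
Qed.

(** Where this fails, the local homeomorphism replacing the prefix [nu] by [mu], which
    [monomial S mu nu] represents, does not fix the point. *)
Definition tail_equal mu nu x :=
  [/\ cylinder mu x, cylinder nu x & iter (size mu) sigma x = iter (size nu) sigma x].

Lemma tail_equal_inj mu nu x y : size mu <> size nu ->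
  tail_equal mu nu x -> tail_equal mu nu y -> x = y.
Proof.
move=> munu [mx nx sx] [my ny sy]; have [lt|lt|//] := ltngtP (size mu) (size nu).
  exact: tail_equal_unique lt nx ny sx sy.
exact: tail_equal_unique lt mx my (esym sx) (esym sy).
Qed.

Notation p := (proj_cyl (Phi := Phi)).

(** Covariance moves the condition on the letters after the prefix [mu] to the other
    side of the word. *)
Lemma proj_cyl_word_tail mu x n k : (k + size mu <= n)%N ->
  p x n * word_elt S mu = p x n * word_elt S mu * p (iter (size mu) sigma x) k.
Proof.
move=> kn; rewrite -mulrA (covariance_word OA_ck PhiI); last exact: Cfun_cylinder.
rewrite mulrA; congr (_ * _); rewrite /proj_cyl -(PhiM PhiI); first last.
- by apply: Cfun_iter_shift; exact: Cfun_cylinder.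
- exact: Cfun_cylinder.
congr Phi; apply/funext => y; rewrite !cylinder_agree_ind.
case: asboolP => [xy|]; last by rewrite mul0r.
rewrite mul1r; case: asboolP => // -[] j jk.
by rewrite !XA_coord_iter_shift xy // (leq_trans _ kn) // ltn_add2r.
Qed.

Lemma proj_cyl_orthogonal x y n k : (k < n)%N -> XA_coord x k <> XA_coord y k ->
  p x n * p y n = 0.
Proof.
move=> kn xyk; rewrite /proj_cyl -(PhiM PhiI); try exact: Cfun_cylinder.
rewrite -(Phi0 PhiI); congr Phi; apply/funext => z; rewrite !cylinder_agree_ind.
case: asboolP => [xz|]; last by rewrite mul0r.
case: asboolP => [yz|]; last by rewrite mulr0.
by case: xyk; rewrite xz // yz.
Qed.

Lemma proj_cyl_word_out mu x n : (size mu <= n)%N -> ~ cylinder mu x ->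
  p x n * word_elt S mu = 0.
Proof.
move=> mun mux; apply: (cut_word OA_univ PhiI); first exact: Cfun_cylinder.
move=> y muy; rewrite cylinder_agree_ind; case: asboolP => // xy; case: mux.
by move=> k i kmu; rewrite muy // xy // (leq_trans kmu).
Qed.

(** Either one of the two words does not begin [x], or the tails of [x] after them are
    separated by disjoint cylinders. *)
Lemma cut_monomial mu nu x m : ~ tail_equal mu nu x ->
  exists2 n, (m <= n)%N & p x n * monomial S mu nu * p x n = 0.
Proof.
move=> ntail; have adj_cut n : adj (word_elt S nu) * p x n = adj (p x n * word_elt S nu).
  by rewrite starM (proj_cyl_adj PhiI).
have [mux|mux] := pselect (cylinder mu x); last first.
  exists (maxn m (size mu)); first exact: leq_maxl.
  by rewrite /monomial mulrA proj_cyl_word_out ?mul0r // leq_maxr.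
have [nux|nux] := pselect (cylinder nu x); last first.
  exists (maxn m (size nu)); first exact: leq_maxl.
  rewrite /monomial -!mulrA adj_cut proj_cyl_word_out ?star0 ?mulr0 //.
  exact: leq_maxr.
have [k kP] : exists k, XA_coord (iter (size mu) sigma x) k <>
    XA_coord (iter (size nu) sigma x) k.
  apply: contrapT => eq; apply: ntail; split=> //; apply: XA_ext => k.
  by apply: contrapT => neq; apply: eq; exists k.
exists (maxn m (k.+1 + maxn (size mu) (size nu))); first exact: leq_maxl.
set n := maxn m _.
have munu : (k.+1 + size mu <= n)%N /\ (k.+1 + size nu <= n)%N by rewrite /n; lia.
rewrite /monomial -!mulrA adj_cut (proj_cyl_word_tail _ munu.2) starM (proj_cyl_adj PhiI).
rewrite !mulrA (proj_cyl_word_tail _ munu.1) -!mulrA [p _ _ * (p _ _ * _)]mulrA.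
by rewrite (proj_cyl_orthogonal (ltnSn k) kP) mul0r !mulr0.
Qed.

(** Each monomial of nonzero degree is cut to 0 by small cylinders around every point
    but one; since no point is isolated, every cylinder contains one that is good for
    all terms of a combination, chosen by successive shrinking. *)
Lemma cut_span a b t : a <> b ->
  span (monomials S (fun k l => (a + k == b + l)%N)) t ->
  forall x m, exists y n, [/\ (m <= n)%N, agree m x y & p y n * t * p y n = 0].
Proof.
move=> ab; elim=> [|c _ u [mu [nu [/eqP munu ->]]] _ IH] x m.
  by exists x, m; rewrite mulr0 mul0r.
have [y [n [mn xy yn]]] := IH x m.
have [z yz ntail] : exists2 z, agree n y z & ~ tail_equal mu nu z.
  have [taily|] := pselect (tail_equal mu nu y); last by exists y.
  have [z yz zy] := XA_avoid A01 A_irr A_nperm y y n; exists z => // tailz.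
  by apply: zy; apply: (tail_equal_inj _ tailz taily) => smn; apply: ab; lia.
have [k nk zk] := cut_monomial n ntail.
exists z, k; split; first exact: leq_trans nk.
  by apply: (agree_trans xy); exact: agreeW yz.
rewrite mulrDr mulrDl -scalerAr -scalerAl zk scaler0 add0r.
have pp : p z k = p z k * p y n.
  rewrite (diag_comm PhiI); try by apply: (Phi_diag PhiI); exact: Cfun_cylinder.
  by rewrite (proj_cylM PhiI yz nk).
have pp' : p z k = p y n * p z k by rewrite (proj_cylM PhiI yz nk).
by rewrite {1}pp {2}pp' -!mulrA [p y n * _]mulrA [p y n * u * _]mulrA yn mul0r mulr0.
Qed.

Lemma commutant_mul s t : diag_commutant S s -> diag_commutant S t ->
  diag_commutant S (s * t).
Proof. by move=> sD tD d dD; rewrite mulrA sD // -mulrA tD // mulrA. Qed.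

Lemma commutant_adj t : diag_commutant S t -> diag_commutant S (adj t).
Proof.
move=> tD d dD; rewrite -[d]starK -!starM tD //.
exact: diag_adj.
Qed.

Section WithCoefficients.
Variables (gamma : R[i] -> OA -> OA) (coef : nat -> nat -> OA -> OA).
Hypotheses (gammaP : gauge_action S gamma)
  (coefP : forall a b (x : OA), cvg_nrm (fun m => gauge_average gamma m a b x) (coef a b x)).

Let cC := coef_contractive gammaP coefP.

Lemma coef_commutant a b t : diag_commutant S t -> diag_commutant S (coef a b t).
Proof. by move=> tD d dD; apply: (coef_commute gammaP coefP) => //; exact: tD. Qed.

(** Approximate [t] by combinations of monomials of degree 0 and pinch them into the
    diagonal: pinching is contractive and does not move [t]. *)
Lemma degree0_diag t : diag_commutant S t -> coef 0 0 t = t -> diag_alg S t.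
Proof.
move=> tD t0; apply: diag_closed => e e0.
have [y yS ty] := mono_dense t e0.
have [us usR usy] := span_pinch OA_univ PhiI (coef_span gammaP coefP 0 0 yS).
exists (pinches us (coef 0 0 y)) => //; apply: le_lt_trans ty.
rewrite -{1}(pinches_commutant usR tD).
apply: (le_trans (contr_dist (pinches_contractive usR) _ _)).
by rewrite -{1}t0; exact: contr_dist.
Qed.

(** For [c] of nonzero degree commuting with the diagonal, [adj c * c] has degree 0,
    so it is a function on the shift space; [c] is approximated by combinations of
    monomials that vanish on a small cylinder inside any given one, so this continuous
    function takes arbitrarily small values in every cylinder. *)
Lemma degree_neq0_vanish a b t : diag_commutant S t -> a <> b -> coef a b t = 0.
Proof.
move=> tD ab; set c := coef a b t.
have cD : diag_commutant S c by exact: coef_commutant.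
have ccD : diag_commutant S (adj c * c) by apply: commutant_mul => //; exact: commutant_adj.
(* The phases of [c] and [adj c] under the gauge action cancel. *)
have cc0 : coef 0 0 (adj c * c) = adj c * c.
  apply: (coef_fixed coefP) => z z1; have [gM _ _] := gammaP z1.
  rewrite (smorphM gM) (smorph_adj gM) /c (gauge_coef OA_univ PhiI gammaP coefP) // starZ.
  rewrite -scalerAl -scalerAr scalerA.
  have -> : (z ^+ b * z^* ^+ a)^* * (z ^+ b * z^* ^+ a) = 1; last by rewrite scale1r.
  rewrite rmorphM !rmorphXn /= conjCK mulrACA -!exprMn z1 [_ * z]mulrC z1.
  by rewrite !expr1n mulr1.
have [g gC gcc] := Phi_surj PhiI (degree0_diag ccD cc0).
have g0 x : g x = 0.
  apply: contrapT => /eqP/cmod_gt0 gx.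
  have gx2 : 0 < cmod (g x) / 2 by rewrite divr_gt0.
  have c1 : 0 < nrm c + 1 by rewrite ltr_wpDl // nrm_ge0.
  have [m mP] := (Cfun_agree g).1 gC x _ gx2.
  have [y yS ty] := mono_dense t (divr_gt0 gx2 c1).
  have [z [n [mn xz zn]]] := cut_span ab (coef_span gammaP coefP a b yS) x m.
  have pD : diag_alg S (p z n) by apply: (Phi_diag PhiI); exact: Cfun_cylinder.
  (* On the cylinder of [z], the element [c] only differs from 0 by the error. *)
  have pc : nrm (p z n * c) <= nrm (t - y).
    have -> : p z n * c = p z n * (c - coef a b y) * p z n.
      rewrite mulrBr mulrBl zn subr0 -mulrA -(cD _ pD) mulrA.
      by rewrite (proj_cyl_idem PhiI).
    apply: (le_trans (nrmM _ _)); rewrite (proj_cyl_nrm PhiI) mulr1.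
    apply: (le_trans (nrmM _ _)); rewrite (proj_cyl_nrm PhiI) mul1r.
    exact: contr_dist.
  have : nrm (p z n * Phi g) <= cmod (g x) / 2.
    rewrite gcc mulrA (commutant_adj cD pD) -mulrA.
    apply: (le_trans (nrmM _ _)); rewrite nrm_adj.
    move: ty; rewrite ltr_pdivlMr // => ty.
    have := nrm_ge0 c; have := nrm_ge0 (t - y); nra.
  move=> /(Phi_cut_lower PhiI gC) gz; have := mP _ xz.
  have := cmodD (g x - g z) (g z); rewrite subrK; lra.
have cc : adj c * c = 0.
  by rewrite -gcc -(Phi0 PhiI); congr Phi; apply/funext.
apply: nrm_eq0; apply/eqP; rewrite -sqrf_eq0 -nrm_cstar cc nrm0.
by [].
Qed.

End WithCoefficients.

(** Cut into gauge-homogeneous parts an element of the commutant of the diagonal: the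
    part of degree 0 is diagonal, the others vanish, and an element is determined by
    its parts. *)
Theorem diag_maximal_abelian t : diag_commutant S t -> diag_alg S t.
Proof.
move=> tD; have [gamma gammaP] := gauge_action_exists OA_univ PhiI.
have /choice[coef coefP] : forall abx : nat * nat * OA, exists l,
    cvg_nrm (fun m => gauge_average gamma m abx.1.1 abx.1.2 abx.2) l.
  by move=> abx; exact: (gauge_average_cvg OA_univ PhiI gammaP).
pose co a b (x : OA) := coef (a, b, x).
have coP a b (x : OA) : cvg_nrm (fun m => gauge_average gamma m a b x) (co a b x).
  exact: (coefP (a, b, x)).
apply: (degree0_diag gammaP coP tD); apply: (coef_vanish OA_univ PhiI gammaP coP).
by move=> a b; exact: (degree_neq0_vanish gammaP coP tD).
Qed.

End MaximalAbelianProof.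

(** * Characters of the circle in the diagonal *)

Section ExponentialBounds.
Context {R : realType}.
Implicit Types (s t theta : R).

Lemma sin_bound t : `|sin t| <= `|t|.
Proof.
wlog t0 : t / 0 <= t.
  move=> H; have [/H //|/ltW t0] := leP 0 t.
  by rewrite -normrN -sinN -[leRHS]normrN H // oppr_ge0.
have [->|tn0] := eqVneq t 0; first by rewrite sin0.
have t1 : 0 < t by rewrite lt_def tn0.
have [|c _] := @MVT_segment R (@sin R) (@cos R) 0 t t0.
  exact/continuous_subspaceT/continuous_sin.
rewrite sin0 !subr0 => ->; rewrite normrM ler_piMl //; exact: cos_max.
Qed.

Lemma cos_sub1 t : cos t - 1 = - (sin (t / 2) ^+ 2 *+ 2).
Proof.
have tE : t = t / 2 *+ 2 by rewrite -[_ *+ 2]mulr_natr divfK ?pnatr_eq0.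
rewrite {1}tE cos_mulr2n cos2sin2; set z := sin _ ^+ 2; ring.
Qed.

Lemma cos_sub1_bound t : `|cos t - 1| <= `|t|.
Proof.
rewrite cos_sub1 normrN normrMn normrX.
have := sin_bound (t / 2); have := sin_max (t / 2); have := normr_ge0 (sin (t / 2)).
rewrite [`|t / 2|]normrM [`|2^-1|]ger0_norm //.
move: `|sin (t / 2)| `|t| => a b a0 a1 ab.
rewrite -mulr_natr; nra.
Qed.

Lemma cos_sub1_sqr_bound t : `|cos t - 1| <= t ^+ 2.
Proof.
rewrite cos_sub1 normrN normrMn normrX -[t ^+ 2]real_normK ?num_real //.
have := sin_bound (t / 2); have := normr_ge0 (sin (t / 2)).
rewrite [`|t / 2|]normrM [`|2^-1|]ger0_norm //.
move: `|sin (t / 2)| `|t| => a b a0 ab.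
rewrite -mulr_natr; nra.
Qed.

Lemma sin_sub_bound t : `|sin t - t| <= t ^+ 2.
Proof.
wlog t0 : t / 0 <= t.
  move=> H; have [/H //|/ltW t0] := leP 0 t.
  by rewrite -sqrrN -normrN opprB addrC -sinN -[X in _ + X]opprK H // oppr_ge0.
have [->|tn0] := eqVneq t 0; first by rewrite sin0 subrr normr0 sqr_ge0.
have t1 : 0 < t by rewrite lt_def tn0.
have dsin (x : R) : is_derive x 1 (fun x : R => sin x - x) (cos x - 1).
  exact: (is_deriveB (f := @sin R) (g := id)).
have [|c] := @MVT R (fun x => sin x - x) (fun x => cos x - 1) 0 t t1 (fun x _ => dsin x).
  apply: continuous_subspaceT => c; apply: cvgB; [exact: continuous_sin|exact: cvg_id].
rewrite in_itv /= => /andP[c0 ct]; rewrite sin0 !subr0 => ->.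
rewrite normrM (ger0_norm t0) expr2 ler_wpM2r //.
by apply: (le_trans (cos_sub1_bound c)); rewrite gtr0_norm // ltW.
Qed.

Lemma cmod_le_parts (z : R[i]) : cmod z <= `|complex.Re z| + `|complex.Im z|.
Proof.
rewrite {1}[z]complexE; apply: (le_trans (cmodD _ _)).
rewrite cmodM !cmod_real.
have -> : cmod ('i%C : R[i]) = 1.
  by rewrite /cmod normc_def /= expr0n/= add0r expr1n sqrtr1.
by rewrite mul1r.
Qed.

Lemma expi_sub1_bound t : cmod (expi t - 1) <= 2 * `|t|.
Proof.
apply: (le_trans (cmod_le_parts _)); rewrite mulr_natl mulr2n.
by apply: lerD; rewrite /= ?subr0 ?cos_sub1_bound ?sin_bound.
Qed.

Lemma expi_taylor_bound t : cmod (expi t - 1 - (0 +i* t)%C) <= 2 * t ^+ 2.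
Proof.
apply: (le_trans (cmod_le_parts _)); rewrite mulr_natl mulr2n.
by apply: lerD; rewrite /= ?subr0 ?cos_sub1_sqr_bound ?sin_sub_bound.
Qed.

Lemma expi_dist s t : cmod (expi s - expi t) <= 2 * `|s - t|.
Proof.
have -> : expi s - expi t = expi t * (expi (s - t) - 1).
  by rewrite mulrBr mulr1 -expiD [t + _]addrC subrK.
by rewrite cmodM cmod_expi mul1r expi_sub1_bound.
Qed.

(** In the right half-plane the cosine of the argument is positive, so the imaginary
    part alone determines a unimodular number, and does so continuously. *)
Lemma expi_asin (z : R[i]) : z * z^* = 1 -> 0 < complex.Re z ->
  [/\ - (pi / 2) < asin (complex.Im z) < pi / 2, -1 < complex.Im z < 1
    & z = expi (asin (complex.Im z))].
Proof.
case: z => a b; rewrite -[_^*]/(a -i* b)%C; simpc => -[ab _] /= a0.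
have ab1 : a ^+ 2 + b ^+ 2 = 1 by rewrite !expr2.
have b1 : -1 < b < 1.
  by rewrite -ltr_norml -(@ltr_pXn2r _ 2) ?nnegrE // expr1n real_normK ?num_real //; nra.
have b1' : -1 <= b <= 1 by case/andP: b1 => /ltW -> /ltW ->.
split=> //.
  by rewrite asin_gtNpi2 ?asin_ltpi2 //; case/andP: b1 => h1 h2; rewrite ?h1 ?h2 ?ltW.
rewrite /expi cos_asin // asinK ?in_itv //=; congr (_ +i* _)%C.
have -> : 1 - b ^+ 2 = a ^+ 2 by rewrite -ab1 addrK.
by rewrite sqrtr_sqr gtr0_norm.
Qed.

(** The other square root lies in the left half-plane. *)
Lemma expi_half (z : R[i]) theta : - (pi / 2) < theta < pi / 2 ->
  0 < complex.Re z -> z ^+ 2 = expi theta -> z = expi (theta / 2).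
Proof.
move=> /andP[h1 h2] z0; have tE : theta / 2 *+ 2 = theta.
  by rewrite -[_ *+ 2]mulr_natr divfK ?pnatr_eq0.
rewrite -{1}tE expiMn => /eqP; rewrite eqf_sqr => /orP[/eqP -> //|/eqP zN].
move: z0; rewrite zN /= oppr_gt0 ltNge ltW // cos_gt0_pihalf //.
have := @pi_gt0 R; lra.
Qed.

End ExponentialBounds.

Section CircleGroup.
Context {R : realType}.
Implicit Types (r s d e : R) (t : RZ R).

Lemma to_RZD r s : to_RZ (r + s) = to_RZ r + to_RZ s.
Proof. by rewrite /to_RZ !piE. Qed.

Lemma of_RZK t : to_RZ (of_RZ t) = t.
Proof. exact: reprK. Qed.

Lemma to_RZ_eq r s : to_RZ r = to_RZ s <-> exists k : int, r - s = k%:~R.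
Proof.
have E : (r - s \in @int_pred R) = (to_RZ r == to_RZ s) := Quotient.idealrBE _ r s.
split=> [/eqP|[k rs]]; first by rewrite -E => /intrP.
by apply/eqP; rewrite -E; apply/intrP; exists k.
Qed.

Lemma to_RZ0 : to_RZ (0 : R) = 0.
Proof. by apply: (@addrI _ (to_RZ (0 : R))); rewrite -to_RZD !addr0. Qed.

Lemma to_RZ1 : to_RZ (1 : R) = 0.
Proof. by rewrite -to_RZ0; apply/to_RZ_eq; exists 1; rewrite subr0. Qed.

(** The open sets of [RZ R] are by definition those with open preimage in the line,
    so that a continuous lift is all that is needed. *)
Lemma RZ_continuousP (B : cstarType R) (u : RZ R -> B) : continuous u <->
  forall r e, 0 < e -> exists2 d, 0 < d &
    forall s, `|r - s| < d -> nrm (u (to_RZ r) - u (to_RZ s)) < e.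
Proof.
have toC : continuous (@to_RZ R) by apply/continuousP => V; exact.
have lift : continuous u <-> continuous (u \o @to_RZ R).
  split=> uC; first by move=> r; exact: continuous_comp (toC r) (uC _).
  by apply/continuousP => V Vop; move/continuousP: uC; apply.
rewrite lift; split=> [uC r e e0|uP r].
  have e0' : 0 < e%:C%C by rewrite ltcR.
  have /cvgrPdist_lt/(_ _ e0')/nbhs_normP[d /= d0 dP] := uC r.
  by exists d => // s /dP; rewrite /= nrm_lt.
apply/cvgrPdist_lt => e /posc_real[e0 eE]; apply/nbhs_normP.
by have [d d0 dP] := uP r _ e0; exists d => // s /dP; rewrite eE nrm_lt.
Qed.

End CircleGroup.

Section UnitaryCharacters.
Context {R : realType} {N : nat} {A : 'M[nat]_N} {OA : cstarType R}.
Context {S : 'I_N -> OA} {Phi : (XA A -> R[i]) -> OA}.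
Hypothesis PhiI : diag_identification S Phi.
Implicit Types (f g : CZ (XA A)) (x y : XA A) (r s c d e : R) (t : RZ R).

Definition phase r f x : R[i] := expi (2 * pi * r * (f x)%:~R).

Lemma Cfun_phase r f : Cfun (phase r f).
Proof. exact: (Cfun_CZ (fun n : int => expi (2 * pi * r * n%:~R)) f). Qed.

Lemma phase_unimodular r f x : phase r f x * (phase r f x)^* = 1.
Proof. exact: expi_unimodular. Qed.

Lemma phaseD r s f x : phase (r + s) f x = phase r f x * phase s f x.
Proof. by rewrite /phase -expiD mulrDr mulrDl. Qed.

Lemma phase_add r f g x : phase r (f + g) x = phase r f x * phase r g x.
Proof.
rewrite /phase -expiD -mulrDr -intrD.
by [].
Qed.

Lemma phase_int (k : int) f x : phase k%:~R f x = 1.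
Proof. by rewrite /phase -mulrA -intrM expi_2pi_int. Qed.

Lemma U_to_RZ r f : U Phi (to_RZ r) f = Phi (phase r f).
Proof.
have [k kE] : exists k : int, of_RZ (to_RZ r) - r = k%:~R.
  by apply/to_RZ_eq; rewrite of_RZK.
rewrite -[LHS]/(Phi (phase (of_RZ (to_RZ r)) f)); congr Phi; apply/funext => x.
by rewrite -(subrK r (of_RZ _)) kE phaseD phase_int mul1r.
Qed.

Lemma U_of_RZ t f : U Phi t f = Phi (phase (of_RZ t) f).
Proof. by []. Qed.

Lemma U_unitary t f : unitary (U Phi t f).
Proof.
by apply: (Phi_unitary PhiI); [exact: Cfun_phase|exact: phase_unimodular].
Qed.

Lemma U_diag t f : diag_alg S (U Phi t f).
Proof. by rewrite U_of_RZ; apply: (Phi_diag PhiI); exact: Cfun_phase. Qed.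

Lemma U_RZD (s t : RZ R) f : U Phi (s + t) f = U Phi s f * U Phi t f.
Proof.
rewrite -(of_RZK s) -(of_RZK t) -to_RZD !U_to_RZ -(PhiM PhiI); try exact: Cfun_phase.
by congr Phi; apply/funext => x; exact: phaseD.
Qed.

Lemma U_add t f g : U Phi t (f + g) = U Phi t f * U Phi t g.
Proof.
rewrite !U_of_RZ -(PhiM PhiI); try exact: Cfun_phase.
by congr Phi; apply/funext => x; exact: phase_add.
Qed.

Lemma CZ_bounded f : exists2 M : R, 0 < M & forall x, `|(f x)%:~R| <= M.
Proof.
have fC := Cfun_CZ (fun n : int => (n%:~R : R)%:C%C) f.
exists (nrm (Phi (fun x => ((f x)%:~R)%:C%C)) + 1) => [|x].
  by rewrite ltr_wpDl // nrm_ge0.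
by have := Phi_lower PhiI x fC; rewrite cmod_real; lra.
Qed.

Lemma U_continuous f : continuous (fun t : RZ R => U Phi t f).
Proof.
apply/RZ_continuousP => r e e0; have [M M0 fM] := CZ_bounded f.
have pi0 := @pi_gt0 R; pose K := 8 * pi * M; have K0 : 0 < K by rewrite !mulr_gt0.
exists (e / K); first by rewrite divr_gt0.
move=> s; rewrite ltr_pdivlMr // => rs; apply: le_lt_trans rs.
rewrite !U_to_RZ -(PhiB PhiI); try exact: Cfun_phase.
have [->|rs] := eqVneq r s.
  rewrite subrr normr0 mul0r; have -> : (fun x => phase s f x - phase s f x) = fun=> 0.
    by apply/funext => x; rewrite subrr.
  by rewrite (Phi0 PhiI) nrm0.
have rs0 : 0 < `|r - s| by rewrite normr_gt0 subr_eq0.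
have -> : `|r - s| * K = 2 * (4 * pi * M * `|r - s|) by rewrite /K; ring.
apply: (Phi_bound PhiI); first by rewrite !mulr_gt0.
  by apply: CfunD; [|apply: CfunN]; exact: Cfun_phase.
move=> x; apply: (le_trans (expi_dist _ _)); rewrite -mulrBl -mulrBr !normrM.
rewrite (ger0_norm (ltW pi0)) [`|2|]ger0_norm //.
have := fM x; move: `|(f x)%:~R| => n nM.
have -> : 2 * (2 * pi * `|r - s| * n) = 4 * pi * `|r - s| * n by ring.
by rewrite -[leRHS]mulrAC ler_wpM2l // !mulr_ge0 // ltW.
Qed.

(** Two integers with the same phases at all times agree: at the time
    [1 / (2 (f x - g x))] the phases would differ by the factor [exp (i pi) = -1]. *)
Lemma U_inj f g : (forall t, U Phi t f = U Phi t g) -> f = g.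
Proof.
move=> fg; apply: CZP => x; apply: contrapT => /eqP neq.
pose n := f x - g x; have n0 : n%:~R != 0 :> R by rewrite intr_eq0 subr_eq0.
have eqp r : phase r f x = phase r g x.
  have := fg (to_RZ r); rewrite !U_to_RZ.
  by move=> /(Phi_inj PhiI (Cfun_phase r f) (Cfun_phase r g)) ->.
have pi0 := @pi_gt0 R.
have : expi (pi : R) = 1.
  have -> : (pi : R) = 2 * pi * (2 * n%:~R)^-1 * n%:~R.
    by field; rewrite n0.
  rewrite /n intrB mulrBr expiD -expi_conj -[X in X * _]/(phase _ f x).
  by rewrite eqp; exact: phase_unimodular.
move=> /expi_eq1[k kE]; have : 1 = 2 * k%:~R :> R.
  by apply: (mulfI (lt0r_neq0 pi0)); rewrite mulr1 {1}kE; ring.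
rewrite -[1]/(1%:~R) -[2]/(2%:~R) -intrM => /intr_inj; lia.
Qed.

(** A continuous character of the circle with values in the unitaries of the
    diagonal is, at each point [x], a character of the circle, hence an integer [f x].
    Near [0] all these characters lie in the right half-plane at once, so that [f]
    is read off from the arguments at a single small time, which depend continuously
    on [x]. *)
Lemma unitary_character (u : RZ R -> OA) : continuous u ->
  (forall t, diag_alg S (u t)) -> (forall t, unitary (u t)) ->
  (forall s t : RZ R, u (s + t) = u s * u t) ->
  exists f, forall t, u t = U Phi t f.
Proof.
move=> /RZ_continuousP uC uD uU uM; have pi0 := @pi_gt0 R.
have u0 : u 0 = 1.
  by have [uu _] := uU 0; rewrite -[LHS]mul1r -uu -mulrA -uM addr0.
have /choice[h hP] : forall r, exists k : XA A -> R[i], Cfun k /\ Phi k = u (to_RZ r).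
  by move=> r; have [k kC kE] := Phi_surj PhiI (uD (to_RZ r)); exists k.
have hC r := (hP r).1; have hE r := (hP r).2.
have hD r s x : h (r + s) x = h r x * h s x.
  have := Phi_inj PhiI (hC (r + s)) (CfunM (hC r) (hC s)).
  by rewrite (PhiM PhiI) // !hE to_RZD uM => /(_ erefl) ->.
have h1 x : h 1 x = 1.
  have := Phi_inj PhiI (hC 1) (@Cfun_cst R _ A 1).
  by rewrite (Phi1 PhiI) hE to_RZ1 u0 => /(_ erefl) ->.
have h_uni r x : h r x * (h r x)^* = 1.
  have := Phi_inj PhiI (CfunM (hC r) (Cfun_conj (hC r))) (@Cfun_cst R _ A 1).
  rewrite (PhiM PhiI) // ?(Phi_conj PhiI) ?(Phi1 PhiI) // ?hE; last exact: Cfun_conj.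
  by have [_ ->] := uU (to_RZ r) => /(_ erefl)/(congr1 (fun k => k x)).
have h_dist r s x : cmod (h r x - h s x) <= nrm (u (to_RZ r) - u (to_RZ s)).
  rewrite -!hE -(PhiB PhiI) //.
  apply: (Phi_lower PhiI x (f := fun x => h r x - h s x)).
  by apply: CfunD => //; exact: CfunN.
have h0 x : h 0 x = 1.
  by have := hD 1 0 x; rewrite addr0 h1 mul1r.
have [d d0 dP] := uC 0 1 ltr01.
have Re_pos r x : `|r| < d -> 0 < complex.Re (h r x).
  move=> rd; have : cmod (h 0 x - h r x) < 1.
    by apply: le_lt_trans (h_dist _ _ _) (dP _ _); rewrite sub0r normrN.
  move=> /(le_lt_trans (cmod_Re _)); rewrite h0 raddfB /= ltr_norml => /andP[_].
  lra.
pose q n : R := 2^-1 ^+ n.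
have q0 n : 0 < q n by rewrite exprn_gt0.
have qS n : q n = q n.+1 + q n.+1.
  by rewrite /q exprS; field.
have q_lt c : 0 < c -> exists n, q n < c.
  move=> c0; have := @cvg_expr R 2^-1; rewrite ger0_norm // invf_lt1 // ltr1n => /(_ isT).
  move=> /cvgrPdist_lt/(_ _ c0)[n _ /(_ _ (leqnn n))] /=.
  by rewrite sub0r normrN ger0_norm ?exprn_ge0 // => ?; exists n.
have [L Ld] := q_lt _ d0.
have q_small n : q (L + n)%N < d.
  apply: le_lt_trans Ld; rewrite /q exprD ler_piMr ?exprn_ge0 //.
  by rewrite exprn_ile1 // invf_le1 // ler1n.
pose theta x := asin (complex.Im (h (q L) x)).
have Re_q n x : 0 < complex.Re (h (q (L + n)%N) x).
  by apply: Re_pos; rewrite gtr0_norm.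
have theta_spec x : [/\ - (pi / 2) < theta x < pi / 2,
    -1 < complex.Im (h (q L) x) < 1 & h (q L) x = expi (theta x)].
  by apply: expi_asin => //; have := Re_q 0%N x; rewrite addn0.
(* Square roots are taken in the right half-plane, so that they halve the angle. *)
have theta_q n x : - (pi / 2) < theta x * q n < pi / 2 /\
    h (q (L + n)%N) x = expi (theta x * q n).
  have [th _ hth] := theta_spec x.
  elim: n => [|n [IH1 IH2]]; first by rewrite addn0 /q expr0 mulr1.
  have half : theta x * q n.+1 = theta x * q n / 2.
    by rewrite (qS n); field.
  split.
    by rewrite half; move: IH1 => /andP[]; move: (theta x * q n) => z z1 z2; lra.
  rewrite half; apply: expi_half => //.
  by rewrite -IH2 addnS [in RHS]qS hD expr2.
have h_mul n r x : h (r *+ n) x = h r x ^+ n.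
  by elim: n => [|n IHn]; rewrite ?mulr0n // mulrS hD IHn exprS.
have qL : q L *+ 2 ^ L = 1.
  by rewrite -[_ *+ 2 ^ L]mulr_natr /q natrX -exprMn mulVf ?expr1n // pnatr_eq0.
have /choice[f fP] : forall x, exists k : int, theta x *+ 2 ^ L = 2 * pi * k%:~R.
  move=> x; apply: expi_eq1; have [_ _ hth] := theta_spec x.
  by rewrite expiMn -hth -h_mul qL h1.
have theta_f x : theta x = 2 * pi * q L * (f x)%:~R.
  rewrite mulrAC -fP -[theta x *+ _]mulr_natr -mulrA [_ * q L]mulrC mulr_natr qL.
  by rewrite mulr1.
(* Nearby points have angles closer than the gap [2 * pi * q L] between the angles
   that belong to distinct integers. *)
have f_loc x : exists n, forall y, agree n x y -> f y = f x.
  have [_ im1 _] := theta_spec x.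
  have e0 : 0 < 2 * pi * q L / 2 by rewrite !divr_gt0 // !mulr_gt0.
  have /cvgrPdist_lt/(_ _ e0)/nbhs_normP[c /= c0 cP] := continuous_asin im1.
  have [n nP] := (Cfun_realP _).1 (Cfun_Im (hC (q L))) x _ c0.
  exists n => y /nP/cP; rewrite /= -!/(theta _) !theta_f -mulrBr normrM.
  rewrite gtr0_norm ?mulr_gt0 // ltr_pM2l ?mulr_gt0 // -intrB.
  have -> : 2^-1 = 1 / 2 :> R by rewrite mul1r.
  move=> lt2; have {}lt2 : (`|f x - f y|%:~R : R) < 1.
    by rewrite intr_norm; apply: lt_trans lt2 _; lra.
  by move: lt2; rewrite -[1]/(1%:~R) ltr_int; lia.
have [F FE] := CZ_of_agree f_loc; exists F => t.
(* A nonnegative representative, to be approximated by multiples of small [q n]. *)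
have [r r0 <-] : exists2 r : R, 0 <= r & to_RZ r = t.
  exists (of_RZ t + (Num.bound `|of_RZ t|)%:R).
    have := archi_boundP (normr_ge0 (of_RZ t)); have := ler_norm (- of_RZ t).
    by rewrite normrN; lra.
  rewrite -[RHS]of_RZK; apply/to_RZ_eq; exists (Num.bound `|of_RZ t|)%:Z.
  by rewrite addrAC subrr add0r.
rewrite U_to_RZ -hE; congr Phi; apply/funext => x.
have phase_q n : h (q (L + n)%N) x = phase (q (L + n)%N) F x.
  have [_ ->] := theta_q n x; rewrite theta_f /phase FE; congr expi.
  by rewrite /q exprD; ring.
have phaseMn n s : phase (s *+ n) F x = phase s F x ^+ n.
  rewrite /phase -expiMn; congr expi.
  by rewrite -[s *+ n]mulr_natr -[in RHS]mulr_natr; ring.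
apply/eqP; rewrite -subr_eq0; apply/eqP; apply: cmod_eq0; apply/eqP.
rewrite eq_le cmod_ge0 andbT; apply/ler_addgt0Pr => e e0; rewrite add0r.
have [c c0 cP] := uC r _ (divr_gt0 e0 (@ltr0Sn _ 1)).
pose K : R := 8 * pi * (`|(F x)%:~R| + 1); have K0 : 0 < K by rewrite !mulr_gt0 // ltr_wpDl.
have [n nP] : exists n, q n < Num.min c (e / K) by apply: q_lt; rewrite lt_min c0 divr_gt0.
set s := q (L + n)%N *+ Num.truncn (r / q (L + n)%N).
have rs : `|r - s| < Num.min c (e / K).
  apply: le_lt_trans nP; have /andP[k1 k2] := truncn_itv (divr_ge0 r0 (ltW (q0 (L + n)%N))).
  rewrite ler_pdivlMr // in k1; rewrite ltr_pdivrMr // in k2.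
  have qLn : q (L + n)%N <= q n.
    by rewrite /q exprD ler_piMl ?exprn_ge0 // exprn_ile1 // invf_le1 // ler1n.
  apply: le_trans qLn; rewrite /s -[_ *+ Num.truncn _]mulr_natr mulrC ger0_norm ?subr_ge0 //.
  by rewrite -natr1 mulrDl mul1r in k2; rewrite lerBlDl ltW.
have [rc rK] : `|r - s| < c /\ `|r - s| < e / K by move: rs; rewrite lt_min => /andP.
have hs : h s x = phase s F x by rewrite /s h_mul phaseMn phase_q.
have b1 := le_lt_trans (h_dist r s x) (cP _ rc).
have b2 : cmod (phase s F x - phase r F x) <= e / 2.
  apply: (le_trans (expi_dist _ _)); rewrite -mulrBl -mulrBr !normrM.
  rewrite (ger0_norm (ltW pi0)) [`|2|]ger0_norm // distrC.
  rewrite ltr_pdivlMr // in rK; rewrite /K in rK.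
  move: rK (normr_ge0 (r - s)) (normr_ge0 ((F x)%:~R : R)).
  move: `|r - s| `|(F x)%:~R| => a b rK a0 b0; nra.
have := cmod_dist (h s x) (h r x) (phase r F x); rewrite {2}hs; lra.
Qed.

End UnitaryCharacters.

(** * Actions fixing the diagonal and their cocycles *)

Section DiagonalActions.
Context {R : realType} {N : nat} {A : 'M[nat]_N} {OA : cstarType R}.
Context {S : 'I_N -> OA} {Phi : (XA A -> R[i]) -> OA}.
Hypotheses (OA_univ : cuntz_krieger A S) (PhiI : diag_identification S Phi).
Implicit Types (f g xi : CZ (XA A)) (x y : XA A) (t : RZ R).

Let OA_ck : ck_family A S. Proof. by case: OA_univ. Qed.

(** The range projections of the generators sum to 1. *)
Lemma gen_cancel (a b : OA) : (forall i, a * S i = b * S i) -> a = b.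
Proof.
move=> ab; rewrite -[a]mulr1 -[b]mulr1 -(gen_sum_range OA_ck) !mulr_sumr.
by apply: eq_bigr => i _; rewrite !mulrA ab.
Qed.

Lemma U0 f : U Phi 0 f = 1.
Proof.
rewrite -to_RZ0 U_to_RZ -(Phi1 PhiI); congr Phi; apply/funext => x.
by rewrite /phase mulr0 mul0r expi0.
Qed.

Lemma U_opp t f : U Phi t (- f) = adj (U Phi t f).
Proof.
have [uu _] := U_unitary PhiI t f; rewrite -[LHS]mul1r -uu -mulrA -(U_add PhiI).
rewrite subrr -[RHS]mulr1; congr (_ * _).
rewrite !U_of_RZ -(Phi1 PhiI); congr Phi; apply/funext => x.
by rewrite /phase mulr0 expi0.
Qed.

Lemma CZ_shift_ex f : exists g, forall x, g x = f (Defs.shift x).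
Proof.
apply: CZ_of_agree => x; have [n nP] := CZ_agree f (Defs.shift x).
by exists n.+1 => y xy; apply: nP; exact: agree_shift.
Qed.

Lemma U_covariance f g t i : (forall x, g x = f (Defs.shift x)) ->
  S i * U Phi t f = U Phi t g * S i.
Proof.
move=> gf; rewrite !U_of_RZ (covariance OA_ck PhiI); last exact: Cfun_phase.
by congr (Phi _ * _); apply/funext => x; rewrite /phase gf.
Qed.

(** Moving [adj (U_t xi)] across [S i] replaces [xi] by [xi o shift]. *)
Lemma U_conj_gen xi xi' g t i : (forall x, xi' x = xi (Defs.shift x)) ->
  U Phi t xi * (U Phi t g * S i) * adj (U Phi t xi) = U Phi t (g + (xi - xi')) * S i.
Proof.
move=> xiE; rewrite -(U_opp t xi) -!mulrA (@U_covariance _ (- xi')); last first.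
  by move=> x; rewrite -[LHS]/(- xi' x) xiE.
by rewrite !mulrA -!(U_add PhiI) addrA [xi + g]addrC.
Qed.

Definition twist_action (rho : CZ (XA A) -> RZ R -> OA -> OA) := forall f t,
  [/\ star_morphism (rho f t), forall i, rho f t (S i) = U Phi t f * S i
    & forall d, diag_alg S d -> rho f t d = d].

Lemma twist_action_exists : exists rho, twist_action rho.
Proof.
have /choice[F FP] : forall ft : CZ (XA A) * RZ R, exists phi : OA -> OA,
    [/\ star_morphism phi, forall i, phi (S i) = U Phi ft.2 ft.1 * S i
      & forall d, diag_alg S d -> phi d = d].
  move=> [f t]; apply: (twist_morphism OA_univ PhiI (Cfun_phase (of_RZ t) f)).
  exact: phase_unimodular.
by exists (fun f t => F (f, t)) => f t; exact: FP (f, t).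
Qed.

(** The unitary [\sum_i alpha_t(S i) (S i)^*] implements an action fixing the diagonal:
    it commutes with the diagonal, hence lies in it by maximality, and it is a
    character of the circle because the action fixes it. *)
Section ActionUnitary.
Hypothesis diag_max : diag_commutant S `<=` diag_alg S.
Variables (alpha : RZ R -> OA -> OA) (alphaP : diag_action S alpha).

Let alphaM t : star_morphism (alpha t).
Proof. by case: alphaP => /(_ t)[]. Qed.

Let alpha_diag t d : diag_alg S d -> alpha t d = d.
Proof. by case: alphaP => _ _ _ _; apply. Qed.

Definition action_unitary t : OA := \sum_i alpha t (S i) * adj (S i).

Lemma action_unitary_gen t i : action_unitary t * S i = alpha t (S i).
Proof.
rewrite /action_unitary mulr_suml (bigD1 i) //= big1 => [|j ji]; last first.
  by rewrite -mulrA (gen_orthogonal OA_univ PhiI) // mulr0.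
rewrite addr0 -mulrA -(alpha_diag t (diag_source OA_ck i)) -(smorphM (alphaM t)).
by rewrite mulrA (gen_partial_isometry OA_ck).
Qed.

(** Multiplying a generator on the left by a range projection of words amounts to
    multiplying it on the right by a diagonal element, which the action fixes. *)
Lemma action_unitary_word t w :
  word_elt S w * adj (word_elt S w) * action_unitary t =
  action_unitary t * (word_elt S w * adj (word_elt S w)).
Proof.
case: w => [|i w]; first by rewrite word_elt_nil star1 !mul1r mulr1.
set p := word_elt S (i :: w) * _; have pD : diag_alg S p := diag_word (i :: w).
apply: gen_cancel => j; rewrite -mulrA action_unitary_gen -(alpha_diag t pD).
rewrite -(smorphM (alphaM t)) -mulrA (alpha_diag t pD).
have [e eD pS] : exists2 e, diag_alg S e & p * S j = S j * e.
  have [ij|ij] := eqVneq i j; last first.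
    exists 0; first exact: diag0.
    rewrite /p {2}word_elt_cons starM -!mulrA (gen_orthogonal OA_univ PhiI ij).
    by rewrite !mulr0.
  exists (word_elt S w * adj (word_elt S w) * (adj (S i) * S i)).
    by apply: diagM; [exact: diag_word|exact: (diag_source OA_ck)].
  by rewrite /p !word_elt_cons starM -ij !mulrA.
by rewrite pS (smorphM (alphaM t)) (alpha_diag t eD) mulrA action_unitary_gen.
Qed.

Lemma action_unitary_diag t : diag_alg S (action_unitary t).
Proof.
apply: diag_max; set u := action_unitary t.
(* The condition on the adjoint makes [M] closed under [adj]. *)
pose M : set OA := [set d | d * u = u * d /\ adj d * u = u * adj d].
suff : diag_alg S `<=` M by move=> DM d /DM[].
apply: cstar_generated_ind => [|_ [w _ <-]]; last first.
  by split; rewrite ?starM ?starK; exact: action_unitary_word.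
split.
- by split; rewrite ?star0 mul0r mulr0.
- move=> c d e [d1 d2] [e1 e2]; split.
    by rewrite mulrDl mulrDr -scalerAl -scalerAr d1 e1.
  by rewrite starD starZ mulrDl mulrDr -scalerAl -scalerAr d2 e2.
- move=> d e [d1 d2] [e1 e2]; split; first by rewrite -mulrA e1 mulrA d1 mulrA.
  by rewrite starM -mulrA d2 mulrA e2 mulrA.
- by move=> d [d1 d2]; split; rewrite ?starK.
apply/closed_nrmP => d dM.
have comm (v : OA) : (forall e, 0 < e ->
    exists2 w : OA, w * u = u * w & nrm (v - w) < e) -> v * u = u * v.
  move=> vw; apply/eqP; rewrite -subr_eq0; apply/eqP; apply: nrm_small_eq0 => e e0.
  have K0 : 0 < 2 * (nrm u + 1) by rewrite mulr_gt0 // ltr_wpDl // nrm_ge0.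
  have [w wu] := vw _ (divr_gt0 e0 K0); rewrite ltr_pdivlMr // => vwe.
  have -> : v * u - u * v = (v - w) * u - u * (v - w).
    by rewrite mulrBl mulrBr wu opprB addrA subrK.
  apply: (le_trans (nrmD _ _)); rewrite nrmN.
  have := nrmM (v - w) u; have := nrmM u (v - w).
  have := nrm_ge0 (v - w); have := nrm_ge0 u; nra.
split; apply: comm => e /dM[w [w1 w2] dw]; first by exists w.
by exists (adj w); rewrite // -starB nrm_adj.
Qed.

Lemma action_unitary_unitary t : unitary (action_unitary t).
Proof.
have uD := action_unitary_diag t; set u := action_unitary t in uD *.
suff uu : u * adj u = 1.
  by split=> //; rewrite (diag_comm PhiI (diag_adj uD) uD).
have [_ one _] := OA_ck; rewrite -{1}[u]mulr1 -one mulr_sumr mulr_suml.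
apply: eq_bigr => i _; rewrite mulrA action_unitary_gen -mulrA -starM action_unitary_gen.
rewrite -(smorph_adj (alphaM t)) -(smorphM (alphaM t)).
by rewrite alpha_diag //; exact: diag_range.
Qed.

Lemma action_unitaryD (s t : RZ R) :
  action_unitary (s + t) = action_unitary s * action_unitary t.
Proof.
rewrite (diag_comm PhiI); try exact: action_unitary_diag.
apply: gen_cancel => i; case: alphaP => _ _ mul _ _.
rewrite action_unitary_gen mul /= -(action_unitary_gen t) (smorphM (alphaM s)).
by rewrite (alpha_diag s (action_unitary_diag t)) -mulrA action_unitary_gen.
Qed.

Lemma action_unitary_continuous : continuous action_unitary.
Proof.
have mulC (b : OA) : continuous (fun a : OA => a * b).
  move=> a; apply/cvgrPdist_lt => e /posc_real[e0 eE].
  have K0 : 0 < nrm b + 1 by rewrite ltr_wpDl // nrm_ge0.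
  apply/nbhs_normP; exists (complex.Re e / (nrm b + 1))%:C%C.
    by rewrite /= ltcR divr_gt0.
  move=> a'; rewrite /= nrm_lt ltr_pdivlMr // => aa'.
  rewrite eE nrm_lt -mulrBl; apply: le_lt_trans (nrmM _ _) _.
  by have := nrm_ge0 (a - a'); nra.
rewrite /action_unitary; elim: (index_enum _) => [|i r IHr].
  have -> : (fun t => \sum_(i <- [::]) alpha t (S i) * adj (S i)) = fun=> 0.
    by apply/funext => t; rewrite big_nil.
  exact: cst_continuous.
have -> : (fun t => \sum_(j <- i :: r) alpha t (S j) * adj (S j)) =
    (fun t => alpha t (S i) * adj (S i) + \sum_(j <- r) alpha t (S j) * adj (S j)).
  by apply/funext => t; rewrite big_cons.
move=> t; apply: (@cvgD _ _ _ (nbhs t) (nbhs_filter t)); last exact: IHr.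
case: alphaP => _ _ _ /(_ (S i) t) aC _.
exact: (continuous_comp aC (mulC (adj (S i)) (alpha t (S i)))).
Qed.

Lemma diag_action_is_twist : exists f, forall t i, alpha t (S i) = U Phi t f * S i.
Proof.
have [f fP] := unitary_character PhiI action_unitary_continuous action_unitary_diag
  action_unitary_unitary action_unitaryD.
by exists f => t i; rewrite -fP action_unitary_gen.
Qed.

End ActionUnitary.

Section Twists.
Variables (rho : CZ (XA A) -> RZ R -> OA -> OA) (rhoP : twist_action rho).

Let rhoM f t : star_morphism (rho f t). Proof. by have [] := rhoP f t. Qed.
Let rhoS f t i : rho f t (S i) = U Phi t f * S i.
Proof. by have [_ ->] := rhoP f t. Qed.
Let rho_fix f t d : diag_alg S d -> rho f t d = d.
Proof. by have [_ _] := rhoP f t; apply. Qed.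

Lemma twist_addt f (s t : RZ R) : rho f (s + t) = rho f s \o rho f t.
Proof.
apply: (gen_ext OA_univ) => [//||i /=]; first exact: smorph_comp.
rewrite !rhoS (smorphM (rhoM f s)) rho_fix; last exact: U_diag.
by rewrite rhoS mulrA -(U_RZD PhiI) addrC.
Qed.

Lemma twist_0t f : rho f 0 = id.
Proof.
by apply: (gen_ext OA_univ) => [//||i /=]; [exact: smorph_id|rewrite rhoS U0 mul1r].
Qed.

Lemma twist_add f g : rho (f + g) = action_mul (rho f) (rho g).
Proof.
apply/funext => t; apply: (gen_ext OA_univ) => [//||i /=]; first exact: smorph_comp.
rewrite /action_mul /= !rhoS (smorphM (rhoM f t)) rho_fix; last exact: U_diag.
by rewrite rhoS mulrA -(U_add PhiI) addrC.
Qed.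

Lemma twist_automorphism f t : star_automorphism (rho f t).
Proof.
split=> //; exists (rho f (- t)) => a.
  by rewrite -[LHS]/((rho f (- t) \o rho f t) a) -twist_addt addNr twist_0t.
by rewrite -[LHS]/((rho f t \o rho f (- t)) a) -twist_addt subrr twist_0t.
Qed.

(** The elements with continuous orbit map form a closed subalgebra, the maps
    [rho f t] being contractive, and contain the generators. *)
Lemma twist_continuous f a : continuous (fun t => rho f t a).
Proof.
pose L : set OA := [set a | forall e, 0 < e -> exists2 d : R, 0 < d &
  forall s, `|s| < d -> nrm (rho f (to_RZ s) a - a) < e].
suff La : L a.
  apply/RZ_continuousP => r e /La[d d0 dP]; exists d => // s rs.
  have -> : to_RZ s = to_RZ r + to_RZ (s - r) by rewrite -to_RZD addrC subrK.
  rewrite twist_addt /= -(smorphB (rhoM _ _)) (le_lt_trans (smorph_nrm (rhoM _ _) _)) //.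
  by rewrite nrm_sub dP // distrC.
have sub : cstar_subalgebra L.
  split.
  - move=> e e0; exists 1 => // s _; rewrite (smorph0 (rhoM _ _)) subrr nrm0 //.
  - move=> c b b' bL b'L e e0; have e20 : 0 < e / 2 by rewrite divr_gt0.
    have c1 : 0 < cmod c + 1 by rewrite ltr_wpDl // cmod_ge0.
    have [d d0 dP] := bL _ (divr_gt0 e20 c1); have [d' d'0 d'P] := b'L _ e20.
    exists (Num.min d d'); first by rewrite lt_min d0.
    move=> s; rewrite lt_min => /andP[/dP h1 /d'P h2].
    rewrite (smorphD (rhoM _ _)) (smorphZ (rhoM _ _)) opprD addrACA -scalerBr.
    have := nrmD (c *: (rho f (to_RZ s) b - b)) (rho f (to_RZ s) b' - b').
    rewrite nrmZ; move: h1; rewrite ltr_pdivlMr // => h1.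
    have := nrm_ge0 (rho f (to_RZ s) b - b); nra.
  - move=> b b' bL b'L e e0; pose K := nrm b + nrm b' + 1.
    have K0 : 0 < K by rewrite ltr_wpDl // addr_ge0 ?nrm_ge0.
    have [d d0 dP] := bL _ (divr_gt0 e0 K0); have [d' d'0 d'P] := b'L _ (divr_gt0 e0 K0).
    exists (Num.min d d'); first by rewrite lt_min d0.
    move=> s; rewrite lt_min => /andP[/dP h1 /d'P h2].
    rewrite (smorphM (rhoM _ _)); apply: (le_lt_trans (nrm_subM _ _ _ _)).
    have := smorph_nrm (rhoM f (to_RZ s)) b; move: h1 h2.
    rewrite !ltr_pdivlMr // /K.
    move: (nrm_ge0 (rho f (to_RZ s) b - b)) (nrm_ge0 (rho f (to_RZ s) b' - b')).
    move: (nrm_ge0 b) (nrm_ge0 b') (nrm_ge0 (rho f (to_RZ s) b)).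
    move: (nrm (rho f (to_RZ s) b - b)) (nrm (rho f (to_RZ s) b' - b')).
    move: (nrm b) (nrm b') (nrm (rho f (to_RZ s) b)) => u v w z z'.
    nra.
  - move=> b bL e /bL[d d0 dP]; exists d => // s /dP.
    by rewrite (smorph_adj (rhoM _ _)) -starB nrm_adj.
  - apply/closed_nrmP => b bL e e0; have e30 : 0 < e / 3 by rewrite divr_gt0.
    have [b' b'L bb'] := bL _ e30; have [d d0 dP] := b'L _ e30; exists d => // s /dP h.
    have := nrm_dist (rho f (to_RZ s) b') (rho f (to_RZ s) b) b.
    have := nrm_dist b' (rho f (to_RZ s) b') b; rewrite (nrm_sub b' b).
    have := smorph_nrm (rhoM f (to_RZ s)) (b - b'); rewrite (smorphB (rhoM _ _)); lra.
apply: (cstar_generated_ind sub (G := range S)); last by case: OA_univ => _ ->.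
move=> _ [i _ <-] e e0; have K0 : 0 < nrm (S i) + 1 by rewrite ltr_wpDl // nrm_ge0.
have /RZ_continuousP/(_ 0 _ (divr_gt0 e0 K0))[d d0 dP] := U_continuous PhiI (f := f).
exists d => // s sd; rewrite rhoS -{2}[S i]mul1r -mulrBl.
apply: (le_lt_trans (nrmM _ _)).
have := dP s; rewrite sub0r normrN to_RZ0 U0 nrm_sub => /(_ sd).
rewrite ltr_pdivlMr //; have := nrm_ge0 (S i); have := nrm_ge0 (U Phi (to_RZ s) f - 1); nra.
Qed.

Lemma twist_diag_action f : diag_action S (rho f).
Proof.
split=> [t||s t|a|t a aD].
- exact: twist_automorphism.
- exact: twist_0t.
- exact: twist_addt.
- exact: twist_continuous.
- exact: rho_fix.
Qed.

Lemma twist_inj f g : rho f = rho g -> f = g.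
Proof.
move=> fg; apply: (U_inj PhiI) => t; apply: gen_cancel => i.
by rewrite -!rhoS fg.
Qed.

Hypothesis diag_max : diag_commutant S `<=` diag_alg S.

Lemma twist_surj alpha : diag_action S alpha -> exists f, rho f = alpha.
Proof.
move=> alphaP; have [f fP] := diag_action_is_twist diag_max alphaP.
exists f; apply/funext => t; apply: (gen_ext OA_univ) => [//||i].
  by case: alphaP => /(_ t)[].
by rewrite rhoS fP.
Qed.

Lemma smorph_Ad (u : OA) (phi : OA -> OA) : unitary u -> star_morphism phi ->
  star_morphism (fun a => u * phi a * adj u).
Proof.
move=> [u1 u2] phiM; split=> [c a b||a].
- by rewrite (smorphD phiM) (smorphZ phiM) mulrDr mulrDl -scalerAr -scalerAl.
- split=> [|a b]; first by rewrite (smorph1 phiM) mulr1.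
  by rewrite (smorphM phiM) -!mulrA [adj u * (u * _)]mulrA u1 mul1r.
- by rewrite (smorph_adj phiM) !starM starK mulrA.
Qed.

(** A cocycle relating two twists commutes with the diagonal, which both fix, so it is
    [U_t(xi)]; conjugating [S i] by it changes [f] by the coboundary of [xi]. *)
Lemma twist_equiv f g : cocycle_equiv (rho f) (rho g) <-> f - g \in coboundary (A := A).
Proof.
split=> [[u [uC uU uM] fgu]|/asboolP[xi xiE]].
  have uD t : diag_alg S (u t).
    apply: diag_max => d dD; have := fgu t d; rewrite !rho_fix // => {1}->.
    by have [u1 _] := uU t; rewrite -mulrA u1 mulr1.
  have uM' (s t : RZ R) : u (s + t) = u s * u t by rewrite uM rho_fix.
  have [xi xiP] := unitary_character PhiI uC uD uU uM'.
  have [xi' xi'P] := CZ_shift_ex xi.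
  have fE : f = g + (xi - xi').
    apply: (U_inj PhiI) => t; apply: gen_cancel => i.
    by rewrite -(U_conj_gen g t i xi'P) -xiP -!rhoS -fgu.
  apply/asboolP; exists xi => x; rewrite fE addrAC subrr add0r.
  by rewrite -xi'P.
have [xi' xi'P] := CZ_shift_ex xi.
have fE : f = g + (xi - xi').
  rewrite -[f](subrK g) [LHS]addrC; congr (_ + _); apply: CZP => x.
  by rewrite xiE -xi'P.
exists (fun t => U Phi t xi).
  split; [exact: (U_continuous PhiI)|by move=> t; exact: (U_unitary PhiI)|move=> s t].
  by rewrite rho_fix; [exact: (U_RZD PhiI)|exact: U_diag].
move=> t; suff : rho f t = fun a => U Phi t xi * rho g t a * adj (U Phi t xi).
  by move=> E a; rewrite E.
apply: (gen_ext OA_univ) => // [|i].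
  by apply: smorph_Ad => //; exact: (U_unitary PhiI).
by rewrite !rhoS (U_conj_gen g t i xi'P) -fE.
Qed.

Lemma twist_class f :
  action_class S (rho f) = rho @` [set g | g - f \in coboundary (A := A)].
Proof.
apply/seteqP; split=> [beta [/twist_surj[g <-]] /twist_equiv gf|_ [g gf <-]].
  by exists g.
by split; [exact: twist_diag_action|exact/twist_equiv].
Qed.

End Twists.

End DiagonalActions.

(** * The generator of an action and positivity *)

Section Order.
Context {R : realType} {N : nat} {A : 'M[nat]_N} {OA : cstarType R}.
Context {S : 'I_N -> OA} {Phi : (XA A -> R[i]) -> OA}.
Hypotheses (OA_univ : cuntz_krieger A S) (PhiI : diag_identification S Phi).
Implicit Types (f g : CZ (XA A)) (x y : XA A).

Let OA_ck : ck_family A S. Proof. by case: OA_univ. Qed.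

Definition CZ_complex f x : R[i] := ((f x)%:~R : R)%:C%C.

Lemma Cfun_CZ_complex f : Cfun (CZ_complex f).
Proof. exact: (Cfun_CZ (fun n : int => (n%:~R : R)%:C%C) f). Qed.

Lemma two_pi_i_neq0 : (0 +i* (2 * pi))%C != 0 :> R[i].
Proof.
apply/eqP => -[/eqP]; rewrite mulf_eq0 pnatr_eq0 /=.
by rewrite gt_eqF ?pi_gt0.
Qed.

(** The second-order Taylor bound holds uniformly because [f] is bounded, and [Phi] is
    bounded for the uniform norm. *)
Lemma twist_delta (alpha : RZ R -> OA -> OA) f :
  (forall t i, alpha t (S i) = U Phi t f * S i) ->
  is_delta S alpha 0 ((0 +i* (2 * pi))%C *: Phi (CZ_complex f)).
Proof.
move=> alphaS; rewrite /is_delta.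
have FE t : \sum_i alpha t (S i) * adj (S i) = U Phi t f.
  rewrite -[RHS]mulr1 -(gen_sum_range OA_ck) mulr_sumr.
  by apply: eq_bigr => i _; rewrite alphaS mulrA.
apply/cvgrPdist_lt => e /posc_real[e0 eE]; apply/nbhs_normP.
have [M M0 fM] := CZ_bounded PhiI f; have pi0 := @pi_gt0 R.
pose K : R := 4 * (2 * pi * M) ^+ 2; have K0 : 0 < K by rewrite mulr_gt0 // exprn_gt0 // !mulr_gt0.
exists (complex.Re e / K); first by rewrite /= divr_gt0.
move=> h /=; rewrite sub0r normrN ltr_pdivlMr // => he h0.
rewrite eE nrm_lt !FE add0r U_to_RZ (U0 PhiI) -(Phi1 PhiI).
pose k x : R[i] := phase h f x - 1 - (0 +i* (2 * pi * h * (f x)%:~R))%C.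
have kC : Cfun k.
  exact: (Cfun_CZ (fun n : int => expi (2 * pi * h * n%:~R) - 1
    - (0 +i* (2 * pi * h * n%:~R))%C) f).
have hC0 : h%:C%C != 0 :> R[i].
  by apply/eqP => -[/eqP]; exact/negP.
have -> : (0 +i* (2 * pi))%C *: Phi (CZ_complex f)
    - (h^-1)%:C%C *: (Phi (phase h f) - Phi (fun=> 1)) = - ((h^-1)%:C%C *: Phi k).
  have kE : k = fun x => (- (0 +i* (2 * pi * h))%C) * CZ_complex f x
      + (phase h f x - 1).
    apply/funext => x; rewrite /k addrC; congr (_ + _).
    by rewrite mulNr; congr (- _); rewrite /CZ_complex; simpc.
  have pC := Cfun_phase h f; have oneC := @Cfun_cst R _ A 1.
  have pC1 : Cfun (fun x => phase h f x - 1) by apply: CfunD => //; exact: CfunN.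
  rewrite kE (Phi_lin PhiI) //; last exact: Cfun_CZ_complex.
  rewrite -(PhiB PhiI) // scalerDr opprD scalerA mulrN scaleNr opprK.
  congr (_ *: _ - _); rewrite fmorphV; apply: (mulfI hC0); rewrite mulrA mulfV // mul1r.
  by simpc; rewrite mulrC.
rewrite nrmN nrmZ cmod_real normfV.
have h_gt0 : 0 < `|h| by rewrite normr_gt0.
rewrite mulrC ltr_pdivrMr //.
have kM x : cmod (k x) <= 2 * (2 * pi * M * `|h|) ^+ 2.
  apply: (le_trans (expi_taylor_bound _)); rewrite ler_pM2l //.
  have le_norm : `|2 * pi * h * (f x)%:~R| <= 2 * pi * M * `|h|.
    rewrite !normrM (ger0_norm (ltW pi0)) [`|2|]ger0_norm // [leLHS]mulrAC.
    by rewrite ler_wpM2r // ler_wpM2l ?fM // mulr_ge0 // ltW.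
  by rewrite -real_normK ?num_real // ler_pXn2r ?nnegrE // (le_trans _ le_norm).
have M2 : 0 < 2 * (2 * pi * M * `|h|) ^+ 2 by rewrite mulr_gt0 // exprn_gt0 // !mulr_gt0.
apply: (le_lt_trans (Phi_bound PhiI M2 kC kM)).
have -> : 2 * (2 * (2 * pi * M * `|h|) ^+ 2) = `|h| * K * `|h| by rewrite /K; ring.
by rewrite ltr_pM2r.
Qed.

Lemma is_delta_unique (alpha : RZ R -> OA -> OA) (t : RZ R) d d' :
  is_delta S alpha t d -> is_delta S alpha t d' -> d = d'.
Proof. by move=> h h'; exact: (cvg_unique _ h h'). Qed.

(** The function [f] is nonnegative exactly when its spectrum, the set of its
    (integer) values, is. *)
Lemma positive_Phi f : positive (Phi (CZ_complex f)) <-> forall x, 0 <= f x.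
Proof.
have fC := Cfun_CZ_complex f.
have sub z : Phi (CZ_complex f) - z%:A = Phi (fun x => CZ_complex f x - z).
  by rewrite (PhiB PhiI) // ?(Phi_cst PhiI) //; exact: Cfun_cst.
split=> [[_ fpos] x|f0].
  have : 0 <= CZ_complex f x.
    apply: fpos => -[b [bl _]].
    have [n nP] := CZ_agree f x.
    have : proj_cyl (Phi := Phi) x n = 0.
      rewrite -[LHS]mul1r -bl -mulrA sub /proj_cyl -(PhiM PhiI); first last.
      - exact: Cfun_cylinder.
      - by apply: CfunD => //; exact: Cfun_cst.
      have -> : (fun y => (CZ_complex f y - CZ_complex f x) *
          \1_(cylinder (prefix_word x n)) y) = fun=> 0.
        apply/funext => y; rewrite cylinder_agree_ind.
        case: asboolP => [/nP fy|]; last by rewrite mulr0.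
        by rewrite /CZ_complex fy subrr mul0r.
      by rewrite (Phi0 PhiI) mulr0.
    move=> /(congr1 (@nrm R OA)); rewrite (proj_cyl_nrm PhiI) nrm0 => /eqP.
    by rewrite oner_eq0.
  by rewrite ler0c ler0z.
split.
  rewrite -(Phi_conj PhiI) //; congr Phi; apply/funext => x.
  exact: conjc_real.
move=> z; apply: contraPT => zneg; rewrite /spectrum /=; apply: contra_notP => _.
pose k x := (CZ_complex f x - z)^-1.
have kC : Cfun k by exact: (Cfun_CZ (fun n : int => ((n%:~R : R)%:C%C - z)^-1) f).
have zC : Cfun (fun x => CZ_complex f x - z) by apply: CfunD => //; exact: Cfun_cst.
have nz x : CZ_complex f x - z != 0.
  rewrite subr_eq0; apply: contraNneq zneg => <-.
  by rewrite ler0c ler0z.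
exists (Phi k); rewrite sub -!(PhiM PhiI) // -(Phi1 PhiI).
by split; congr Phi; apply/funext => x; rewrite /k ?mulVf ?mulfV.
Qed.

Lemma twist_nonneg (alpha : RZ R -> OA -> OA) f :
  (forall t i, alpha t (S i) = U Phi t f * S i) ->
  action_nonneg S alpha <-> forall x, 0 <= f x.
Proof.
move=> alphaS; have delta := twist_delta alphaS; rewrite -positive_Phi.
have inv : (0 +i* (2 * pi))%C^-1 *: ((0 +i* (2 * pi))%C *: Phi (CZ_complex f))
    = Phi (CZ_complex f).
  by rewrite scalerA mulVf ?scale1r // two_pi_i_neq0.
split=> [[d dd]|f0]; first by rewrite (is_delta_unique dd delta) inv.
by exists ((0 +i* (2 * pi))%C *: Phi (CZ_complex f)) => //; rewrite inv.
Qed.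

End Order.

(** * The isomorphism of ordered groups *)

Section DimensionGroup.
Context {N : nat} {A : 'M[nat]_N}.
Implicit Types (f g : CZ (XA A)).

Lemma HA_class_eq f g :
  HA_class f = HA_class g <-> f - g \in coboundary (A := A).
Proof.
have E : (f - g \in coboundary (A := A)) = (HA_class f == HA_class g) :=
  Quotient.idealrBE _ f g.
by rewrite E; split=> /eqP.
Qed.

Lemma HA_classD f g : HA_class (f + g) = HA_class f + HA_class g.
Proof. by rewrite /HA_class !piE. Qed.

Lemma HA_class_surj (h : HA A) : exists f, HA_class f = h.
Proof. by exists (repr (h : Quotient.quot (coboundary (A := A)))); exact: reprK. Qed.

End DimensionGroup.

Unset Implicit Arguments.

Theorem proposition2p4 (R : realType) (N : nat) (A : 'M[nat]_N)
  (N_gt1 : (1 < N)%N)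
  (A01 : forall i j, A i j = 0%N \/ A i j = 1%N)
  (A_irr : irreducible_mx A)
  (A_nperm : ~~ is_perm_mx A)
  (OA : cstarType R) (S : 'I_N -> OA) (OA_ck : cuntz_krieger A S)
  (Phi : (XA A -> R[i]) -> OA) (Phi_ident : diag_identification S Phi) :
  exists rho : CZ (XA A) -> RZ R -> OA -> OA,
    [/\ forall f t i, rho f t (S i) = U Phi t f * S i,
        set_bij setT (diag_action S) rho,
        forall f g, rho (f + g) = action_mul (rho f) (rho g)
      & exists Psi : HA A -> set (RZ R -> OA -> OA),
          [/\ forall f, Psi (HA_class f) = action_class S (rho f),
              set_bij setT (action_classes S) Psi,
              forall x y, Psi (x + y) = class_mul S (Psi x) (Psi y)
            & forall x, HA_nonneg x <-> class_nonneg S (Psi x)]].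
Proof.
have diag_max : diag_commutant S `<=` diag_alg S.
  by move=> t; exact: (diag_maximal_abelian OA_ck Phi_ident A01 A_irr A_nperm).
have [rho rhoP] := twist_action_exists OA_ck Phi_ident.
have rhoS f t i : rho f t (S i) = U Phi t f * S i by have [_ ->] := rhoP f t.
have rho_diag := twist_diag_action OA_ck Phi_ident rhoP.
have rho_surj := twist_surj OA_ck Phi_ident rhoP diag_max.
have rho_equiv := twist_equiv OA_ck Phi_ident rhoP diag_max.
have rho_class := twist_class OA_ck Phi_ident rhoP diag_max.
have rho_add := twist_add OA_ck Phi_ident rhoP.
exists rho; split=> //.
  split=> [f _|f g _ _|alpha /rho_surj[f <-]]; [exact: rho_diag| |by exists f].
  exact: (twist_inj OA_ck Phi_ident rhoP).
have class_eq f g : f - g \in coboundary (A := A) ->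
    action_class S (rho f) = action_class S (rho g).
  move=> fg; rewrite !rho_class; congr (_ @` _); apply/seteqP; split=> k /= kf.
    by rewrite -(subrK f k) -addrA rpredD.
  by rewrite -(subrK g k) -addrA rpredD // -opprB rpredN.
have class_rep f : action_class S (rho f) (rho f).
  by rewrite rho_class; exists f => //=; rewrite subrr rpred0.
have /choice[rep repE] := @HA_class_surj N A.
pose Psi h := action_class S (rho (rep h)).
have PsiE f : Psi (HA_class f) = action_class S (rho f).
  by apply: class_eq; apply/HA_class_eq; rewrite repE.
exists Psi; split=> [//||x y|x].
- split=> [h _|h k _ _|_ [_ /rho_surj[f <-] <-]].
  + by exists (rho (rep h)).
  + rewrite -(repE h) -(repE k) !PsiE => hk.
    apply/HA_class_eq; have := class_rep (rep h); rewrite hk => -[_].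
    by move/rho_equiv.
  + by exists (HA_class f).
- rewrite -(repE x) -(repE y) -HA_classD !PsiE; set f := rep x; set g := rep y.
  rewrite !rho_class; apply/seteqP; split=> [_ [k kfg <-]|gamma].
    split; first exact: rho_diag.
    exists (rho f), (rho g); split.
    + by exists f => //=; rewrite subrr rpred0.
    + by exists g => //=; rewrite subrr rpred0.
    + by rewrite -rho_add; apply/rho_equiv.
  move=> [/rho_surj[k <-] [_ [_ [[f' /= ff' <-] [g' /= gg' <-]]]]].
  rewrite -rho_add => /rho_equiv kfg; exists k => //=.
  rewrite -(subrK (f' + g') k) -addrA rpredD //.
  by rewrite opprD addrACA rpredD.
- rewrite -(repE x) PsiE rho_class; split=> [[f f0 /HA_class_eq xf]|].
    exists (rho f); first by exists f => //=; rewrite -opprB rpredN.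
    by apply/(twist_nonneg OA_ck Phi_ident (rhoS f)).
  move=> [_ [f /= fx <-] /(twist_nonneg OA_ck Phi_ident (rhoS f)) f0].
  by exists f => //; apply/HA_class_eq; rewrite -opprB rpredN.
Qed.
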